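(* Let $a<b$ be coprime positive integers and let $L$ be any $(a,b)$-rational alt Tamari lattice. Then the order of rowmotion $\operatorname{row}\colon L\to L$ divides $a+b-1$. Moreover, the triple $(L,\mathbb{Z}/(a+b-1)\mathbb{Z},\operatorname{Cat}_q(a,b))$ exhibits cyclic sieving, where the generator of $\mathbb{Z}/(a+b-1)\mathbb{Z}$ acts on $L$ as $\operatorname{row}$ and $$\operatorname{Cat}_q(a,b)=\frac{1}{[a+b]_q}\binom{a+b}{b}_q .$$
   Context: All posets are finite. Cyclic sieving. If $X$ is a finite set acted upon by a cyclic group $C=\langle c\rangle\simeq\mathbb{Z}/N\mathbb{Z}$ and $f\in\mathbb{N}[q]$, the triple $(X,C,f)$ exhibits cyclic sieving if for all $k\ge 0$ the number of $x\in X$ fixed by $c^k$ equals $f(\zeta^k)$, where $\zeta=e^{2\pi i/N}$. Notation: $[n]_q=1+q+\cdots+q^{n-1}$, $[n]_q!=[n]_q[n-1]_q\cdots[1]_q$, $\binom{n}{k}_q=\frac{[n]_q!}{[k]_q!\,[n-k]_q!}$. The rational $q$-Catalan number $\operatorname{Cat}_q(a,b)$ is a polynomial in $q$ with nonnegative integer coefficients. Alt $\nu$-Tamari lattices. Lattice paths use unit east steps $E$ and north steps $N$. Write $\nu=E^{\nu_0}NE^{\nu_1}N\cdots NE^{\nu_n}$, encoded as $(\nu_0,\dots,\nu_n)$. A $\nu$-Dyck path is a lattice path with the same endpoints as $\nu$ lying weakly above $\nu$. An increment vector with respect to $\nu$ is a sequence $\delta=(\delta_1,\dots,\delta_n)$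 of nonnegative integers with $\delta_i\le\nu_i$ for all $i$. For a $\nu$-Dyck path $\mu$, the $\delta$-altitude of its lattice points is defined as follows: the starting point has altitude $0$, each east step decreases the altitude by $1$, and the $i$-th north step of $\mu$ increases it by $\delta_i$. For a valley $EN$ of $\mu$, let $p$ be the lattice point between these two steps, let $q$ be the next lattice point of $\mu$ after $p$ with the same $\delta$-altitude as $p$, and let $\mu[p,q]$ be the subpath from $p$ to $q$. The $\delta$-rotation of $\mu$ at this valley is the path $\mu'$ obtained from $\mu$ by exchanging $\mu[p,q]$ with the east step immediately preceding it; write $\mu\lessdot_\delta\mu'$. The alt $\nu$-Tamari lattice $\operatorname{Tam}_{\nu}(\delta)$ is the set of $\nu$-Dyck paths ordered by the reflexive transitive closure of $\lessdot_\delta$; it is a semidistributive lattice whose cover relations are exactly the $\delta$-rotations. Rational case. For coprime positive integers $a<b$, let $\nu$ be the lowest lattice path with north and east steps that connects the lower-left and upper-right corners of a rectangle of height $a$ and width $b$ and stays weakly above the diagonal line connecting these two corners. The $(a,b)$-rational alt Tamari lattices are the lattices $\operatorname{Tam}_{\nu}(\delta)$ for this $\nu$ and any increment vector $\delta$ with respect to $\nu$. Rowmotion. A lattice $L$ is semidistributive if for all $x,y,z\in L$: $x\vee y=x\vee z$ implies $x\vee(y\wedge z)=x\vee y$, and $x\wedge y=x\wedge z$ implies $x\wedge(y\vee z)=x\wedge y$. In a semidistributive lattice $L$, for each cover relation $x\lessdot y$ the set $\{z\in L: z\vee x=y\}$ has a minimum element $j_{x,y}$, which is join-irreducible. Let $\mathcal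 D_L(x)=\{j_{w,x}:w\lessdot x\}$ and $\mathcal U_L(x)=\{j_{x,w}:x\lessdot w\}$. The maps $\mathcal D_L$ and $\mathcal U_L$ are injective and have the same image, so there is a unique bijection $\operatorname{row}\colon L\to L$ (rowmotion) with $\mathcal U_L(x)=\mathcal D_L(\operatorname{row}(x))$ for all $x\in L$. *)

(* Defs.v *)
From mathcomp Require Import all_boot all_order all_algebra all_fingroup.
From mathcomp Require Import reals trigo complex.

Set Implicit Arguments.
Unset Strict Implicit.
Unset Printing Implicit Defensive.

(** * Rowmotion on a finite lattice given by its order relation *)

Section Rowmotion.
Context {T : finType} (le : rel T).

Definition covers (x y : T) : bool :=
  [&& le x y, x != y &
      [forall z, le x z && le z y ==> (z == x) || (z == y)]].

Definition is_join (x y z : T) : bool :=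
  [&& le x z, le y z & [forall u, le x u && le y u ==> le z u]].

(* [j] is j_{x,y}, the minimum of { z | z \/ x = y } *)
Definition is_cover_label (x y j : T) : bool :=
  is_join j x y && [forall z, is_join z x y ==> le j z].

Definition down_labels (x : T) : {set T} :=
  [set j | [exists w, covers w x && is_cover_label w x j]].

Definition up_labels (x : T) : {set T} :=
  [set j | [exists w, covers x w && is_cover_label x w j]].

(* The default value 1 is never used when [le] is the order of a finite
   semidistributive lattice: there such a permutation exists and is unique. *)
Definition rowmotion : {perm T} :=
  odflt 1%g
    [pick s : {perm T} | [forall x, up_labels x == down_labels (s x)]].

End Rowmotion.

(** * Lattice paths, as words in the steps E and N *)

Notation stepE := false (only parsing).
Notation stepN := true (only parsing).

(* The k-th lattice point of [p] is (east p k, north p k), for k <= size p. *)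
Definition east (p : seq bool) (k : nat) : nat := count_mem stepE (take k p).
Definition north (p : seq bool) (k : nat) : nat := count_mem stepN (take k p).

Definition weakly_above (p p' : seq bool) : bool :=
  [forall i : 'I_(size p).+1, exists j : 'I_(size p').+1,
     (east p' j == east p i) && (north p' j <= north p i)].

Definition same_endpoints (p p' : seq bool) : bool :=
  (count_mem stepE p == count_mem stepE p') && (count_mem stepN p == count_mem stepN p').

(* (nu_0, ..., nu_n) |-> E^{nu_0} N E^{nu_1} N ... N E^{nu_n} *)
Definition path_of (nu : seq nat) : seq bool :=
  nseq (head 0 nu) stepE ++ flatten [seq stepN :: nseq k stepE | k <- behead nu].

Definition is_dyck (nu : seq nat) (p : seq bool) : bool :=
  same_endpoints p (path_of nu) && weakly_above p (path_of nu).

Definition dyck_path (nu : seq nat) : finType :=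
  {p : (size (path_of nu)).-tuple bool | is_dyck nu p}.

(** * Alt nu-Tamari lattices *)

(* delta = (delta_1, ..., delta_n); [all2] also forces the lengths to agree. *)
Definition increment_vector (nu delta : seq nat) : bool :=
  all2 leq delta (behead nu).

Definition altitude (delta : seq nat) (p : seq bool) (k : nat) : int :=
  ((sumn (take (north p k) delta))%:Z - (east p k)%:Z)%R.

(* The valley EN is formed by the steps of indices i and i+1, so its lattice
   point is the one of index i+1; the next point of the same altitude is the
   one of index j. *)
Definition rotates (delta : seq nat) (p p' : seq bool) : bool :=
  [exists i : 'I_(size p).+1, exists j : 'I_(size p).+1,
    [&& i.+1 < j,
        nth stepN p i == stepE,
        nth stepE p i.+1 == stepN,
        altitude delta p j == altitude delta p i.+1,
        [forall k : 'I_(size p).+1,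
           (i.+1 < k) && (k < j) ==> (altitude delta p k != altitude delta p i.+1)] &
        p' == take i p ++ drop i.+1 (take j p) ++ stepE :: drop j p]].

Definition alt_tamari_le (nu delta : seq nat) : rel (dyck_path nu) :=
  connect (fun p p' : dyck_path nu => rotates delta (val p) (val p')).

(** * The rational case *)

Definition path_to (a b : nat) (p : seq bool) : bool :=
  (count_mem stepN p == a) && (count_mem stepE p == b).

(* weakly above the segment from (0, 0) to (b, a) *)
Definition above_diagonal (a b : nat) (p : seq bool) : bool :=
  [forall k : 'I_(size p).+1, a * east p k <= b * north p k].

Definition lowest_above_diagonal (a b : nat) (p : seq bool) : Prop :=
  [/\ path_to a b p, above_diagonal a b p &
      forall p', path_to a b p' -> above_diagonal a b p' -> weakly_above p' p].

(** * q-analogues and cyclic sieving *)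

Local Open Scope ring_scope.

Definition qint (n : nat) : {poly int} := \sum_(i < n) 'X^i.
Definition qfact (n : nat) : {poly int} := \prod_(1 <= i < n.+1) qint i.

(* Divisors are monic and the divisions exact, so [%/] is the true quotient. *)
Definition qbinomial (n k : nat) : {poly int} :=
  qfact n %/ (qfact k * qfact (n - k)).
Definition qCatalan (a b : nat) : {poly int} :=
  qbinomial (a + b) b %/ qint (a + b).

(* e^{2 pi i / n} *)
Definition zeta (R : realType) (n : nat) : R[i] :=
  (cos (2 * pi / n%:R) +i* sin (2 * pi / n%:R))%C.

(* The generator of Z/nZ acts on T as c. Nonnegativity of the coefficients of f
   plays no role in the condition, so f is allowed to be any integer
   polynomial. *)
Definition cyclic_sieving (R : realType) (T : finType) (n : nat)
    (c : {perm T}) (f : {poly int}) : Prop :=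
  (#[c]%g %| n)%N /\
  forall k : nat,
    #|[set x | (c ^+ k)%g x == x]|%:R
      = (map_poly intr f).[zeta R n ^+ k] :> R[i].

(* Main.v *)
Require Import Defs.
From mathcomp Require Import all_boot all_order all_algebra all_fingroup.
From mathcomp Require Import cyclic pgroup sylow.
From mathcomp Require Import reals trigo complex.
From mathcomp Require Import zify ring lra.

(** Rowmotion on an alt nu-Tamari lattice is conjugate, through a bijection that
    depends on the increment vector, to one promotion operator on lattice paths
    that does not depend on it. In the rational case the fixed points of powers
    of promotion are counted by comparison with the rotation of binary words of
    length a + b - 1.

    Coordinates. Each east step of a path either takes the altitude to a new
    minimum or loses one of the units that a north step has gained; give it the
    number of north steps after it. These numbers turn the lattice into a family
    of vectors, ordered by the reverse coordinatewise order and closed under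
    coordinatewise maxima ([meet_ex]), in which a rotation lowers one coordinate
    e from c+1 to at most c ([rotation_heights]) and every comparable pair
    starts with a rotation ([rotation_ex]). Then the label of a cover is the
    least element whose coordinate e is at most c, and an element is the join of
    its lower labels. So rowmotion is the only permutation that turns the pairs
    (e, c) of the rotations leaving x into those of the rotations entering its
    image ([rowmotion_unique]). The map [row_comp], defined by recursion on the
    north steps, does this ([up_down_row]).

    Straightening. A path E^p N m, with m the part after a north step of gain d,
    is sent to the path with m replaced by its image under d+1 rowmotions, and
    one continues inside the new m. Each rowmotion moves an insertion point one
    unit of altitude closer to the start of m ([row_comp_ins], [row_comp_run]),
    so the first point of altitude -d, where rowmotion changes m, is brought to
    the front of m. What remains is an operation free of altitudes
    ([untwist_row]).

    Promotion. In the rational case write a path as r E. The operation removes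
    the first N of this path, changes into N the first E that would now go below
    the diagonal, and appends an E ([diagonal_promote]). If G and X are two
    words that stay above the line and G X has as many letters of each kind as
    r, then |G| promotions turn G X into X G ([exchangeP]); with X empty this
    shows that a + b - 1 promotions are the identity. The same induction shows
    that the words rot^(-t) (promote^t r) take at most b values. Counting
    rotations of the paths r E and all words with a letters N among a + b - 1
    shows that these sets of values, one for each r, have exactly b elements and
    partition the words ([card_cutsE], [cuts_unique]).

    Fixed points. Let d k = a + b - 1 and let r be fixed by k promotions. For a
    prime p dividing d, the rotation by (a + b - 1) / p acts on the b words
    attached to r with at most one fixed point, since two words with such a
    rotational symmetry in the same set agree ([fix_cut_unique]). Hence b is
    congruent to 0 or 1 modulo p. If it is 1, the fixed word is unique, so it is
    fixed by the rotation by k too; this matches the r fixed by k promotions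
    with the words fixed by that rotation, of which there are binomial(k, a/d)
    if d divides a, and none otherwise ([card_fix_dvd]). If it is 0, exchange a
    and b by reversing paths ([card_fixed]). These numbers are the values of the
    q-Catalan polynomial at primitive d-th roots of unity ([qeval_div],
    [qeval_ndiv]). *)

Set Implicit Arguments.
Unset Strict Implicit.
Unset Printing Implicit Defensive.

Import Order.TTheory GRing.Theory Num.Theory.

(** * Rowmotion from coordinates *)

Section Coordinates.
Variables (T : finType) (le : rel T) (n : nat) (g : T -> nat -> nat).
(* Edges are the covers; the label of a cover only depends on the pair (e, c) of
   its edge. *)
Variable edge : T -> T -> nat -> nat -> Prop.
Hypothesis leP : forall x y, reflect (forall i, g y i <= g x i) (le x y).
Hypothesis g_inj : forall x y, (forall i, g x i = g y i) -> x = y.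
Hypothesis g_dim : forall x i, n <= i -> g x i = 0.
Hypothesis meetP : forall x y, exists z, forall i, g z i = maxn (g x i) (g y i).
Hypothesis edge_at : forall x y e c, edge x y e c ->
  [/\ g x e = c.+1, g y e <= c & forall i, i != e -> g y i = g x i].
Hypothesis edge_ex : forall x y, le x y -> x != y ->
  exists z e c, edge x z e c /\ le z y.
Hypothesis edge_fun : forall x y y' e c, edge x y e c -> edge x y' e c -> y = y'.

Lemma coord_le_refl x : le x x.
Proof. exact/leP. Qed.

Lemma coord_le_trans : transitive le.
Proof.
by move=> y x z /leP H1 /leP H2; apply/leP => i; apply: leq_trans (H2 i) (H1 i).
Qed.

Lemma coord_le_anti x y : le x y -> le y x -> x = y.
Proof.
by move=> /leP H1 /leP H2; apply: g_inj => i; apply/eqP; rewrite eqn_leq H1 H2.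
Qed.

Lemma edge_le x y e c : edge x y e c -> le x y.
Proof.
move/edge_at => [gx gy H]; apply/leP => i.
by have [->|/H->] := eqVneq i e => //; lia.
Qed.

Lemma edge_neq x y e c : edge x y e c -> x != y.
Proof. by move/edge_at => [gx gy _]; apply/eqP => E; move: gx gy; rewrite E; lia. Qed.

(** An element strictly above [x] and below [y] is above the end of some edge
    from [x]; that edge can only lower the coordinate [e], from the same value,
    so it is the edge to [y]. *)
Lemma edge_between x y z e c : edge x y e c -> le x z -> le z y -> x != z -> z = y.
Proof.
move=> xy xz zy nxz; have [z1 [e1 [c1 [xz1 z1z]]]] := edge_ex xz nxz.
have [gx gy H] := edge_at xy; have [gx1 gz1 _] := edge_at xz1.
have /leP/(_ e1) yz1 := coord_le_trans z1z zy.
have e1e : e1 = e by apply/eqP; case: eqVneq => // /H; lia.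
have c1c : c1 = c by move: gx1; rewrite e1e gx => -[].
rewrite e1e c1c in xz1; rewrite -(edge_fun xz1 xy) in zy *.
exact: coord_le_anti.
Qed.

Lemma coversE x y : reflect (exists e c, edge x y e c) (covers le x y).
Proof.
apply: (iffP and3P) => [[xy nxy /forallP H]|[e [c xy]]].
  have [z [e [c [xz zy]]]] := edge_ex xy nxy.
  move: (H z); rewrite (edge_le xz) zy => /orP[/eqP E|/eqP E].
    by have := edge_neq xz; rewrite E eqxx.
  by exists e, c; rewrite -E.
split; [exact: edge_le xy | exact: edge_neq xy |].
apply/forallP => z; apply/implyP => /andP[xz zy].
have [//|nxz] := eqVneq x z.
by rewrite (edge_between xy xz zy nxz) eqxx.
Qed.

Definition least_below e c j := g j e <= c /\ forall z, g z e <= c -> le j z.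

(** Coordinatewise maxima keep the coordinate [e] at most [c], so an element of
    largest coordinate sum is below all the others. *)
Lemma least_below_ex e c z : g z e <= c -> exists j, least_below e c j.
Proof.
pose P := [pred x | g x e <= c]; pose W x := \sum_(i < n) g x i.
move=> Pz; have Pz' : P z by [].
case: (arg_maxnP W Pz') => j Pj jmax; exists j; split=> // w Pw.
have [m mE] := meetP j w.
have Pm : P m by rewrite /P /= mE geq_max Pw andbT; exact: Pj.
have Wm : forall i : 'I_n, true -> g j i <= g m i ?= iff (g j i == g m i).
  by move=> i _; split=> //; rewrite mE leq_maxl.
have /forallP E : [forall (i : 'I_n | true), g j i == g m i].
  by rewrite -(leqif_sum Wm).2 eqn_leq (leqif_sum Wm).1; apply: jmax.
have jm : j = m.
  apply: g_inj => i; have [iN|iN] := ltnP i n; last by rewrite !g_dim.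
  by apply/eqP; exact: (E (Ordinal iN)).
by apply/leP => i; rewrite jm mE leq_maxr.
Qed.

(** An element [z] below [y] whose coordinate [e] exceeds [c] is already below
    [x], so it does not join with [x] to [y]; the other ones below [y] do. *)
Lemma cover_labelE x y e c j : edge x y e c ->
  is_cover_label le x y j <-> least_below e c j.
Proof.
move=> xy; have [gx gy H] := edge_at xy.
have [j0 [j0c j0min]] := least_below_ex gy.
have joinJ : is_join le j0 x y.
  apply/and3P; split; [exact: j0min | exact: edge_le xy |].
  apply/forallP => u; apply/implyP => /andP[j0u xu].
  have [m mE] := meetP u y.
  have mu : le m u by apply/leP => i; rewrite mE leq_maxl.
  have my : le m y by apply/leP => i; rewrite mE leq_maxr.
  have xm : le x m.
    by apply/leP => i; rewrite mE geq_max; move/leP: xu => ->; move/leP: (edge_le xy) => ->.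
  suff -> : y = m by [].
  apply/esym/(edge_between xy xm my)/eqP => E.
  move/leP: j0u => /(_ e) ue; have := mE e; rewrite -E gx; move: ue j0c gy; lia.
have minJ z : is_join le z x y -> le j0 z.
  case/and3P=> zy _ /forallP ub; apply: j0min; rewrite leqNgt; apply/negP => cz.
  have zx : le z x.
    apply/leP => i; have [->|ie] := eqVneq i e; first by rewrite gx.
    by rewrite -H //; apply/leP.
  have := ub x; rewrite zx coord_le_refl /= => yx.
  by have := edge_neq xy; rewrite (coord_le_anti (edge_le xy) yx) eqxx.
split=> [/andP[jj /forallP jmin]|[jc jmin]].
  have -> : j = j0 by apply: coord_le_anti (minJ _ jj); have := jmin j0; rewrite joinJ.
  by split.
have -> : j = j0 by apply: coord_le_anti; [exact: jmin | exact: j0min].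
by apply/andP; split=> //; apply/forallP => z; apply/implyP; apply: minJ.
Qed.

Lemma up_labelsP x j : reflect (exists y e c, edge x y e c /\ least_below e c j)
  (j \in up_labels le x).
Proof.
rewrite inE; apply: (iffP existsP) => [[y /andP[/coversE[e [c xy]] L]]|[y [e [c [xy L]]]]].
  by exists y, e, c; split=> //; apply/(cover_labelE _ xy).
exists y; apply/andP; split; first by apply/coversE; exists e, c.
by apply/(cover_labelE _ xy).
Qed.

Lemma down_labelsP x j : reflect (exists y e c, edge y x e c /\ least_below e c j)
  (j \in down_labels le x).
Proof.
rewrite inE; apply: (iffP existsP) => [[y /andP[/coversE[e [c xy]] L]]|[y [e [c [xy L]]]]].
  by exists y, e, c; split=> //; apply/(cover_labelE _ xy).
exists y; apply/andP; split; first by apply/coversE; exists e, c.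
by apply/(cover_labelE _ xy).
Qed.

Lemma edge_below x y : le x y -> x != y -> exists w e c, edge w y e c /\ le x w.
Proof.
pose W x := \sum_(i < n) g x i.
have [m] := ubnP (W x); elim: m x => // m IH x Wm xy nxy.
have [z [e [c [xz zy]]]] := edge_ex xy nxy.
have [E|nzy] := eqVneq z y; first by exists x, e, c; rewrite -E; split=> //; apply: coord_le_refl.
have Wz : W z < W x.
  have [gx gz H] := edge_at xz.
  have en : e < n by rewrite ltnNge; apply/negP => /(g_dim x); rewrite gx.
  rewrite /W (bigD1 (Ordinal en)) // [X in _ < X](bigD1 (Ordinal en)) //= gx.
  by rewrite (eq_bigr (fun i : 'I_n => g x i)) => [|i ie]; [lia | exact: H].
have [w [e' [c' [wy zw]]]] := IH z (leq_trans Wz (ltnSE Wm)) zy nzy.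
by exists w, e', c'; split=> //; apply: coord_le_trans zw; apply: edge_le xz.
Qed.

(** If [z] is above all lower labels of [x] but not above [x], the meet of [x]
    and [z] is below a lower cover [w] of [x]. The label of this cover is below
    [z] while its coordinate [e] is at most [c], which contradicts the large
    coordinate [e] of the meet. *)
Lemma down_labels_le x z : (forall j, j \in down_labels le x -> le j z) -> le x z.
Proof.
move=> H; have [m mE] := meetP x z.
have mx : le m x by apply/leP => i; rewrite mE leq_maxl.
have mz : le m z by apply/leP => i; rewrite mE leq_maxr.
have [<-|nmx] := eqVneq m x => //.
have [w [e [c [wx mw]]]] := edge_below mx nmx.
have [gw gx _] := edge_at wx; have [j [jc jmin]] := least_below_ex gx.
have jz : le j z by apply/H/down_labelsP; exists w, e, c.
have := mE e; move/leP: mw => /(_ e); rewrite gw; move/leP: jz => /(_ e); lia.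
Qed.

Lemma down_labels_inj : injective (down_labels le).
Proof.
move=> x y E; have jx z j : j \in down_labels le z -> le j z.
  by move=> /down_labelsP[w [e [c [wz [_ jmin]]]]]; apply: jmin; have [] := edge_at wz.
by apply: coord_le_anti; apply: down_labels_le => j; [rewrite E | rewrite -E]; apply: jx.
Qed.

(** A label depends only on the pair [(e, c)], so the upper labels of [x] are
    the lower labels of [s x]; no other permutation has this property because
    the lower labels of an element determine it. *)
Theorem rowmotion_unique (s : {perm T}) :
  (forall x e c, (exists y, edge x y e c) <-> (exists y, edge y (s x) e c)) ->
  rowmotion le = s.
Proof.
move=> H; have ud x : up_labels le x = down_labels le (s x).
  apply/setP => j; apply/up_labelsP/down_labelsP => [[y [e [c [xy L]]]]|[y [e [c [xy L]]]]].
    by have [|y' xy'] := (H x e c).1; [exists y | exists y', e, c].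
  by have [|y' xy'] := (H x e c).2; [exists y | exists y', e, c].
rewrite /rowmotion; case: pickP => [t /forallP Ht|/(_ s)/negP[]] /=; last first.
  by apply/forallP => x; rewrite ud.
by apply/permP => x; apply: down_labels_inj; rewrite -ud; apply/esym/eqP.
Qed.

End Coordinates.

(** * Recursive rowmotion and promotion of compositions *)

(** A part of a path that starts after a north step, or at the origin, is given
    by the numbers [mu] of east steps in its rows and the altitude gains [ds] of
    its north steps; altitudes are measured from its first point. [ins j c]
    inserts [j] east steps at the first point of altitude [-c]. *)
Fixpoint ins (j c : nat) (ds mu : seq nat) : seq nat :=
  if mu is q :: mu' then
    if c <= q then q + j :: mu'
    else if ds is d :: ds' then q :: ins j (c - q + d) ds' mu' else mu
  else [::].

(** Removes [k] of the east steps that follow the first point of altitude [-c].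
    *)
Fixpoint del (k c : nat) (ds mu : seq nat) : seq nat :=
  if mu is q :: mu' then
    if c <= q then q - k :: mu'
    else if ds is d :: ds' then q :: del k (c - q + d) ds' mu' else mu
  else [::].

(** Number of consecutive east steps from the first point of altitude [-c]. *)
Fixpoint run (c : nat) (ds mu : seq nat) : nat :=
  if mu is q :: mu' then
    if c <= q then q - c
    else if ds is d :: ds' then run (c - q + d) ds' mu' else 0
  else 0.

(** The condition to stay weakly above a path: at least [b_i] east steps come
    after the [i]-th north step. *)
Fixpoint valid (bs mu : seq nat) : bool :=
  match bs, mu with
  | [::], [:: _] => true
  | b :: bs', _ :: mu' => (b <= sumn mu') && valid bs' mu'
  | _, _ => false
  end.

(** With [b_i] east steps of nu after its [i]-th north step, this is the
    condition [delta_i <= nu_i]. *)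
Fixpoint adm (ds bs : seq nat) : bool :=
  match ds, bs with
  | [::], [::] => true
  | d :: ds', b :: bs' => (d + head 0 bs' <= b) && adm ds' bs'
  | _, _ => false
  end.

(** After rowmotion of the part behind the first north step, the rotation at the
    first valley is performed when the path starts with an east step; otherwise
    as many of these rotations as possible are undone. *)
Fixpoint row_comp (ds bs mu : seq nat) : seq nat :=
  match ds, bs, mu with
  | d :: ds', b :: bs', p :: mu' =>
    let m := row_comp ds' bs' mu' in
    if p is p'.+1 then p' :: ins 1 d ds' m
    else let k := minn (run d ds' m) (sumn m - b) in k :: del k d ds' m
  | _, _, _ => mu
  end.

Ltac split_tests :=
  rewrite /=;
  repeat match goal with
  | |- context [if ?a <= ?b then _ else _] => case: (leqP a b) => ? /=
  end; try lia.

Lemma size_ins j c ds mu : size (ins j c ds mu) = size mu.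
Proof. by elim: mu ds c => [|q mu IH] [|d ds] c //; split_tests; rewrite ?IH. Qed.

Lemma insK k c ds mu : del k c ds (ins k c ds mu) = mu.
Proof.
by elim: mu ds c => [|q mu IH] [|d ds] c //; split_tests; rewrite ?addnK ?IH.
Qed.

Lemma delK k c ds mu : k <= run c ds mu -> ins k c ds (del k c ds mu) = mu.
Proof.
elim: mu ds c => [|q mu IH] [|d ds] c //; split_tests => // H; try (congr (_ :: _); lia).
by rewrite IH.
Qed.

Lemma ins_inj k c ds : injective (ins k c ds).
Proof. by move=> x y /(congr1 (del k c ds)); rewrite !insK. Qed.

Lemma ins_ins k j d x ds mu : d <= x ->
  ins k d ds (ins j x ds mu) = ins j (x + k) ds (ins k d ds mu).
Proof.
elim: mu ds d x => [|q mu IH] [|d ds] c x // cx; split_tests; try (congr (_ :: _); lia).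
- by congr (_ :: _); congr ins; lia.
- by congr (_ :: _); rewrite IH; [congr ins; lia|lia].
Qed.

Lemma ins_add j k c ds mu : ins j c ds (ins k c ds mu) = ins (k + j) c ds mu.
Proof.
elim: mu ds c => [|q mu IH] [|d ds] c //; split_tests; try (congr (_ :: _); lia).
by rewrite IH.
Qed.

Lemma ins_within j k c d ds mu : c <= k ->
  ins j (d + c) ds (ins k d ds mu) = ins (k + j) d ds mu.
Proof.
elim: mu ds d => [|q mu IH] [|d' ds] d // ck; split_tests; try (congr (_ :: _); lia).
by congr (_ :: _); rewrite -IH //; congr ins; lia.
Qed.

Lemma run_ins_ge k d x ds mu : d <= x ->
  run (x + k) ds (ins k d ds mu) = run x ds mu.
Proof.
elim: mu ds d x => [|q mu IH] [|d ds] c x // cx; split_tests.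
- by congr run; lia.
- rewrite -(IH ds (c - q + d) (x - q + d)); last by lia.
  by congr run; lia.
Qed.

Lemma run_addl c d ds mu : c <= run d ds mu -> run (d + c) ds mu = run d ds mu - c.
Proof.
elim: mu ds d => [|q mu IH] [|d ds] x //; split_tests.
by move=> H; rewrite -IH //; congr run; lia.
Qed.

Lemma run_ins_out j c d ds mu : run d ds mu < c ->
  run d ds (ins j (d + c) ds mu) = run d ds mu.
Proof.
elim: mu ds d => [|q mu IH] [|d ds] x //; split_tests.
by move=> H; rewrite -[RHS](IH _ _ H); congr run; congr ins; lia.
Qed.

Lemma leq_run c ds mu : run c ds mu <= sumn mu.
Proof.
elim: mu ds c => [|q mu IH] [|d ds] c //; split_tests.
by apply: leq_trans (IH _ _) _; lia.
Qed.

Lemma sum_del k c ds mu : k <= run c ds mu -> sumn (del k c ds mu) = sumn mu - k.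
Proof.
elim: mu ds c => [|q mu IH] [|d ds] c //; split_tests.
move=> H; rewrite IH //; have := leq_run (c - q + d) ds mu; lia.
Qed.

(** Guarantees that the first point of altitude [-c] exists and that the bounds
    still hold after an insertion there. *)
Definition fits (ds bs : seq nat) (c : nat) (mu : seq nat) : bool :=
  [&& adm ds bs, valid bs mu & head 0 bs + c <= sumn mu].

Lemma fits_tail d ds b bs c q mu : q < c ->
  fits (d :: ds) (b :: bs) c (q :: mu) -> fits ds bs (c - q + d) mu.
Proof.
by rewrite /fits /= => cq /and3P[/andP[? ->] /andP[? ->]] /=; lia.
Qed.

Lemma fits_cons d ds b bs p mu : adm (d :: ds) (b :: bs) -> valid (b :: bs) (p :: mu) ->
  fits ds bs d mu.
Proof. by rewrite /fits /= => /andP[? ->] /andP[? ->] /=; lia. Qed.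

Lemma fitsW ds bs c c' mu : c' <= c -> fits ds bs c mu -> fits ds bs c' mu.
Proof. by rewrite /fits => ? /and3P[-> ->] /=; lia. Qed.

(** Follows the path down to its first point of altitude [-c]. *)
Lemma fits_ind (Q : seq nat -> seq nat -> nat -> seq nat -> Prop) :
  (forall c q, c <= q -> Q [::] [::] c [:: q]) ->
  (forall c d ds b bs q mu, c <= q -> fits (d :: ds) (b :: bs) c (q :: mu) ->
     Q (d :: ds) (b :: bs) c (q :: mu)) ->
  (forall c d ds b bs q mu, q < c -> fits (d :: ds) (b :: bs) c (q :: mu) ->
     fits ds bs (c - q + d) mu -> Q ds bs (c - q + d) mu ->
     Q (d :: ds) (b :: bs) c (q :: mu)) ->
  forall ds bs c mu, fits ds bs c mu -> Q ds bs c mu.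
Proof.
move=> Q0 Q1 Q2 ds bs c mu; elim: mu ds bs c => [|q mu IH] [|d ds] [|b bs] c.
- by rewrite /fits /= ?andbF.
- by rewrite /fits /= ?andbF.
- by rewrite /fits /= ?andbF.
- by rewrite /fits /= ?andbF.
- by case: mu {IH} => [|? ?] //; rewrite /fits /= addn0 => H; apply: Q0.
- by rewrite /fits /= ?andbF.
- by rewrite /fits /= ?andbF.
- move=> F; have [H|H] := leqP c q; first exact: Q1.
  have F' := fits_tail H F.
  by apply: Q2 => //; apply: IH.
Qed.

Lemma sum_ins j c ds bs mu : fits ds bs c mu -> sumn (ins j c ds mu) = sumn mu + j.
Proof. by elim/fits_ind: ds bs c mu / => *; split_tests. Qed.

Lemma valid_ins j c ds bs mu : fits ds bs c mu -> valid bs (ins j c ds mu).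
Proof.
elim/fits_ind: ds bs c mu / => [c q|c d ds b bs q mu|c d ds b bs q mu] H; split_tests.
- by case/and3P.
- move=> F F' V; rewrite (sum_ins _ F') V andbT.
  by case/and3P: F => _ /= /andP[]; lia.
Qed.

Lemma run_ins j c ds bs mu : fits ds bs c mu ->
  run c ds (ins j c ds mu) = run c ds mu + j.
Proof. by elim/fits_ind: ds bs c mu / => *; split_tests. Qed.

Lemma run_ins_in j c d ds bs mu : fits ds bs d mu -> c <= run d ds mu ->
  run d ds (ins j (d + c) ds mu) = run d ds mu + j.
Proof.
elim/fits_ind: ds bs d mu / => [x q|x d ds b bs q mu|x d ds b bs q mu] H; split_tests.
move=> F F' V H0; rewrite -V //; congr run; congr ins; lia.
Qed.

Lemma fits_del k c ds bs mu : fits ds bs c mu -> k <= run c ds mu ->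
  head 0 bs + c + k <= sumn mu -> fits ds bs c (del k c ds mu).
Proof.
move=> F K S; have A : adm ds bs by case/and3P: F.
rewrite /fits A sum_del //=; apply/andP; split; last by lia.
elim/fits_ind: ds bs c mu / F A K S => [x q|x d ds b bs q mu|x d ds b bs q mu] H; split_tests.
- by case/and3P.
move=> F F' V /andP[A1 A2] K S; rewrite V // ?sum_del //; try lia.
Qed.

Lemma row_comp_valid ds bs mu : adm ds bs -> valid bs mu ->
  valid bs (row_comp ds bs mu) /\ sumn (row_comp ds bs mu) = sumn mu.
Proof.
elim: ds bs mu => [|d ds IH] [|b bs] [|p mu] // A V.
have F := fits_cons A V; have /and3P[A' V' S'] := F.
have [Vm Sm] := IH _ _ A' V'.
have Vb : b <= sumn mu by case/andP: V.
have Fm : fits ds bs d (row_comp ds bs mu) by rewrite /fits A' Vm Sm.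
case: p V => [|p] V /=; last by rewrite (sum_ins _ Fm) (valid_ins _ Fm) Sm andbT; split; lia.
set k := minn _ _.
have kr : k <= run d ds (row_comp ds bs mu) by exact: geq_minl.
have kb : k <= sumn mu - b by rewrite -Sm; exact: geq_minr.
have A1 : d + head 0 bs <= b by case/andP: A.
rewrite sum_del // Sm; split; last lia.
have /and3P[_ -> _] : fits ds bs d (del k d ds (row_comp ds bs mu)) by apply: fits_del => //; lia.
by rewrite andbT; lia.
Qed.

(** Rowmotion brings an insertion point one unit of altitude closer to the
    start. *)
Lemma row_comp_ins j c ds bs mu : adm ds bs -> valid bs mu -> head 0 bs + c < sumn mu ->
  row_comp ds bs (ins j c.+1 ds mu) = ins j c ds (row_comp ds bs mu).
Proof.
elim: ds bs mu c => [|d ds IH] [|b bs] [|p mu] c // A V S.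
  by case: mu V S => //= _ H; split_tests.
have F := fits_cons A V; have /and3P[A' V' S'] := F.
have [Vm Sm] := row_comp_valid A' V'.
have Vb : b <= sumn mu by case/andP: V.
have A1 : d + head 0 bs <= b by case/andP: A.
have Fm : fits ds bs d (row_comp ds bs mu) by rewrite /fits A' Vm Sm.
set m := row_comp ds bs mu in Vm Sm Fm *.
case: p V S => [|p] V S /=.
  have -> : c.+1 - 0 + d = (d + c).+1 by lia.
  have Sc : b + c < sumn mu by exact: S.
  rewrite IH //; last by lia.
  have Fmc : fits ds bs (d + c) m by rewrite /fits A' Vm Sm /=; lia.
  rewrite -/m (sum_ins _ Fmc); set k := minn (run d ds m) _.
  have kr : k <= run d ds m by exact: geq_minl.
  have [ck|ck] := leqP c k.
  - rewrite (run_ins_in _ Fm); last by lia.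
    have -> : minn (run d ds m + j) (sumn m + j - b) = k + j by rewrite /k; lia.
    by rewrite -{1}(delK kr) ins_within // insK.
  - have kE : k = run d ds m by move: ck; rewrite /k; lia.
    rewrite run_ins_out -?kE //.
    have -> : minn k (sumn m + j - b) = k by move: ck; rewrite /k; lia.
    rewrite -{1}(delK kr).
    have -> : d + c = (d + (c - k)) + k by lia.
    rewrite -ins_ins ?insK; last by lia.
    by congr (_ :: ins _ _ _ _); lia.
have [cp|cp] := leqP c p.
  by split_tests; congr (_ :: _); lia.
split_tests.
have -> : c.+1 - p.+1 + d = (d + (c - p.+1)).+1 by lia.
have Sc : b + c < p.+1 + sumn mu by exact: S.
rewrite IH //; last by lia.
rewrite ins_ins; last by lia.
by congr (_ :: ins _ _ _ _); lia.
Qed.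

(** Like insertion points, runs of east steps move up by one unit of altitude.
    The comparison is capped by [s], as a run that uses up the margin over the
    bounds may change its length. *)
Lemma row_comp_run s c ds bs mu : adm ds bs -> valid bs mu -> head 0 bs + c + s < sumn mu ->
  minn (run c ds (row_comp ds bs mu)) s = minn (run c.+1 ds mu) s.
Proof.
elim: ds bs mu c => [|d ds IH] [|b bs] [|p mu] c // A V S.
  by case: mu V S => //= _ H; split_tests.
have F := fits_cons A V; have /and3P[A' V' S'] := F.
have [Vm Sm] := row_comp_valid A' V'.
have Vb : b <= sumn mu by case/andP: V.
have A1 : d + head 0 bs <= b by case/andP: A.
have Fm : fits ds bs d (row_comp ds bs mu) by rewrite /fits A' Vm Sm.
set m := row_comp ds bs mu in Vm Sm Fm *.
case: p V S => [|p] V S /=.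
  have -> : c.+1 - 0 + d = (d + c).+1 by lia.
  have Sc : b + c + s < sumn mu by exact: S.
  rewrite -(IH bs) //; last by lia.
  rewrite -/m; set k := minn (run d ds m) _.
  have kr : k <= run d ds m by exact: geq_minl.
  have [ck|ck] := leqP c k.
  - by rewrite run_addl; [rewrite /k; lia | lia].
  - have kE : k = run d ds m by move: ck; rewrite /k; lia.
    rewrite -[in RHS](delK kr).
    have -> : d + c = (d + (c - k)) + k by lia.
    rewrite run_ins_ge; last by lia.
    by congr (minn (run _ _ _) _); lia.
have [cp|cp] := leqP c p.
  by split_tests; congr (_ :: _); lia.
split_tests.
have -> : c.+1 - p.+1 + d = (d + (c - p.+1)).+1 by lia.
have Sc : b + c + s < p.+1 + sumn mu by exact: S.
rewrite -[in RHS](IH bs) //; last by lia.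
rewrite -[X in run X _ (ins _ _ _ _)]addn1.
by rewrite run_ins_ge; last lia.
Qed.

(** If the first entries are [q+1] and [0], the image of the first path has an
    east step that could be deleted behind the first north step, whereas the
    greedy deletion leaves no such step in the image of the second one. *)
Lemma row_comp_inj ds bs mu mu' : adm ds bs -> valid bs mu -> valid bs mu' ->
  sumn mu = sumn mu' -> row_comp ds bs mu = row_comp ds bs mu' -> mu = mu'.
Proof.
elim: ds bs mu mu' => [|d ds IH] [|b bs] [|p mu] [|p' mu'] // A.
have wlog_le q q' nu nu' : valid (b :: bs) (q :: nu) -> valid (b :: bs) (q' :: nu') ->
    sumn (q :: nu) = sumn (q' :: nu') -> q' <= q ->
    row_comp (d :: ds) (b :: bs) (q :: nu) = row_comp (d :: ds) (b :: bs) (q' :: nu') ->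
    q :: nu = q' :: nu'.
  move=> V V' S qq.
  have /and3P[A1 V1 S1] := fits_cons A V; have /and3P[_ V1' S1'] := fits_cons A V'.
  have [Vm Sm] := row_comp_valid A1 V1.
  have [Vm' Sm'] := row_comp_valid A1 V1'.
  have Fm : fits ds bs d (row_comp ds bs nu) by rewrite /fits A1 Vm Sm.
  have Fm' : fits ds bs d (row_comp ds bs nu') by rewrite /fits A1 Vm' Sm'.
  case: q V S qq => [|q] V S qq; case: q' V' S qq => [|q'] V' S qq //=.
  - set k := minn _ _; set k' := minn _ _ => -[kk].
    rewrite -kk => /(congr1 (ins k d ds)).
    rewrite !delK; [|by rewrite kk geq_minl|exact: geq_minl].
    by move=> E; rewrite (IH bs nu nu').
  - set k' := minn _ _ => -[kk].
    move/(congr1 (ins k' d ds)).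
    have kr : k' <= run d ds (row_comp ds bs nu') by exact: geq_minl.
    rewrite delK // ins_add => E.
    move: (E) => /(congr1 (run d ds)); rewrite (run_ins _ Fm) => Er.
    move: (E) => /(congr1 sumn); rewrite (sum_ins _ Fm) => Es.
    have : b <= sumn nu by case/andP: V.
    by move: kk kr; rewrite /k'; lia.
  - case=> qe /ins_inj E.
    by rewrite qe (IH bs nu nu') //; move: S; rewrite /= qe; lia.
move=> V V' S E; have [|/ltnW] := leqP p' p => qq.
  exact: wlog_le.
by apply/esym/wlog_le.
Qed.

(** A row that has east steps hands one over to the next row; an empty row takes
    as many as the bounds allow from the next one. *)
Fixpoint promote_comp (bs : seq nat) (mu : seq nat) {struct bs} : seq nat :=
  match bs, mu with
  | b :: bs', p :: q :: mu' =>
    if p is p'.+1 then p' :: promote_comp bs' (q.+1 :: mu')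
    else let k := minn q (q + sumn mu' - b) in k :: promote_comp bs' (q - k :: mu')
  | _, _ => mu
  end.

(** The number [d.+1] of rowmotions applied behind a north step is what it takes
    to move the first point of altitude [-d] to the front, together with the
    rowmotion that is part of [row_comp] itself. *)
Fixpoint untwist (ds bs mu : seq nat) : seq nat :=
  match ds, bs, mu with
  | d :: ds', b :: bs', p :: mu' =>
    p :: untwist ds' bs' (iter d.+1 (row_comp ds' bs') mu')
  | _, _, _ => mu
  end.

Lemma iter_row_comp_valid n ds bs mu : adm ds bs -> valid bs mu ->
  valid bs (iter n (row_comp ds bs) mu) /\ sumn (iter n (row_comp ds bs) mu) = sumn mu.
Proof.
move=> A V; elim: n => // n [Vn Sn].
by rewrite iterS -Sn; apply: row_comp_valid.
Qed.

Lemma untwist_valid ds bs mu : adm ds bs -> valid bs mu ->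
  valid bs (untwist ds bs mu) /\ sumn (untwist ds bs mu) = sumn mu.
Proof.
elim: ds bs mu => [|d ds IH] [|b bs] [|p mu] // A V.
have /and3P[A' V' S'] := fits_cons A V.
have [Vi Si] := iter_row_comp_valid d.+1 A' V'.
have [Vu Su] := IH bs (iter d.+1 (row_comp ds bs) mu) A' Vi.
split; first by apply/andP; split; [rewrite Su Si; case/andP: V | exact: Vu].
by move: Su; rewrite Si /= => ->.
Qed.

Lemma untwist_inj ds bs mu mu' : adm ds bs -> valid bs mu -> valid bs mu' ->
  sumn mu = sumn mu' -> untwist ds bs mu = untwist ds bs mu' -> mu = mu'.
Proof.
elim: ds bs mu mu' => [|d ds IH] [|b bs] [|p mu] [|p' mu'] // A V V' S [pp E].
have /and3P[A1 V1 _] := fits_cons A V; have /and3P[_ V1' _] := fits_cons A V'.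
have {}S : sumn mu = sumn mu' by move: S; rewrite /= pp; lia.
rewrite pp; congr (_ :: _).
have {E} : iter d.+1 (row_comp ds bs) mu = iter d.+1 (row_comp ds bs) mu'.
  have [W1 S1] := iter_row_comp_valid d.+1 A1 V1.
  have [W2 S2] := iter_row_comp_valid d.+1 A1 V1'.
  by apply: (IH bs) E => //; rewrite S1 S2.
elim: d.+1 => // n IHn; rewrite !iterS => E; apply: IHn.
have [W1 S1] := iter_row_comp_valid n A1 V1.
have [W2 S2] := iter_row_comp_valid n A1 V1'.
by apply: row_comp_inj E => //; rewrite S1 S2.
Qed.

Lemma ins0 j ds q mu : ins j 0 ds (q :: mu) = q + j :: mu.
Proof. by case: ds. Qed.

Lemma untwist_ins0 j ds bs q mu :
  untwist ds bs (ins j 0 ds (q :: mu)) = ins j 0 ds (untwist ds bs (q :: mu)).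
Proof. by case: ds => [|d ds]; case: bs => [|b bs]; rewrite !ins0. Qed.

Lemma iter_row_comp_ins n j c ds bs mu : adm ds bs -> valid bs mu ->
  head 0 bs + c + n <= sumn mu ->
  iter n (row_comp ds bs) (ins j (c + n) ds mu) = ins j c ds (iter n (row_comp ds bs) mu).
Proof.
move=> A V; elim: n c => [|n IH] c S; first by rewrite addn0.
rewrite -addSnnS !iterS IH; last lia.
have [Vn Sn] := iter_row_comp_valid n A V.
by rewrite row_comp_ins //; lia.
Qed.

Lemma iter_row_comp_run n s c ds bs mu : adm ds bs -> valid bs mu ->
  head 0 bs + c + n + s <= sumn mu ->
  minn (run c ds (iter n (row_comp ds bs) mu)) s = minn (run (c + n) ds mu) s.
Proof.
move=> A V; elim: n c => [|n IH] c S; first by rewrite addn0.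
have [Vn Sn] := iter_row_comp_valid n A V.
rewrite iterS row_comp_run //; last lia.
by rewrite IH ?addSnnS //; lia.
Qed.

(** By [row_comp_ins] and [row_comp_run], after [d] further rowmotions the
    insertion or deletion at altitude [-d] becomes one at the first point, where
    it is the transfer of steps made by [promote_comp]. *)
Lemma untwist_row ds bs mu : adm ds bs -> valid bs mu ->
  untwist ds bs (row_comp ds bs mu) = promote_comp bs (untwist ds bs mu).
Proof.
elim: ds bs mu => [|d ds IH] [|b bs] [|p mu] // A V.
have F := fits_cons A V; have /and3P[A' V' S'] := F.
have [Vm Sm] := row_comp_valid A' V'.
have Vb : b <= sumn mu by case/andP: V.
have A1 : d + head 0 bs <= b by case/andP: A.
have Fm : fits ds bs d (row_comp ds bs mu) by rewrite /fits A' Vm Sm.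
set m := row_comp ds bs mu in Vm Sm Fm *.
have headE nu : valid bs nu -> exists q nu', nu = q :: nu'.
  by case: nu => [|q nu']; [case: (bs) | exists q, nu'].
case: p V => [|p] V.
  rewrite [row_comp _ _ _]/= -/m; set k := minn _ _.
  have kr : k <= run d ds m by exact: geq_minl.
  have kb : k <= sumn m - b by exact: geq_minr.
  set m' := del k d ds m.
  have mE : ins k d ds m' = m by exact: delK.
  have Fm' : fits ds bs d m' by apply: fits_del => //; lia.
  have /and3P[_ Vm' Lm'] := Fm'.
  have Sm' : sumn m = sumn m' + k by rewrite -mE (sum_ins _ Fm').
  have Rm' : run d ds m = run d ds m' + k by rewrite -mE (run_ins _ Fm').
  have [Vz Sz] := iter_row_comp_valid d A' Vm'.
  have [Vu Su] := untwist_valid A' Vz.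
  have Rz := @iter_row_comp_run d (sumn m' - head 0 bs - d) 0 ds bs m' A' Vm'.
  have Ez := @iter_row_comp_ins d k 0 ds bs m' A' Vm'.
  have -> : untwist (d :: ds) (b :: bs) (0 :: mu)
            = 0 :: untwist ds bs (iter d (row_comp ds bs) m) by rewrite -iterSr.
  rewrite -mE -[X in ins k X]add0n Ez; last by lia.
  have -> : untwist (d :: ds) (b :: bs) (k :: m')
            = k :: promote_comp bs (untwist ds bs (iter d (row_comp ds bs) m')).
    by rewrite -(IH bs) // iterS.
  move: Vz Sz Vu Su Rz; case: (iter d _ _) => [|q z] Vz Sz; first by case: (bs) Vz.
  rewrite untwist_ins0.
  have [u ->] : exists u, untwist ds bs (q :: z) = q :: u.
    by case: (ds) => [|? ?]; case: (bs) => [|? ?]; eexists.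
  rewrite ins0 => Vu Su Rz; rewrite [RHS]/=.
  suff -> : minn (q + k) (q + k + sumn u - b) = k by rewrite addnK.
  have R0 : run 0 ds (q :: z) = q by case: (ds) => [|? ?] /=; rewrite subn0.
  have kE : k = minn (run d ds m) (sumn m - b) by [].
  by move: Su Sz Rz; rewrite R0 add0n /=; lia.
have -> : row_comp (d :: ds) (b :: bs) (p.+1 :: mu) = p :: ins 1 d ds m by [].
have -> : untwist (d :: ds) (b :: bs) (p.+1 :: mu)
          = p.+1 :: untwist ds bs (iter d (row_comp ds bs) m) by rewrite -iterSr.
have -> : untwist (d :: ds) (b :: bs) (p :: ins 1 d ds m)
          = p :: untwist ds bs (row_comp ds bs (iter d (row_comp ds bs) (ins 1 d ds m))).
  by rewrite -iterS.
have [Vz Sz] := iter_row_comp_valid d A' Vm.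
rewrite -[X in ins 1 X]add0n iter_row_comp_ins //; last lia.
rewrite IH //; last by apply: (@valid_ins _ _ _ bs); rewrite /fits A' Vz; lia.
case: (iter d _ _) Vz {Sz} => [|q z] Vz; first by case: (bs) Vz.
rewrite untwist_ins0.
have [u ->] : exists u, untwist ds bs (q :: z) = q :: u.
  by case: (ds) => [|? ?]; case: (bs) => [|? ?]; eexists.
by rewrite ins0 addn1.
Qed.

(** * Coordinates, rotations and meets of compositions *)

Ltac nat_lia :=
  repeat match goal with
  | H : is_true (adm _ _) |- _ => clear H
  | H : is_true (valid _ _) |- _ => clear H
  | H : is_true (fits _ _ _ _) |- _ => clear H
  | H : @eq (seq _) _ _ |- _ => clear H
  | H : forall _, _ |- _ => clear H
  end; lia.

(** Entry [c] is the number of north steps after the east step that first takes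
    the altitude from [-c] to [-c-1]: of the entries of the tail, the first [d]
    compensate the gain of the north step. *)
Fixpoint free_part (ds mu : seq nat) {struct mu} : seq nat :=
  if mu is q :: mu' then
    nseq q (size mu') ++ (if ds is d :: ds' then drop d (free_part ds' mu') else [::])
  else [::].

(** For each north step of gain [d], the numbers of north steps after the [d]
    east steps at which its gain is lost again. *)
Fixpoint bound_part (ds mu : seq nat) : seq nat :=
  match ds, mu with
  | d :: ds', _ :: mu' => take d (free_part ds' mu') ++ bound_part ds' mu'
  | _, _ => [::]
  end.

Definition heights ds mu := bound_part ds mu ++ free_part ds mu.

Lemma adm_sum ds bs : adm ds bs -> sumn ds <= head 0 bs.
Proof.
by elim: ds bs => [|d ds IH] [|b bs] //= /andP[H /IH]; nat_lia.
Qed.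

Lemma adm_valid_cons d ds b bs p mu : adm (d :: ds) (b :: bs) -> valid (b :: bs) (p :: mu) ->
  [/\ adm ds bs, valid bs mu, d + head 0 bs <= b & b <= sumn mu].
Proof. by rewrite /= => /andP[? ?] /andP[? ?]. Qed.

Lemma size_free ds bs mu : adm ds bs -> valid bs mu ->
  size (free_part ds mu) = sumn mu - sumn ds.
Proof.
elim: ds bs mu => [|d ds IH] [|b bs] [|p mu] //.
  by case: mu => // _ _; rewrite /= cats0 size_nseq; nat_lia.
move=> A V; have [A' V' H1 H2] := adm_valid_cons A V.
rewrite /= size_cat size_nseq size_drop (IH bs) //.
by have := adm_sum A'; nat_lia.
Qed.

Lemma size_bound ds bs mu : adm ds bs -> valid bs mu -> size (bound_part ds mu) = sumn ds.
Proof.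
elim: ds bs mu => [|d ds IH] [|b bs] [|p mu] // A V.
have [A' V' H1 H2] := adm_valid_cons A V.
rewrite /= size_cat (IH bs) // size_takel // (size_free A' V').
by have := adm_sum A'; nat_lia.
Qed.

Lemma size_heights ds bs mu : adm ds bs -> valid bs mu -> size (heights ds mu) = sumn mu.
Proof.
move=> A V; rewrite size_cat (size_free A V) (size_bound A V).
suff : sumn ds <= sumn mu by nat_lia.
case: ds bs A V => [|d ds] [|b bs] //; case: mu => // p mu A V.
have [A' V' H1 H2] := adm_valid_cons A V.
by have := adm_sum A; rewrite /=; nat_lia.
Qed.

Lemma free_lt ds mu i : 0 < size mu -> nth 0 (free_part ds mu) i < size mu.
Proof.
elim: mu ds i => [|q mu IH] ds i //= _; rewrite nth_cat nth_nseq size_nseq.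
case: (ltnP i q) => // qi; case: ds => [|d ds]; first by rewrite nth_nil.
rewrite nth_drop; case: mu IH => [|q' mu] IH; first by rewrite nth_nil.
exact: leq_trans (IH _ _ isT) _.
Qed.

Lemma free_anti ds mu i j : i <= j -> nth 0 (free_part ds mu) j <= nth 0 (free_part ds mu) i.
Proof.
elim: mu ds i j => [|q mu IH] ds i j //= ij; first by rewrite !nth_nil.
rewrite !nth_cat !nth_nseq !size_nseq; case: (ltnP j q) => qj.
  by rewrite (leq_ltn_trans ij qj).
case: (ltnP i q) => qi.
  case: ds => [|d ds]; first by rewrite nth_nil.
  rewrite nth_drop; case: mu {IH} => [|q' mu]; first by rewrite nth_nil.
  by apply/ltnW/free_lt.
case: ds => [|d ds]; first by rewrite !nth_nil.
by rewrite !nth_drop; apply: IH; nat_lia.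
Qed.

(** Place in the coordinate vector of a path of the coordinate [x] of its part
    after the first north step. The [D] bound coordinates of this part come
    first, then its free ones, of which [d] become bound; [p] is the number of
    new free ones. *)
Definition lift_index (d D p x : nat) : nat :=
  if x < D then d + x else if x < D + d then x - D else x + p.

Lemma nth_heights_lift d ds b bs p mu x : adm (d :: ds) (b :: bs) ->
  valid (b :: bs) (p :: mu) ->
  nth 0 (heights (d :: ds) (p :: mu)) (lift_index d (sumn ds) p x) = nth 0 (heights ds mu) x.
Proof.
move=> A V; have [A' V' H1 H2] := adm_valid_cons A V.
have sF := size_free A' V'; have sB := size_bound A' V'.
have sT : size (take d (free_part ds mu)) = d.
  by rewrite size_takel // sF; have := adm_sum A'; nat_lia.
rewrite /heights /= /lift_index !nth_cat size_cat sT sB size_nseq.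
case: (ltnP x (sumn ds)) => xD.
  by rewrite ltn_add2l xD ltnNge leq_addr /= addKn.
case: (ltnP x (sumn ds + d)) => xd.
  have -> : x - sumn ds < d + sumn ds by nat_lia.
  have -> : x - sumn ds < d by nat_lia.
  by rewrite nth_take //; nat_lia.
have -> : (x + p < d + sumn ds) = false by nat_lia.
have -> : (x + p - (d + sumn ds) < p) = false by nat_lia.
by rewrite nth_drop; congr nth; nat_lia.
Qed.

Lemma nth_heights_head d ds b bs p mu i : adm (d :: ds) (b :: bs) ->
  valid (b :: bs) (p :: mu) -> i < p ->
  nth 0 (heights (d :: ds) (p :: mu)) (sumn (d :: ds) + i) = size mu.
Proof.
move=> A V ip; rewrite /heights nth_cat (size_bound A V) ltnNge leq_addr /= addKn.
by rewrite nth_cat size_nseq ip nth_nseq ip.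
Qed.

Lemma size_valid bs mu : valid bs mu -> size mu = (size bs).+1.
Proof.
by elim: bs mu => [|b bs IH] [|p mu] //=; [case: mu | move=> /andP[_ /IH ->]].
Qed.

Lemma size_adm ds bs : adm ds bs -> size ds = size bs.
Proof. by elim: ds bs => [|d ds IH] [|b bs] //= /andP[_ /IH ->]. Qed.

Lemma lift_cases d D p y :
  (exists x, y = lift_index d D p x) \/ (exists2 i, i < p & y = d + D + i).
Proof.
have [yd|yd] := ltnP y d.
  left; exists (y + D); rewrite /lift_index ltnNge leq_addl /= addnC ltn_add2l yd; nat_lia.
have [yD|yD] := ltnP y (d + D).
  left; exists (y - d); rewrite /lift_index; have -> : y - d < D by nat_lia.
  nat_lia.
have [yp|yp] := ltnP y (d + D + p); first by right; exists (y - (d + D)); nat_lia.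
left; exists (y - p); rewrite /lift_index.
have -> : (y - p < D) = false by nat_lia.
have -> : (y - p < D + d) = false by nat_lia.
nat_lia.
Qed.

Lemma nseq_insert (r q j c : nat) X : c <= q ->
  nseq (q + j) r ++ X = take c (nseq q r ++ X) ++
    nseq j (last r (take c (nseq q r ++ X))) ++ drop c (nseq q r ++ X).
Proof.
move=> cq; have tE : take c (nseq q r ++ X) = nseq c r.
  by rewrite takel_cat ?size_nseq // take_nseq.
have lE : last r (nseq c r) = r by elim: (c).
rewrite drop_cat size_nseq tE lE; case: ltnP => H.
  rewrite drop_nseq !catA -!nseqD; congr (nseq _ _ ++ _); nat_lia.
have -> : q = c by nat_lia.
by rewrite subnn drop0 nseqD catA.
Qed.

Lemma last_nonempty (x y : nat) s : 0 < size s -> last x s = last y s.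
Proof. by case: s. Qed.

Lemma fits_size_free c ds bs mu : fits ds bs c mu -> c <= size (free_part ds mu).
Proof.
by case/and3P=> A V S; rewrite (size_free A V); have := adm_sum A; nat_lia.
Qed.

(** The inserted steps come right after the free step of index [c-1], hence
    share its height; for [c = 0] they are at the start. *)
Lemma free_ins j c ds bs mu : fits ds bs c mu -> free_part ds (ins j c ds mu) =
  take c (free_part ds mu) ++
  nseq j (last (size mu).-1 (take c (free_part ds mu))) ++ drop c (free_part ds mu).
Proof.
elim/fits_ind: ds bs c mu / => [c q|c d ds b bs q mu|c d ds b bs q mu] H.
- by rewrite [ins _ _ _ _]/= H /=; apply: nseq_insert.
- by move=> F; rewrite [ins _ _ _ _]/= H /=; apply: nseq_insert.
move=> F F' IH; have := fits_size_free F'.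
rewrite [ins _ _ _ _]/= [c <= q]leqNgt H /= size_ins IH; set c' := c - q + d.
set U := free_part ds mu => cU; set l := last _ _.
have dU : size (take c' U) = c' by rewrite size_takel.
have -> : drop d (take c' U ++ nseq j l ++ drop c' U) = drop d (take c' U) ++ nseq j l ++ drop c' U.
  by rewrite drop_cat dU; have -> : d < c' by rewrite /c'; nat_lia.
have -> : take c (nseq q (size mu) ++ drop d U) = nseq q (size mu) ++ drop d (take c' U).
  by rewrite take_cat size_nseq ltnNge (ltnW H) /= take_drop.
have -> : drop c (nseq q (size mu) ++ drop d U) = drop c' U.
  by rewrite drop_cat size_nseq ltnNge (ltnW H) /= drop_drop.
rewrite -catA; congr (_ ++ (_ ++ (nseq j _ ++ _))).
rewrite last_cat /l -[in LHS](cat_take_drop d (take c' U)) last_cat.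
by apply: last_nonempty; rewrite size_drop dU /c'; nat_lia.
Qed.

Lemma bound_ins j c ds bs mu : fits ds bs c mu -> bound_part ds (ins j c ds mu) = bound_part ds mu.
Proof.
elim/fits_ind: ds bs c mu / => [c q|c d ds b bs q mu|c d ds b bs q mu] H //.
  by rewrite [ins _ _ _ _]/= H.
move=> F F' IH; rewrite [ins _ _ _ _]/= [c <= q]leqNgt H /= IH (free_ins _ F').
rewrite take_cat size_takel ?(fits_size_free F') //; case: ltnP => dc.
  by rewrite take_takel // ltnW.
have -> : c - q + d = d by nat_lia.
by rewrite subnn take0 cats0.
Qed.

(** The rotation lowers the coordinate [e] of the east step before the valley,
    and [c] north steps follow the north step of the valley. *)
Inductive rotation : seq nat -> seq nat -> seq nat -> nat -> nat -> Prop :=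
| rotation_head d ds p mu :
    rotation (d :: ds) (p.+1 :: mu) (p :: ins 1 d ds mu) (sumn (d :: ds) + p) (size ds)
| rotation_tail d ds p mu mu' e c : rotation ds mu mu' e c ->
    rotation (d :: ds) (p :: mu) (p :: mu') (lift_index d (sumn ds) p e) c.

Lemma rotation_valid ds bs mu mu' e c : adm ds bs -> valid bs mu -> rotation ds mu mu' e c ->
  valid bs mu' /\ sumn mu' = sumn mu.
Proof.
move=> A V R; elim: R bs A V => {ds mu mu' e c} [d ds p mu|d ds p mu mu' e c _ IH] [|b bs] // A V.
  have F := fits_cons A V; have [A' V' H1 H2] := adm_valid_cons A V.
  by rewrite /= (sum_ins _ F) (valid_ins _ F) andbT; split; nat_lia.
have [A' V' H1 H2] := adm_valid_cons A V.
by have [V1 S1] := IH bs A' V'; rewrite /= V1 S1 H2.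
Qed.

(** Only the east step that the rotation moves changes its height, since it is
    moved past a subpath that returns to the same altitude and so it keeps its
    role among the free or bound steps. *)
Lemma rotation_heights ds bs mu mu' e c : adm ds bs -> valid bs mu -> rotation ds mu mu' e c ->
  [/\ nth 0 (heights ds mu) e = c.+1, nth 0 (heights ds mu') e <= c &
      forall i, i != e -> nth 0 (heights ds mu') i = nth 0 (heights ds mu) i].
Proof.
move=> A V R; elim: R bs A V => {ds mu mu' e c} [d ds p mu|d ds p mu mu' e c R IH] [|b bs] // A V.
  have F := fits_cons A V; have [A' V' H1 H2] := adm_valid_cons A V.
  have sz : size mu = (size ds).+1 by rewrite (size_valid V') (size_adm A').
  have dU := fits_size_free F.
  have tE : take d (free_part ds (ins 1 d ds mu)) = take d (free_part ds mu).
    by rewrite (free_ins _ F) takel_cat ?size_takel // take_takel.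
  have Vy : valid (b :: bs) (p :: ins 1 d ds mu).
    by rewrite /= (sum_ins _ F) (valid_ins _ F) andbT; nat_lia.
  have bE : bound_part (d :: ds) (p :: ins 1 d ds mu) = bound_part (d :: ds) (p.+1 :: mu).
    by rewrite /= tE (bound_ins _ F).
  have fE : free_part (d :: ds) (p :: ins 1 d ds mu) =
      nseq p (size mu) ++ last (size mu).-1 (take d (free_part ds mu)) :: drop d (free_part ds mu).
    rewrite /= size_ins (free_ins _ F) drop_cat size_takel // ltnn subnn drop0.
    by [].
  split.
  - by rewrite (nth_heights_head A V) ?ltnS.
  - rewrite /heights bE fE nth_cat (size_bound A V) ltnNge leq_addr /= addKn nth_cat size_nseq.
    rewrite ltnn subnn /= -ltnS -sz (last_nth 0) size_takel //.
    case: (d) dU => [|d'] dU; first by rewrite take0 /= sz.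
    by rewrite /= nth_take // free_lt // sz.
  - have fE' : free_part (d :: ds) (p.+1 :: mu) = nseq p.+1 (size mu) ++ drop d (free_part ds mu) by [].
    move=> i ie; rewrite /heights bE fE fE' !nth_cat (size_bound A V); case: ltnP => // Di.
    rewrite -(subnKC Di) eqn_add2l in ie.
    move: (i - _) ie => k kp; rewrite !size_nseq !nth_nseq.
    have -> : (k < p.+1) = (k < p) by nat_lia.
    case: ltnP => // pk; have -> : k - p = (k - p.+1).+1 by nat_lia.
    by [].
have [A' V' H1 H2] := adm_valid_cons A V.
have [E1 E2 E3] := IH bs A' V'; have [V1 S1] := rotation_valid A' V' R.
have Vy : valid (b :: bs) (p :: mu') by rewrite /= V1 S1 H2.
rewrite (nth_heights_lift _ A V) (nth_heights_lift _ A Vy); split=> // i.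
have [[x ->]|[k kp ->]] := lift_cases d (sumn ds) p i.
  rewrite (nth_heights_lift _ A V) (nth_heights_lift _ A Vy) => xe.
  by apply: E3; apply: contraNneq xe => ->.
move=> _; rewrite -[d + sumn ds]/(sumn (d :: ds)) (nth_heights_head A V) // (nth_heights_head A Vy) //.
by rewrite (size_valid V1) (size_valid V').
Qed.

Lemma rotation_lt ds mu mu' e c : rotation ds mu mu' e c -> c < size ds.
Proof. by elim=> //= *; apply: ltnW. Qed.

Lemma rotation_fun ds mu mu' mu'' e e' c : rotation ds mu mu' e c -> rotation ds mu mu'' e' c -> mu' = mu''.
Proof.
move=> R; elim: R mu'' e' => {ds mu mu' e c} [d ds p mu|d ds p mu mu' e c R IH] mu'' e' R'.
  inversion R' as [|d' ds' p' m m' e1 c1 R1] => //; subst.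
  by have := rotation_lt R1; rewrite ltnn.
inversion R' as [d' ds' p' m|d' ds' p' m m' e1 c1 R1]; subst.
  by have := rotation_lt R; rewrite ltnn.
by rewrite (IH _ _ R1).
Qed.

Definition below ds mu mu' := forall i, nth 0 (heights ds mu') i <= nth 0 (heights ds mu) i.

Lemma nth_free_head d ds b bs p mu i : adm (d :: ds) (b :: bs) ->
  valid (b :: bs) (p :: mu) ->
  nth 0 (heights (d :: ds) (p :: mu)) (sumn (d :: ds) + i) = nth 0 (free_part (d :: ds) (p :: mu)) i.
Proof. by move=> A V; rewrite /heights nth_cat (size_bound A V) ltnNge leq_addr /= addKn. Qed.

Lemma nth_heights_free d ds b bs p mu i : adm (d :: ds) (b :: bs) ->
  valid (b :: bs) (p :: mu) -> i < d ->
  nth 0 (heights (d :: ds) (p :: mu)) i = nth 0 (free_part ds mu) i.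
Proof.
move=> A V id; have [A' V' H1 H2] := adm_valid_cons A V.
have sT : size (take d (free_part ds mu)) = d.
  by rewrite size_takel // (size_free A' V'); have := adm_sum A'; nat_lia.
by rewrite /heights /= -catA nth_cat sT id nth_take.
Qed.

Lemma nth_tail_free d ds p mu i : p <= i ->
  nth 0 (free_part (d :: ds) (p :: mu)) i = nth 0 (free_part ds mu) (d + (i - p)).
Proof. by move=> H; rewrite /= nth_cat size_nseq ltnNge H /= nth_drop. Qed.

(** If the first entries agree, induction applies behind the first north step.
    Otherwise [mu] has the larger first entry, and its last east step before the
    north step can be rotated: it lands next to the free step of index [d-1],
    whose height in [mu] is at least the required one (for [d = 0], in the next
    row). *)
Lemma rotation_ex ds bs mu nu : adm ds bs -> valid bs mu -> valid bs nu ->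
  sumn mu = sumn nu -> below ds mu nu -> mu != nu ->
  exists mu' e c, rotation ds mu mu' e c /\ below ds mu' nu.
Proof.
elim: ds bs mu nu => [|d ds IH] [|b bs] [|p mu] [|q nu] //.
  by case: mu nu => [|? ?] [|? ?] // _ _ _; rewrite /= !addn0 => -> _; rewrite eqxx.
move=> A V V' S le ne; have [A' W H1 H2] := adm_valid_cons A V.
have [_ W' _ H2'] := adm_valid_cons A V'.
have sz : size mu = size nu by rewrite (size_valid W) (size_valid W').
have sz0 : size mu = (size ds).+1 by rewrite (size_valid W) (size_adm A').
have qp : q <= p.
  rewrite leqNgt; apply/negP => pq; have := le (sumn (d :: ds) + p).
  rewrite (nth_heights_head A V') // (nth_free_head _ A V) nth_tail_free //.
  by rewrite leqNgt -sz free_lt // sz0.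
have [E|npq] := eqVneq p q.
  have lt : below ds mu nu.
    by move=> i; have := le (lift_index d (sumn ds) p i);
      rewrite (nth_heights_lift _ A V) {1}E (nth_heights_lift _ A V').
  have [|||mu' [e [c [R lm]]]] := IH bs mu nu A' W W'.
  - by move: S; rewrite /= E; nat_lia.
  - exact: lt.
  - by apply: contraNneq ne => ->; rewrite E.
  exists (p :: mu'), (lift_index d (sumn ds) p e), c; split; first exact: rotation_tail.
  have [V1 S1] := rotation_valid A' W R.
  have Vz : valid (b :: bs) (p :: mu') by rewrite /= V1 S1 H2.
  move=> i; have [[x ->]|[k kp ->]] := lift_cases d (sumn ds) p i.
    by rewrite (nth_heights_lift _ A Vz) {1}E (nth_heights_lift _ A V').
  rewrite -[d + sumn ds]/(sumn (d :: ds)) (nth_heights_head A Vz) // (nth_heights_head A V') -?E //.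
  by rewrite (size_valid V1) (size_valid W').
case: p V S le ne qp npq => [|p] V S le ne qp npq; first by move: qp npq; rewrite leqn0 eq_sym => ->.
pose z := p :: ins 1 d ds mu; have R : rotation (d :: ds)
  (p.+1 :: mu) z (sumn (d :: ds) + p) (size ds) by apply: rotation_head.
exists z, (sumn (d :: ds) + p), (size ds); split => // i.
have [E1 E2 E3] := rotation_heights A V R.
have [->|/E3 ->] := eqVneq i (sumn (d :: ds) + p); last exact: le.
have [Vz Sz] := rotation_valid A V R; have F := fits_cons A V.
have dU := fits_size_free F.
rewrite (nth_free_head _ A V') (nth_free_head _ A Vz) nth_tail_free; last by nat_lia.
rewrite nth_tail_free // subnn addn0 (free_ins _ F) nth_cat size_takel // ltnn subnn /=.
rewrite (last_nth 0) size_takel //; case: (d) H1 A V V' le F dU => [|d'] H1' A V V' le F dU.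
  by rewrite take0 /= -ltnS prednK sz0 // -sz0 sz free_lt // -sz sz0.
apply: leq_trans (free_anti ds nu (_ : d' <= _)) _; first by nat_lia.
rewrite /= nth_take //.
have := le d'; rewrite (nth_heights_free A V) ?(nth_heights_free A V') //.
Qed.

(** Otherwise a rotation would lower a coordinate below its own value. *)
Lemma heights_inj ds bs mu nu : adm ds bs -> valid bs mu -> valid bs nu ->
  sumn mu = sumn nu -> (forall i, nth 0 (heights ds mu) i = nth 0 (heights ds nu) i) -> mu = nu.
Proof.
move=> A V V' S E; apply/eqP; apply/contraT => ne.
have [|mu' [e [c [R /(_ e)]]]] := rotation_ex A V V' S _ ne; first by move=> i; rewrite E.
by have [E1 E2 _] := rotation_heights A V R; rewrite -E E1; nat_lia.
Qed.

(** Removes the free step of index [c]. *)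
Fixpoint remove (c : nat) (ds mu : seq nat) {struct mu} : seq nat :=
  if mu is q :: mu' then
    if c < q then q.-1 :: mu'
    else if ds is d :: ds' then q :: remove (c - q + d) ds' mu' else mu
  else [::].

Lemma size_remove c ds mu : size (remove c ds mu) = size mu.
Proof. by elim: mu ds c => [|q mu IH] [|d ds] c //=; case: ltnP => //= _; rewrite IH. Qed.

Lemma remove_spec c ds bs mu : fits ds bs c mu -> 0 < c ->
  [/\ valid bs (remove c.-1 ds mu), sumn (remove c.-1 ds mu) = (sumn mu).-1,
      bound_part ds (remove c.-1 ds mu) = bound_part ds mu &
      free_part ds (remove c.-1 ds mu) = take c.-1 (free_part ds mu) ++ drop c (free_part ds mu)].
Proof.
elim/fits_ind: ds bs c mu / => [c q|c d ds b bs q mu|c d ds b bs q mu] H.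
- move=> c0; rewrite /=; have -> : c.-1 < q by nat_lia.
  rewrite /= !cats0 take_nseq ?drop_nseq; last by nat_lia.
  by rewrite -nseqD; split=> //; [nat_lia | congr nseq; nat_lia].
- move=> F c0; rewrite /=; have -> : c.-1 < q by nat_lia.
  case/and3P: F => _ V _; split; [exact: V | by rewrite /=; nat_lia | by [] |].
  rewrite takel_cat ?size_nseq; last by nat_lia.
  rewrite take_nseq; last by nat_lia.
  have -> /= : q.-1 = c.-1 + (q - c) by nat_lia.
  rewrite nseqD -catA; congr (_ ++ _).
  rewrite drop_cat size_nseq; case: ltnP => H'; first by rewrite drop_nseq.
  by have -> : c = q; [nat_lia | rewrite subnn drop0].
move=> F F' IH c0; have c0' : 0 < c - q + d by nat_lia.
have [Vr Sr Br Fr] := IH c0'; rewrite [remove _ _ _]/=.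
have -> : (c.-1 < q) = false by nat_lia.
have -> : c.-1 - q + d = (c - q + d).-1 by nat_lia.
have /and3P[A V S] := F; have [A' V' H1 H2] := adm_valid_cons A V.
have cU := fits_size_free F'.
split.
- by rewrite /= Sr Vr andbT; move: S => /=; nat_lia.
- by rewrite /= Sr; move: S => /=; nat_lia.
- rewrite /= Br Fr take_cat size_takel; last by nat_lia.
  case: ltnP => dc; first by rewrite take_takel // ltnW.
  by have -> : d - (c - q + d).-1 = 0 by [nat_lia]; rewrite take0 cats0; congr (take _ _ ++ _); nat_lia.
- rewrite /= size_remove Fr [take c.-1 _]take_cat [drop c _]drop_cat size_nseq.
  have -> : (c.-1 < q) = false by nat_lia.
  have -> : (c < q) = false by nat_lia.
  rewrite -catA; congr (_ ++ _); rewrite drop_drop.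
  rewrite drop_cat size_takel; last by nat_lia.
  rewrite take_drop; have -> : c.-1 - q + d = (c - q + d).-1 by nat_lia.
  case: ltnP => dc //; have -> : d - (c - q + d).-1 = 0 by nat_lia.
  by rewrite drop0 [drop d (take _ _)]drop_oversize // size_takel; nat_lia.
Qed.

Lemma iter_remove_spec k d ds bs mu : fits ds bs (d + k) mu ->
  let m := iter k (remove d ds) mu in
  [/\ valid bs m, sumn m = sumn mu - k, bound_part ds m = bound_part ds mu &
      free_part ds m = take d (free_part ds mu) ++ drop (d + k) (free_part ds mu)].
Proof.
elim: k => [|k IH] F.
  by have /and3P[A V S] := F; rewrite /= addn0 cat_take_drop subn0.
have Fk : fits ds bs (d + k) mu by apply: fitsW F; nat_lia.
have /= [V S Bd Fr] := IH Fk; have /and3P[A _ Sm] := F.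
have dU := fits_size_free F.
have F1 : fits ds bs d.+1 (iter k (remove d ds) mu) by rewrite /fits A V S; nat_lia.
have [V1 S1 B1 Fr1] := remove_spec F1 isT.
rewrite /= -[d]/(d.+1.-1); split; [exact: V1 | by rewrite S1 S; nat_lia | by rewrite B1 |].
rewrite Fr1 Fr [_.+1.-1]/= takel_cat ?size_takel //; last by nat_lia.
rewrite take_takel //; congr (_ ++ _).
rewrite drop_cat size_takel; last by nat_lia.
rewrite ltnNge leqnSn /= drop_drop; congr drop; nat_lia.
Qed.

(** Let [p = q + k] be the larger of the first entries. The [k] extra steps have
    maximal height, so they decide their coordinates; deletion of the free steps
    of indices [d, ..., d + k - 1] from the other tail aligns the remaining
    coordinates, and induction applies to the tails. *)
Lemma meet_ex ds bs mu nu : adm ds bs -> valid bs mu -> valid bs nu -> sumn mu = sumn nu ->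
  exists la, [/\ valid bs la, sumn la = sumn mu &
    forall i, nth 0 (heights ds la) i = maxn (nth 0 (heights ds mu) i) (nth 0 (heights ds nu) i)].
Proof.
elim: ds bs mu nu => [|d ds IH] [|b bs] // mu nu A.
  case: mu => [|q [|? ?]] //; case: nu => [|q' [|? ?]] // _ _.
  by rewrite /= !addn0 => ->; exists [:: q']; split=> [||i]; rewrite /= ?addn0 ?maxnn.
have wlog_le p q mu' nu' : valid (b :: bs) (p :: mu') -> valid (b :: bs) (q :: nu') ->
  sumn (p :: mu') = sumn (q :: nu') -> q <= p ->
  exists la, [/\ valid (b :: bs) la, sumn la = sumn (p :: mu') &
    forall i, nth 0 (heights (d :: ds) la) i =
      maxn (nth 0 (heights (d :: ds) (p :: mu')) i) (nth 0 (heights (d :: ds) (q :: nu')) i)].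
  move=> V V' S qp; have [A' W H1 H2] := adm_valid_cons A V.
  have [_ W' _ H2'] := adm_valid_cons A V'; set k := p - q.
  have S' : p + sumn mu' = q + sumn nu' by exact: S.
  have F : fits ds bs (d + k) nu' by rewrite /fits A' W' /=; nat_lia.
  have /= [Vm Sm Bm Fm] := iter_remove_spec F; set m := iter k _ _ in Vm Sm Bm Fm.
  have [|la [Vl Sl El]] := IH bs mu' m A' W Vm; first by rewrite Sm; nat_lia.
  have Vz : valid (b :: bs) (p :: la) by rewrite /= Vl Sl H2.
  have dU := fits_size_free F.
  have fm i : i < d -> nth 0 (free_part ds m) i = nth 0 (free_part ds nu') i.
    by move=> id; rewrite Fm nth_cat size_takel; [rewrite id nth_take | nat_lia].
  have fm' i : nth 0 (free_part ds m) (d + i) = nth 0 (free_part ds nu') (d + k + i).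
    by rewrite Fm nth_cat size_takel; [rewrite ltnNge leq_addr /= nth_drop addKn | nat_lia].
  have sz : size mu' = (size ds).+1 by rewrite (size_valid W) (size_adm A').
  have sz' : size nu' = (size ds).+1 by rewrite (size_valid W') (size_adm A').
  have szl : size la = (size ds).+1 by rewrite (size_valid Vl) (size_adm A').
  have vf w i : valid bs w -> nth 0 (heights ds w) (sumn ds + i) = nth 0 (free_part ds w) i.
    by move=> Wn; rewrite /heights nth_cat (size_bound A' Wn) ltnNge leq_addr /= addKn.
  have El' i : nth 0 (free_part ds la) i = maxn (nth 0 (free_part ds mu') i) (nth 0 (free_part ds m) i).
    by rewrite -!vf.
  exists (p :: la); split => //; first by rewrite /= Sl.
  move=> i; have [id|di] := ltnP i d.
    by rewrite (nth_heights_free A Vz) // (nth_heights_free A V) // (nth_heights_free A V') // El' fm.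
  have [iD|Di] := ltnP i (sumn (d :: ds)).
    have [x xD ->] : exists2 x, x < sumn ds & i = lift_index d (sumn ds) 0 x.
      by exists (i - d); rewrite /lift_index; move: iD => /= iD; have -> : i - d < sumn ds by [nat_lia]; nat_lia.
    have lE r : lift_index d (sumn ds) 0 x = lift_index d (sumn ds) r x by rewrite /lift_index xD.
    rewrite {1}(lE p) (nth_heights_lift _ A Vz) {1}(lE p) (nth_heights_lift _ A V) (lE q) (nth_heights_lift _ A V').
    by rewrite El; congr maxn; rewrite /heights !nth_cat Bm (size_bound A' W') xD.
  rewrite -(subnKC Di); move: (i - _) => j.
  rewrite (nth_free_head _ A Vz) (nth_free_head _ A V) (nth_free_head _ A V').
  have [jp|pj] := ltnP j p.
    have hd w : nth 0 (free_part (d :: ds) (p :: w)) j = size w.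
      by rewrite /= nth_cat size_nseq jp nth_nseq jp.
    rewrite !hd sz szl -sz'; apply/esym/maxn_idPl.
    by rewrite -ltnS -[(size nu').+1]/(size (q :: nu')) free_lt.
  have qj : q <= j by nat_lia.
  rewrite !nth_tail_free // El' fm'; congr (maxn _ (nth _ _ _)); nat_lia.
case: mu => [|p mu] //; case: nu => [|q nu] // V V' S.
have [qp|/ltnW pq] := leqP q p; first exact: wlog_le.
have [la [V1 S1 E1]] := wlog_le _ _ _ _ V' V (esym S) pq.
by exists la; split=> // [|i]; [rewrite S1 | rewrite E1 maxnC].
Qed.

Definition up ds mu e c := exists mu', rotation ds mu mu' e c.
Definition down ds bs mu e c := exists2 mu', valid bs mu' & rotation ds mu' mu e c.

Lemma up_cons d ds p mu e c : up (d :: ds) (p :: mu) e c <->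
  [/\ 0 < p, e = sumn (d :: ds) + p.-1 & c = size ds] \/
  (exists2 e', up ds mu e' c & e = lift_index d (sumn ds) p e').
Proof.
split=> [[mu' R]|[[p0 -> ->]|[e' [mu' R] ->]]].
- inversion R as [d' ds' p' m|d' ds' p' m m' e1 c1 R1]; subst; first by left.
  by right; exists e1 => //; exists m'.
- by case: p p0 => // p _; exists (p :: ins 1 d ds mu); apply: rotation_head.
- by exists (p :: mu'); apply: rotation_tail.
Qed.

(** A path is entered by a rotation at the first north step exactly when an east
    step follows the first point of altitude [-d] and the bounds allow to move
    it back. *)
Lemma down_cons d ds b bs p mu e c : adm (d :: ds) (b :: bs) ->
  valid (b :: bs) (p :: mu) -> down (d :: ds) (b :: bs) (p :: mu) e c <->
  [/\ 0 < run d ds mu, b < sumn mu, e = sumn (d :: ds) + p & c = size ds] \/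
  (exists2 e', down ds bs mu e' c & e = lift_index d (sumn ds) p e').
Proof.
move=> A V; have [A' V' H1 H2] := adm_valid_cons A V.
split=> [[mu' V1 R]|[[r0 bs0 -> ->]|[e' [mu' V1 R] ->]]].
- inversion R as [d' ds' p' m|d' ds' p' m m' e1 c1 R1]; subst.
    left; have F := fits_cons A V1; rewrite (run_ins _ F) (sum_ins _ F).
    by split=> //; case/andP: V1 => *; nat_lia.
  by right; exists e1 => //; exists m => //; case/andP: V1.
- have F : fits ds bs d (del 1 d ds mu).
    by apply: fits_del => //; [apply: fits_cons A V | nat_lia].
  have S1 := sum_del r0.
  exists (p.+1 :: del 1 d ds mu).
    by rewrite /= S1; case/and3P: F => _ -> _; rewrite andbT; nat_lia.
  by rewrite -{2}(delK r0); apply: rotation_head.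
- have [_ S1] := rotation_valid A' V1 R.
  by exists (p :: mu'); [rewrite /= V1 -S1 H2 | apply: rotation_tail].
Qed.

Definition shift j t e := if t <= e then e + j else e.

Ltac index_lia :=
  rewrite /shift /lift_index /=;
  repeat match goal with
  | |- context [if ?a <= ?b then _ else _] =>
    lazymatch a with
    | context [if _ then _ else _] => fail
    | _ => lazymatch b with
           | context [if _ then _ else _] => fail
           | _ => case: (leqP a b) => ?
           end
    end
  end; nat_lia.

(** Whether a rotation enters at a north step depends on a run behind it, and
    the insertion neither creates nor empties such a run; it only renumbers the
    coordinates behind the insertion point. *)
Lemma down_ins j x ds bs mu e c : fits ds bs x mu ->
  down ds bs (ins j x ds mu) e c <->
  exists2 e', down ds bs mu e' c & e = shift j (sumn ds + x) e'.
Proof.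
move=> F; elim/fits_ind: ds bs x mu / F e => [x q|x d ds b bs q mu|x d ds b bs q mu] H.
- move=> e; split=> [[m _ R]|[e' [m _ R] _]]; inversion R.
- move=> F e; have /and3P[A V _] := F.
  rewrite [ins _ _ _ _]/= H.
  have V1 : valid (b :: bs) (q + j :: mu) by exact: V.
  rewrite (down_cons _ _ A V1); split=> [[[r0 b0 -> ->]|[e' D ->]]|[e']].
  + exists (sumn (d :: ds) + q); first by apply: (down_cons _ _ A V).2; left.
    by rewrite /shift leq_add2l H addnA.
  + exists (lift_index d (sumn ds) q e'); first by apply: (down_cons _ _ A V).2; right; exists e'.
    by index_lia.
  move=> /(down_cons _ _ A V)[[r0 b0 -> ->]|[e1 D ->]] ->.
    by left; split=> //; rewrite /shift leq_add2l H addnA.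
  right; exists e1 => //.
  by index_lia.
move=> F F' IH e; have /and3P[A V S] := F; have [A' V' H1 H2] := adm_valid_cons A V.
rewrite [ins _ _ _ _]/= [x <= q]leqNgt H /=.
have V1 : valid (b :: bs) (q :: ins j (x - q + d) ds mu).
  by rewrite /= (sum_ins _ F') (valid_ins _ F') andbT; nat_lia.
have bS : b < sumn mu by move: S => /=; nat_lia.
have rE : (0 < run d ds (ins j (x - q + d) ds mu)) = (0 < run d ds mu).
  have Fd := fits_cons A V; rewrite addnC.
  have [xr|rx] := leqP (x - q) (run d ds mu); last by rewrite run_ins_out.
  by rewrite (run_ins_in _ Fd) //; nat_lia.
rewrite (down_cons _ _ A V1) rE (sum_ins _ F'); split=> [[[r0 b0 -> ->]|[e' D ->]]|[e']].
- exists (sumn (d :: ds) + q); first by apply: (down_cons _ _ A V).2; left.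
  by rewrite /shift leq_add2l leqNgt H.
- have [e1 D1 ->] := (IH e').1 D.
  exists (lift_index d (sumn ds) q e1); first by apply: (down_cons _ _ A V).2; right; exists e1.
  by index_lia.
move=> /(down_cons _ _ A V)[[r0 b0 -> ->]|[e1 D ->]] ->.
  left; split=> //; first by nat_lia.
  by rewrite /shift leq_add2l leqNgt H.
right; exists (shift j (sumn ds + (x - q + d)) e1); first by apply/IH; exists e1.
by index_lia.
Qed.

(** The rotation at the first valley, when there is one, is performed by
    [row_comp], so it enters the image. When there is none, [row_comp] undoes
    these rotations until none of them enters. The others are handled by
    induction, with the renumbering of [down_ins]. *)
Theorem up_down_row ds bs mu e c : adm ds bs -> valid bs mu ->
  up ds mu e c <-> down ds bs (row_comp ds bs mu) e c.
Proof.
elim: ds bs mu e => [|d ds IH] [|b bs] // [|p mu] // e A V.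
  by split=> [[m R]|[m _ R]]; inversion R.
have [A' V' H1 H2] := adm_valid_cons A V; have F := fits_cons A V.
have [Vm Sm] := row_comp_valid A' V'; have [VR SR] := row_comp_valid A V.
have Fm : fits ds bs d (row_comp ds bs mu) by rewrite /fits A' Vm Sm; case/and3P: F.
have {}IH e' := IH bs mu e' A' V'.
rewrite up_cons; move: VR SR; rewrite [row_comp _ _ _]/=; set m := row_comp ds bs mu in IH Vm Sm Fm *.
case: p V => [|p] V.
  set k := minn _ _ => VR SR.
  have kr : k <= run d ds m by exact: geq_minl.
  have kb : k <= sumn m - b by exact: geq_minr.
  have Fd : fits ds bs d (del k d ds m) by apply: fits_del => //; nat_lia.
  have mE := delK kr; set m' := del k d ds m in VR SR Fd mE *.
  have noup : ~ (0 < run d ds m' /\ b < sumn m').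
    have := run_ins k Fd; have := sum_ins k Fd; rewrite mE.
    have : k = minn (run d ds m) (sumn m - b) by []. nat_lia.
  rewrite (down_cons _ _ A VR); split=> [[[//]|[e' /IH D ->]]|[[r0 b0]|[e' D ->]]].
  - right; move: D; rewrite -mE => /(down_ins _ _ _ Fd)[e1 D ->]; exists e1 => //.
    by index_lia.
  - by case: noup.
  - right; exists (shift k (sumn ds + d) e').
      by apply/IH; rewrite -mE; apply: (down_ins _ _ _ Fd).2; exists e'.
    by index_lia.
move=> VR SR; rewrite (down_cons _ _ A VR) (run_ins _ Fm) (sum_ins _ Fm).
split=> [[[_ -> ->]|[e' /IH D ->]]|[[_ _ -> ->]|[e' /(down_ins _ _ _ Fm)[e1 D ->] ->]]].
- by left; split=> //; nat_lia.
- right; exists (shift 1 (sumn ds + d) e'); first by apply: (down_ins _ _ _ Fm).2; exists e'.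
  by index_lia.
- by left.
- right; exists e1; first exact/IH.
  by index_lia.
Qed.

(** * Lattice paths and compositions *)

Lemma count_idE (w : seq bool) : count_mem true w = count id w.
Proof. by apply: eq_count => -[]. Qed.

Lemma count_negbE (w : seq bool) : count_mem false w = count negb w.
Proof. by apply: eq_count => -[]. Qed.

Lemma size_counts (w : seq bool) : size w = count negb w + count id w.
Proof. by elim: w => // -[] w /= ->; rewrite ?addnS. Qed.

Fixpoint comp_of (w : seq bool) : seq nat :=
  match w with
  | [::] => [:: 0]
  | true :: w' => 0 :: comp_of w'
  | false :: w' => if comp_of w' is p :: m then p.+1 :: m else [:: 1]
  end.

Lemma comp_of_cons w : exists p m, comp_of w = p :: m.
Proof.
elim: w => [|[] w [p [m E]]]; first by exists 0, [::].
  by exists 0, (comp_of w).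
by exists p.+1, m; rewrite /= E.
Qed.

Lemma path_of_E p m : path_of (p.+1 :: m) = false :: path_of (p :: m).
Proof. by []. Qed.

Lemma path_of_N q m : path_of (0 :: q :: m) = true :: path_of (q :: m).
Proof. by []. Qed.

Lemma comp_ofK : cancel comp_of path_of.
Proof.
elim=> [|[] w IH] //=; have [p [m E]] := comp_of_cons w; rewrite E in IH *.
  by rewrite path_of_N IH.
by rewrite path_of_E IH.
Qed.

Lemma path_ofK mu : 0 < size mu -> comp_of (path_of mu) = mu.
Proof.
elim: mu => // p m IH _; elim: p => [|p IHp]; last by rewrite path_of_E /= IHp.
by case: m IH => [|q m] // IH; rewrite path_of_N /= IH.
Qed.

Lemma size_comp w : size (comp_of w) = (count_mem true w).+1.
Proof.
elim: w => [|[] w IH] //=; first by rewrite IH.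
by have [p [m E]] := comp_of_cons w; rewrite E in IH *.
Qed.

Lemma sumn_comp w : sumn (comp_of w) = count_mem false w.
Proof.
elim: w => [|[] w IH] //=.
by have [p [m E]] := comp_of_cons w; rewrite E in IH *; rewrite /= -IH.
Qed.

Definition point (w : seq bool) x y :=
  exists k, [/\ k <= size w, east w k = x & north w k = y].

Lemma point0 w : point w 0 0.
Proof. by exists 0; rewrite /east /north take0. Qed.

Lemma point_E w x y : point (false :: w) x y <->
  (x = 0 /\ y = 0) \/ (exists2 x', x = x'.+1 & point w x' y).
Proof.
split=> [[[|k] [ks <- <-]]|[[-> ->]|[x' -> [k [ks <- <-]]]]].
- by left.
- by right; exists (east w k) => //; exists k.
- exact: point0.
- by exists k.+1.
Qed.

Lemma point_N w x y : point (true :: w) x y <->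
  (x = 0 /\ y = 0) \/ (exists2 y', y = y'.+1 & point w x y').
Proof.
split=> [[[|k] [ks <- <-]]|[[-> ->]|[x' -> [k [ks <- <-]]]]].
- by left.
- by right; exists (north w k) => //; exists k.
- exact: point0.
- by exists k.+1.
Qed.

(** In row [y] the path visits the abscissae between two consecutive partial
    sums. *)
Lemma pointP w x y : point w x y <->
  y <= count_mem true w /\ sumn (take y (comp_of w)) <= x <= sumn (take y.+1 (comp_of w)).
Proof.
elim: w x y => [|[] w IH] x y.
- split=> [[[|k] [//= _ <- <-]] //|].
  by case: y => [|y] [//= _]; case: x => // _; apply: point0.
- rewrite point_N; split=> [[[-> ->] //|[y' -> /IH[H1 H2]]]|] //=.
  case: y => [|y] /=; first by rewrite take0; case: x => [|x] [_ //]; left.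
  by rewrite add1n ltnS !add0n => H; right; exists y => //; apply/IH.
- have [p [m E]] := comp_of_cons w; rewrite point_E /= E /=.
  have IH' := IH _ y; rewrite E in IH'.
  split=> [[[-> ->]|[x' -> /IH'[H1]]]|[H1]] //.
    by case: y {IH'} H1 => [|y] /= H1 H2; split=> //; lia.
  case: x => [|x]; first by case: y {IH'} H1 => [|y] //=; left.
  move=> H2; right; exists x => //; apply/IH'; split=> //.
  by case: y {IH'} H1 H2 => [|y] /=; lia.
Qed.

Lemma weakly_aboveP w w' : reflect
  (forall x y, point w x y -> exists2 y', point w' x y' & y' <= y)
  (weakly_above w w').
Proof.
apply: (iffP forallP) => [H x y [k [ks <- <-]]|H i].
  have /existsP[j /andP[/eqP E N]] := H (Ordinal (ks : k < (size w).+1)).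
  by exists (north w' j) => //; exists j; rewrite -ltnS ltn_ord.
have [|y' [k [ks E <-]] le] := H (east w i) (north w i).
  by exists i; rewrite -ltnS ltn_ord.
by apply/existsP; exists (Ordinal (ks : k < (size w').+1)); rewrite /= E eqxx.
Qed.

Lemma sumn_take_le (s : seq nat) i j : i <= j -> sumn (take i s) <= sumn (take j s).
Proof.
elim: s i j => [|x s IH] [|i] [|j] //= ij; first by rewrite leq_add2l IH.
Qed.

(** The lowest point of abscissa [x] on a path is in the first row that reaches
    [x]. *)
Lemma weakly_above_comp w w' : count_mem true w = count_mem true w' ->
  count_mem false w = count_mem false w' ->
  weakly_above w w' <-> forall i, sumn (take i (comp_of w)) <= sumn (take i (comp_of w')).
Proof.
move=> cN cE; split=> [/weakly_aboveP H i|H].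
  have full v : count_mem true v < i -> sumn (take i (comp_of v)) = count_mem false v.
    by move=> iv; rewrite take_oversize ?sumn_comp // size_comp.
  have [iN|Ni] := ltnP (count_mem true w) i; first by rewrite !full // -?cN // cE.
  case: i Ni {full} => [|i] Ni; first by rewrite !take0.
  have [|y' /pointP[_ /andP[_ H2]] le] := H (sumn (take i.+1 (comp_of w))) i.
    by apply/pointP; rewrite leqnn sumn_take_le // ltnW.
  by apply: leq_trans H2 (sumn_take_le _ _).
apply/weakly_aboveP => x y /pointP[yN /andP[H1 H2]].
have ex : exists y', x <= sumn (take y'.+1 (comp_of w')).
  by exists y; apply: leq_trans (H _).
have le : ex_minn ex <= y.
  by case: ex_minnP => m _; apply; apply: leq_trans (H _).
exists (ex_minn ex) => //; apply/pointP; split; first by rewrite -cN; apply: leq_trans yN.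
case: ex_minnP => [[|m]] Hm min; first by rewrite take0.
rewrite Hm andbT leqNgt; apply/negP => lt.
by have := min m (ltnW lt); rewrite ltnn.
Qed.

Fixpoint bounds (nu : seq nat) : seq nat :=
  if nu is _ :: ((_ :: _) as nu') then sumn nu' :: bounds nu' else [::].

Lemma head_bounds nu : head 0 (bounds nu) = sumn (behead nu).
Proof. by case: nu => [|p [|q nu]]. Qed.

Lemma bounds_adm nu delta : 0 < size nu -> increment_vector nu delta -> adm delta (bounds nu).
Proof.
rewrite /increment_vector; elim: nu delta => // p [|q nu] IH [|d ds] // _.
case/andP=> dq H; have -> : adm (d :: ds) (bounds [:: p, q & nu]) =
  (d + head 0 (bounds (q :: nu)) <= sumn (q :: nu)) && adm ds (bounds (q :: nu)) by [].
by rewrite IH // andbT head_bounds /= leq_add2r.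
Qed.

Lemma valid_bounds nu mu : 0 < size nu -> valid (bounds nu) mu <->
  size mu = size nu /\ forall i, 0 < i -> sumn (drop i nu) <= sumn (drop i mu).
Proof.
elim: nu mu => // p [|q nu] IH [|r mu] // _.
- by split=> [|[]].
- case: mu => [|? ?]; split=> //=; last by case=> [[]].
  by move=> _; split=> // -[|[|i]].
- by split=> // -[].
have -> : valid (bounds [:: p, q & nu]) (r :: mu) =
  (sumn (q :: nu) <= sumn mu) && valid (bounds (q :: nu)) mu by [].
split=> [/andP[H /IH[//|S Hi]]|[[S] Hi]].
  by split=> [|[|[|i]] // _]; [rewrite /= S | rewrite !drop1 | exact: (Hi i.+1)].
apply/andP; split; first by have := Hi 1 isT; rewrite !drop1.
apply/IH => //; split=> // i i0; exact: (Hi i.+1).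
Qed.

Lemma is_dyckP nu w : 0 < size nu ->
  is_dyck nu w <-> valid (bounds nu) (comp_of w) /\ sumn (comp_of w) = sumn nu.
Proof.
move=> n0; have nE := path_ofK n0; rewrite /is_dyck /same_endpoints.
have cE : count_mem false (path_of nu) = sumn nu by rewrite -sumn_comp nE.
have cN : (count_mem true (path_of nu)).+1 = size nu by rewrite -size_comp nE.
rewrite (valid_bounds _ n0) size_comp sumn_comp -cN -cE.
have td (s : seq nat) i : sumn (take i s) + sumn (drop i s) = sumn s.
  by rewrite -sumn_cat cat_take_drop.
split=> [/andP[/andP[/eqP E /eqP F]]|[[[F] H] E]].
  rewrite weakly_above_comp // nE => H; split=> //; split=> [|i _]; first by rewrite F.
  have := H i; have := td nu i; have := td (comp_of w) i.
  by rewrite sumn_comp E cE; lia.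
rewrite E F !eqxx /= weakly_above_comp // nE => -[|i]; first by rewrite !take0.
have := H i.+1 isT; have := td nu i.+1; have := td (comp_of w) i.+1.
by rewrite sumn_comp E cE; lia.
Qed.

Lemma altitude0 ds w : altitude ds w 0 = 0%R.
Proof. by rewrite /altitude /north /east take0 /= take0. Qed.

Lemma altitude_E ds w k : altitude ds (false :: w) k.+1 = (altitude ds w k - 1)%R.
Proof.
by rewrite /altitude /north /east /= add0n; lia.
Qed.

Lemma altitude_N d ds w k : altitude (d :: ds) (true :: w) k.+1 = (d%:Z + altitude ds w k)%R.
Proof.
by rewrite /altitude /north /east /= add0n; lia.
Qed.

Definition first_return (c : nat) ds w t :=
  [/\ t <= size w, (c%:Z + altitude ds w t = 0)%R &
    forall k, k < t -> (c%:Z + altitude ds w k <> 0)%R].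

Lemma first_return0 ds w : first_return 0 ds w 0.
Proof. by split=> //; rewrite altitude0. Qed.

Lemma first_return_E c ds w t :
  first_return c ds w t -> first_return c.+1 ds (false :: w) t.+1.
Proof.
move=> [tw E H]; split=> //; first by rewrite altitude_E; lia.
case=> [_|k kt]; first by rewrite altitude0; lia.
by have := H k kt; rewrite altitude_E; lia.
Qed.

Lemma first_return_N c d ds w t : 0 < c ->
  first_return (c + d) ds w t -> first_return c (d :: ds) (true :: w) t.+1.
Proof.
move=> c0 [tw E H]; split=> //; first by rewrite altitude_N; lia.
case=> [_|k kt]; first by rewrite altitude0; lia.
by have := H k kt; rewrite altitude_N; lia.
Qed.

Lemma first_return_fun c ds w t t' :
  first_return c ds w t -> first_return c ds w t' -> t = t'.
Proof.
move=> [_ E H] [_ E' H']; case: (ltngtP t t') => // tt; first by case: (H' _ tt).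
by case: (H _ tt).
Qed.

Lemma fits_pred ds bs c q m : fits ds bs c.+1 (q.+1 :: m) -> fits ds bs c (q :: m).
Proof.
case/and3P=> A V S; apply/and3P; split=> //; first by case: (bs) V.
by move: S; rewrite /= addnS addSn ltnS.
Qed.

(** Inserting one step at altitude [-c] in a composition is inserting the letter
    E at the first return to 0 from altitude [c]. *)
Lemma ins_word c ds bs q m : fits ds bs c (q :: m) ->
  exists2 t, first_return c ds (path_of (q :: m)) t &
    path_of (ins 1 c ds (q :: m)) =
      take t (path_of (q :: m)) ++ false :: drop t (path_of (q :: m)).
Proof.
elim: ds bs c q m => [|d ds IH] bs c q m; elim: q c => [|q IHq] [|c] F.
- by exists 0; [exact: first_return0 | rewrite take0 drop0 ins0 addn1].
- by case: bs F => [|b bs] /and3P[//]; case: m.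
- by exists 0; [exact: first_return0 | rewrite take0 drop0 ins0 addn1].
- have F' := fits_pred F.
  have [t T E] := IHq _ F'; exists t.+1; first exact: first_return_E.
  move: E; rewrite /= ltnS; case: ifP => _; first by rewrite addSn !path_of_E => ->.
  by rewrite path_of_E => ->.
- by exists 0; [exact: first_return0 | rewrite take0 drop0 ins0 addn1].
- case: bs F => [|b bs] F; first by case/and3P: F.
  have F' := fits_tail (ltn0Sn c) F; case: m F F' => [|r m] F F'.
    by case/and3P: F' => _ ; case: (bs).
  have [t T E] := IH _ _ _ _ F'; rewrite subn0 in T E.
  exists t.+1; first exact: first_return_N.
  rewrite /= subn0; move: E; case IE : (ins _ _ _ _) => [|r' m'].
    by have := size_ins 1 (c.+1 + d) ds (r :: m); rewrite IE.
  by rewrite !path_of_N => ->.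
- by exists 0; [exact: first_return0 | rewrite take0 drop0 ins0 addn1].
- have F' := fits_pred F.
  have [t T E] := IHq _ F'; exists t.+1; first exact: first_return_E.
  move: E; rewrite /= ltnS subSS; case: ifP => _; first by rewrite addSn !path_of_E => ->.
  by rewrite path_of_E => ->.
Qed.

(** Rotations of words, by recursion on the common prefix before the valley. *)
Inductive wrot : seq nat -> seq bool -> seq bool -> Prop :=
| wrot_here d ds w t : first_return d ds w t ->
    wrot (d :: ds) (false :: true :: w) (true :: take t w ++ false :: drop t w)
| wrot_E ds w w' : wrot ds w w' -> wrot ds (false :: w) (false :: w')
| wrot_N d ds w w' : wrot ds w w' -> wrot (d :: ds) (true :: w) (true :: w').

Lemma path_of_cons p m : 0 < size m -> path_of (p :: m) = nseq p false ++ true :: path_of m.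
Proof.
by case: m.
Qed.

Lemma wrot_nseq ds q w w' : wrot ds w w' -> wrot ds (nseq q false ++ w) (nseq q false ++ w').
Proof. by move=> R; elim: q => // q IH; apply: wrot_E. Qed.

Lemma rotation_wrot ds bs mu mu' e c : adm ds bs -> valid bs mu -> rotation ds mu mu' e c ->
  wrot ds (path_of mu) (path_of mu').
Proof.
move=> A V R; elim: R bs A V => {ds mu mu' e c} [d ds p mu|d ds p mu mu' e c R IH] [|b bs] // A V;
  have [A' V' H1 H2] := adm_valid_cons A V; have F := fits_cons A V;
  have sm := size_valid V'.
  rewrite !path_of_cons ?size_ins ?sm //; case: mu F {V V' H2 sm} => [|q m] F.
    by case/and3P: F; case: (bs).
  have [t T ->] := ins_word F; have -> : nseq p.+1 false = nseq p false ++ [:: false].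
    by rewrite cats1 -[p.+1]addn1 nseqD cats1.
  by rewrite -catA; apply: wrot_nseq; apply: wrot_here.
have [V1 _] := rotation_valid A' V' R.
rewrite !path_of_cons ?sm ?(size_valid V1) //.
by apply/wrot_nseq/wrot_N/(IH bs).
Qed.

Lemma rotation_succ ds q m q' m' e c : rotation ds (q :: m) (q' :: m') e c ->
  exists e', rotation ds (q.+1 :: m) (q'.+1 :: m') e' c.
Proof.
move=> R; inversion R as [d ds' p mu|d ds' p mu mu' e1 c1 R1]; subst.
  by exists (sumn (d :: ds') + q'.+1); apply: rotation_head.
by exists (lift_index d (sumn ds') q'.+1 e1); apply: rotation_tail.
Qed.

Lemma wrot_rotation ds bs w w' : adm ds bs -> valid bs (comp_of w) -> wrot ds w w' ->
  exists e c, rotation ds (comp_of w) (comp_of w') e c.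
Proof.
move=> A V R; elim: R bs A V => {ds w w'} [d ds w t T|ds w w' R IH|d ds w w' R IH] bs A V.
- case: bs A V => [|b bs] // A V; exists (sumn (d :: ds)), (size ds).
  have F : fits ds bs d (comp_of w) := fits_cons A V; rewrite [comp_of (false :: _)]/=.
  have -> : comp_of (true :: take t w ++ false :: drop t w) = 0 :: ins 1 d ds (comp_of w).
    rewrite /=; congr (_ :: _); have [p [m E]] := comp_of_cons w; rewrite E in F *.
    have [t' T' E'] := ins_word F; rewrite -E comp_ofK in T' E'.
    rewrite (first_return_fun T T') -E' path_ofK ?E //.
    by rewrite size_ins.
  by rewrite -[sumn _]addn0; apply: rotation_head.
- have [p [m E]] := comp_of_cons w; have [p' [m' E']] := comp_of_cons w'.
  have [|e [c]] := IH bs A.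
    by move: V; rewrite /= E; case: bs {A} => [|b bs]; rewrite ?E.
  rewrite /= E E' => /rotation_succ[e' R']; by exists e', c.
- case: bs A V => [|b bs] // /andP[_ A] /andP[_ V].
  have [e [c R']] := IH bs A V; exists (lift_index d (sumn ds) 0 e), c.
  exact: rotation_tail.
Qed.

Lemma rotatesP ds w w' : count_mem true w <= size ds -> rotates ds w w' <-> wrot ds w w'.
Proof.
move=> cw; split.
  case/existsP=> i /existsP[j /and5P[ij /eqP E /eqP F /eqP alt /andP[/forallP no /eqP ->]]].
  have jw : j <= size w by rewrite -ltnS.
  have {}no k : i.+1 < k -> k < j -> altitude ds w k != altitude ds w i.+1.
    move=> ik kj; have kw : k < (size w).+1 by apply: ltn_trans kj (ltn_ord j).
    by have /implyP := no (Ordinal kw); rewrite /= ik kj; apply.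
  move: (i : nat) (j : nat) ij E F alt no jw => {i j} i j.
  elim: i ds w j cw => [|i IH] ds [|x w] [|j] // cw.
    case: w cw => [|y w] cw; first by rewrite /=; lia.
    case: j => // j _ /= E F alt no jw; rewrite E F in alt no cw *.
    case: ds cw alt no => [|d ds] // cw alt no.
    apply: wrot_here; split=> //.
      by move: alt; rewrite !altitude_E altitude_N altitude0; lia.
    move=> k kj; have := no k.+2 isT kj.
    by rewrite !altitude_E altitude_N altitude0 => /eqP; lia.
  move=> ij E F alt no jw; case: x cw alt no E F jw => cw alt no E F jw.
    case: ds cw alt no => [|d ds] // cw alt no.
    apply: wrot_N; apply: IH => //.
      by move: alt; rewrite !altitude_N; lia.
    by move=> k ik kj; have := no k.+1 ik kj; rewrite !altitude_N => /eqP H; apply/eqP; lia.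
  apply: wrot_E; apply: IH => //.
    by move: alt; rewrite !altitude_E; lia.
  by move=> k ik kj; have := no k.+1 ik kj; rewrite !altitude_E => /eqP H; apply/eqP; lia.
move=> R; suff [i [j [ij jw E F [alt no ->]]]] : exists i j, [/\ i.+1 < j, j <= size w,
    nth true w i = false, nth false w i.+1 = true &
    [/\ altitude ds w j = altitude ds w i.+1,
      forall k, i.+1 < k -> k < j -> altitude ds w k <> altitude ds w i.+1 &
      w' = take i w ++ drop i.+1 (take j w) ++ false :: drop j w]].
  have iw : i < (size w).+1 by lia.
  apply/existsP; exists (Ordinal iw); apply/existsP; exists (Ordinal (jw : j < (size w).+1)).
  rewrite /= ij E F alt !eqxx andbT /=; apply/forallP => k.
  by apply/implyP => /andP[ik kj]; apply/eqP; apply: no.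
elim: R {cw} => {ds w w'}
  [d ds w t [tw E H]|ds w w' R [i [j [ij jw E F [alt no ->]]]]|
   d ds w w' R [i [j [ij jw E F [alt no ->]]]]].
- exists 0, t.+2; split=> //; split=> [|[|[|k]] // _ kt|].
  + by rewrite !altitude_E altitude_N altitude0; lia.
  + by have := H k kt; rewrite !altitude_E altitude_N altitude0; lia.
  + by rewrite /= ?take0 ?drop0.
- exists i.+1, j.+1; split=> //; split=> [|[|k] // ik kj|//].
  + by rewrite !altitude_E alt.
  + by have := no k ik kj; rewrite !altitude_E; lia.
- exists i.+1, j.+1; split=> //; split=> [|[|k] // ik kj|//].
  + by rewrite !altitude_N alt.
  + by have := no k ik kj; rewrite !altitude_N; lia.
Qed.

(** * Rowmotion of alt nu-Tamari lattices *)

Section AltTamari.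
Variables nu delta : seq nat.
Hypothesis nu0 : 0 < size nu.
Hypothesis incr : increment_vector nu delta.

Local Notation T := (dyck_path nu).
Local Notation bs := (bounds nu).
Local Notation mu x := (comp_of (val (val (x : T)))).

Let A : adm delta bs. Proof. exact: bounds_adm. Qed.

Lemma dyck_valid (x : T) : valid bs (mu x) /\ sumn (mu x) = sumn nu.
Proof. by apply/is_dyckP => //; apply: (valP x). Qed.

Lemma dyck_ex m : valid bs m -> sumn m = sumn nu -> exists x : T, mu x = m.
Proof.
move=> V S; have sm := size_valid V; have sn : size nu = size m.
  rewrite sm -(size_adm A); case: (nu) incr nu0 => // q s.
  by rewrite /increment_vector /= all2E => /andP[/eqP ->].
have E : comp_of (path_of m) = m by rewrite path_ofK // sm.
have sz : size (path_of m) == size (path_of nu).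
  rewrite !size_counts -!count_negbE -!count_idE -!sumn_comp E path_ofK // S eqn_add2l.
  by rewrite -eqSS -!size_comp E path_ofK // sn.
have D : is_dyck nu (Tuple sz) by apply/is_dyckP; rewrite //= E.
by exists (exist _ (Tuple sz) D).
Qed.

Lemma dyck_eq (x y : T) : mu x = mu y -> x = y.
Proof. by move/(can_inj comp_ofK) => E; apply/val_inj/val_inj. Qed.

Lemma dyck_rotates (x y : T) :
  rotates delta (val x) (val y) <-> exists e c, rotation delta (mu x) (mu y) e c.
Proof.
have [V S] := dyck_valid x.
rewrite rotatesP; last by rewrite -ltnS -size_comp (size_valid V) (size_adm A).
split; first by apply: wrot_rotation A V.
by case=> e [c] /(rotation_wrot A V); rewrite !comp_ofK.
Qed.

Local Notation g x i := (nth 0 (heights delta (mu x)) i).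

Lemma dyck_dim (x : T) i : sumn nu <= i -> g x i = 0.
Proof. by move=> H; have [V S] := dyck_valid x; rewrite nth_default // (size_heights A V) S. Qed.

(** Rotations lower coordinates; conversely [rotation_ex] provides a chain of
    rotations, which ends as the sum of the coordinates decreases. *)
Lemma dyck_leP (x y : T) :
  reflect (forall i, g y i <= g x i) (alt_tamari_le delta x y).
Proof.
apply: (iffP idP) => [/connectP[p]|].
  elim: p x => [|z p IH] x /= => [_ -> //|/andP[/dyck_rotates[e [c R]] P] E i].
  have [V _] := dyck_valid x; have [g1 g2 g3] := rotation_heights A V R.
  apply: leq_trans (IH _ P E i) _.
  by have [->|/g3->//] := eqVneq i e; rewrite g1 ltnW.
have [m] := ubnP (\sum_(i < sumn nu) g x i); elim: m x => // m IH x Wm le.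
have [E|ne] := eqVneq (mu x) (mu y); first by rewrite (dyck_eq E); apply: connect0.
have [V S] := dyck_valid x; have [V' S'] := dyck_valid y.
have [|m' [e [c [R B]]]] := rotation_ex A V V' _ le ne; first by rewrite S S'.
have [Vm Sm] := rotation_valid A V R; have [|z E] := dyck_ex Vm; first by rewrite Sm.
rewrite -E in R B; apply: connect_trans (connect1 _) (IH z _ B).
  by apply/dyck_rotates; exists e, c.
have [g1 g2 g3] := rotation_heights A V R.
have eN : e < sumn nu by rewrite ltnNge; apply/negP => /(dyck_dim x); rewrite g1.
apply: leq_trans (_ : \sum_(i < sumn nu) g x i <= m) => //.
rewrite (bigD1 (Ordinal eN)) //= [X in _ < X](bigD1 (Ordinal eN)) //= g1.
rewrite -addSn leq_add ?ltnS // leq_sum // => i ie.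
by rewrite g3.
Qed.

Definition row_path (x : T) : T :=
  odflt x [pick y : T | mu y == row_comp delta bs (mu x)].

Lemma row_pathE (x : T) : mu (row_path x) = row_comp delta bs (mu x).
Proof.
rewrite /row_path; case: pickP => [y /eqP //|no].
have [V S] := dyck_valid x; have [Vr Sr] := row_comp_valid A V.
by have [|y E] := dyck_ex Vr; rewrite ?Sr //; have := no y; rewrite E eqxx.
Qed.

Lemma row_path_inj : injective row_path.
Proof.
move=> x y /(congr1 (fun z => mu z)); rewrite !row_pathE.
have [V S] := dyck_valid x; have [V' S'] := dyck_valid y.
by move=> E; apply/dyck_eq/(row_comp_inj A V V') => //; rewrite S S'.
Qed.

Lemma rowmotion_path (x : T) : mu (rowmotion (@alt_tamari_le nu delta) x) = row_comp delta bs (mu x).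
Proof.
suff -> : rowmotion (@alt_tamari_le nu delta) = perm row_path_inj by rewrite permE row_pathE.
apply: (@rowmotion_unique _ _ (sumn nu) (fun x i => g x i)
  (fun x y e c => rotation delta (mu x) (mu y) e c)).
- exact: dyck_leP.
- move=> y z E; have [V S] := dyck_valid y; have [V' S'] := dyck_valid z.
  by apply/dyck_eq/(heights_inj A V V' _ E); rewrite S S'.
- exact: dyck_dim.
- move=> y z; have [V S] := dyck_valid y; have [V' S'] := dyck_valid z.
  have [|m [Vm Sm E]] := meet_ex A V V'; first by rewrite S S'.
  by have [|t tE] := dyck_ex Vm; [rewrite Sm | exists t => i; rewrite tE].
- by move=> y z e c R; have [V S] := dyck_valid y; exact: (rotation_heights A V R).
- move=> y z /dyck_leP le ne; have [V S] := dyck_valid y; have [V' S'] := dyck_valid z.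
  have ne' : mu y != mu z by apply: contra_neq ne; apply: dyck_eq.
  have [|m [e [c [R B]]]] := rotation_ex A V V' _ le ne'; first by rewrite S S'.
  have [Vm Sm] := rotation_valid A V R; have [|t E] := dyck_ex Vm; first by rewrite Sm.
  by exists t, e, c; rewrite E; split=> //; apply/dyck_leP => i; rewrite E.
- by move=> y z z' e c R R'; apply/dyck_eq/(rotation_fun R R').
- move=> y e c; have [V S] := dyck_valid y; rewrite permE row_pathE.
  have [Vr Sr] := row_comp_valid A V.
  split=> [[z R]|[z R]].
    have [|m Vm Rm] := (up_down_row e c A V).1; first by exists (mu z).
    have [_ Sm] := rotation_valid A Vm Rm.
    by have [|t E] := dyck_ex Vm; [rewrite -Sm Sr | exists t; rewrite E].
  have [Vz _] := dyck_valid z.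
  have [|m Rm] := (up_down_row e c A V).2; first by exists (mu z).
  have [Vm Sm] := rotation_valid A V Rm.
  by have [|t E] := dyck_ex Vm; [rewrite Sm | exists t; rewrite E].
Qed.

End AltTamari.

(** * Promotion of words above a line *)

Section Words.
Variables a b : nat.
Local Open Scope ring_scope.

(** Weighted so that the diagonal of the rectangle is the line of height 0. *)
Definition wt (c : bool) : int := if c then b%:Z else - a%:Z.

Definition wsum (w : seq bool) : int := foldr (fun c s => wt c + s) 0 w.

Fixpoint above (h : int) (w : seq bool) : bool :=
  if w is c :: w' then (0 <= h + wt c) && above (h + wt c) w' else true.

(** From height [h], the first E that would lead below 0 is changed into N and
    is put back at the end; if no E does, N is put at the end. *)
Fixpoint jump (h : int) (w : seq bool) : seq bool :=
  if w is c :: w' then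
    if 0 <= h + wt c then c :: jump (h + wt c) w' else true :: rcons w' false
  else [:: true].

Definition promote (w : seq bool) : seq bool :=
  if w is _ :: w' then jump 0 w' else [::].

Lemma wsum_cat u v : wsum (u ++ v) = wsum u + wsum v.
Proof. by elim: u => [|c u IH] /=; lia. Qed.

Lemma above_cat h u v : above h (u ++ v) = above h u && above (h + wsum u) v.
Proof.
elim: u h => [|c u IH] h /=; first by rewrite addr0.
by rewrite IH -andbA; do 2!f_equal; congr above; lia.
Qed.

Lemma above_le h h' w : h <= h' -> above h w -> above h' w.
Proof.
elim: w h h' => [|c w IH] h h' //= hh /andP[H1 H2].
by apply/andP; split; [lia | apply: IH H2; lia].
Qed.

Lemma above_sum h w : 0 <= h -> above h w -> 0 <= h + wsum w.
Proof.
elim: w h => [|c w IH] h /=; first by lia.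
by move=> h0 /andP[H1 /(IH _ H1)]; lia.
Qed.

Lemma aboveP h w : (forall i, (i <= size w)%N -> (0 <= h + wsum (take i w))%R) -> above h w.
Proof.
elim: w h => //= c w IH h H; apply/andP; split.
  have := H 1 isT; have -> : take 1 (c :: w) = [:: c] by rewrite /= take0.
  by rewrite /=; lia.
by apply: IH => i iw; have := H i.+1 iw; rewrite /=; lia.
Qed.

Lemma jump_cat h u v : above h u -> jump h (u ++ v) = u ++ jump (h + wsum u) v.
Proof.
elim: u h => [|c u IH] h /=; first by rewrite addr0.
by case/andP=> -> H; rewrite IH //; congr (_ :: _ ++ jump _ _); lia.
Qed.

Lemma jump_fail h w : h < a%:Z -> jump h (false :: w) = true :: rcons w false.
Proof. by rewrite /= /wt => H; case: ifP => //; lia. Qed.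

Lemma first_fail h w : 0 <= h -> ~~ above h w ->
  exists u v, [/\ w = u ++ false :: v, above h u & h + wsum u < a%:Z].
Proof.
elim: w h => [|c w IH] h //= h0.
case: (boolP (0 <= h + wt c)) => H /=.
  by case/(IH _ H) => u [v [-> P S]]; exists (c :: u), v; split; rewrite //= ?H //; lia.
by move=> _; exists [::], w; move: H; case: c; rewrite /wt => H; split=> //=; lia.
Qed.

Lemma wsumE w : wsum w = (b * count id w)%:Z - (a * count negb w)%:Z.
Proof. by elim: w => [|c w IH] /=; [lia | rewrite IH /wt; case: c => /=; lia]. Qed.

(** A sum [b * x - a * y] with [0 < y < b] does not vanish, [a] and [b] being
    coprime. *)
Lemma wsum_neq0 w : coprime a b -> (0 < count negb w < b)%N -> wsum w != 0.
Proof.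
move=> co /andP[H1 H2]; apply/eqP; rewrite wsumE => H.
have : (b %| a * count negb w)%N.
  by apply/dvdnP; exists (count id w); lia.
by rewrite Gauss_dvdr 1?coprime_sym // => /dvdn_leq; lia.
Qed.

Definition rot1 (w : seq bool) := rotr 1 w.

Lemma iter_rot1 u v : iter (size v) rot1 (u ++ v) = v ++ u.
Proof.
elim/last_ind: v u => [|v c IH] u; first by rewrite cats0.
by rewrite size_rcons iterSr -rcons_cat /rot1 rotr1_rcons -/rot1 (IH (c :: u)) cat_rcons.
Qed.

(** Follows a word under promotion, in a frame that rotates with it. *)
Definition unrot (t : nat) (w : seq bool) := iter t rot1 (iter t promote w).

Lemma unrotD s t w : unrot (s + t) w = iter s rot1 (unrot t (iter s promote w)).
Proof. by rewrite /unrot -!iterD (addnC t). Qed.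

Hypothesis co : coprime a b.
Hypothesis a0 : (0 < a)%N.
Hypothesis b0 : (0 < b)%N.

Lemma promote_fail u v : above 0 u -> wsum u < a%:Z ->
  promote (true :: u ++ false :: v) = u ++ true :: rcons v false.
Proof. by move=> P S; rewrite /= jump_cat // jump_fail // add0r. Qed.

Lemma promote_end u : above 0 u -> promote (true :: u) = rcons u true.
Proof. by move=> P; rewrite /= -[X in jump _ X]cats0 jump_cat //= cats1. Qed.

(** The letter counts of a path that lacks its last east step. By coprimality,
    the factors of such a word that contain E have nonzero sum. *)
Definition full w := (wsum w == a%:Z) && (count negb w < b)%N.

Ltac word_lia :=
  repeat match goal with
  | H : is_true (above _ _) |- _ => clear H
  | H : is_true (full _) |- _ => clear H
  | H : is_true (coprime _ _) |- _ => clear H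
  end; lia.

(** After |G| promotions the two halves of [G ++ X] have changed places;
    moreover few words are visited in the rotating frame. *)
Definition exchange G X :=
  iter (size G) promote (G ++ X) = X ++ G /\
  exists2 S, (size S <= count negb G)%N &
    forall t, (t <= size G)%N -> unrot t (G ++ X) \in (G ++ X) :: S.

(** Second stage of [exchangeP] when [G] is N Y E H with E the first step that
    would fail: as many promotions as N Y is long have been done, as many as E H
    is long remain. The induction hypothesis [IH] treats a prefix of H up to the
    next failing step, and the lemma applies again to the rest of H, with a
    longer [Y]. *)
Lemma exchange_rec n :
  (forall G X, (size G < n)%N -> above 0 G -> above 0 X -> full (G ++ X) -> exchange G X) ->
  forall H Y X, (size H < n)%N ->
  above 0 (true :: Y ++ false :: H) -> above 0 X ->
  wsum Y < a%:Z -> above (a%:Z - wsum Y) Y ->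
  full (true :: Y ++ false :: H ++ X) ->
  let w := true :: H ++ X ++ false :: Y in
  let w' := X ++ true :: Y ++ false :: H in
  iter (size H).+1 promote w = w' /\
  exists2 S, (size S <= count negb H)%N &
    forall t, (t <= (size H).+1)%N -> unrot t w \in [:: w, iter (size H).+1 rot1 w' & S].
Proof.
move=> IH H; have [m] := ubnP (size H); elim: m H => // m IHm H Hm Y X Hn P PX SY PY F w w'.
have [WT CT] : wsum (true :: Y ++ false :: H ++ X) = a%:Z /\
    (count negb (true :: Y ++ false :: H ++ X) < b)%N by case/andP: F => /eqP.
move: WT CT; rewrite /= !wsum_cat /= wsum_cat !count_cat /= count_cat /wt => WT CT.
have : above b%:Z Y && above (b%:Z + wsum Y - a%:Z) H && (0 <= b%:Z + wsum Y - a%:Z).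
  move: P; rewrite /= above_cat /= /wt !add0r => /and3P[P1 P2 P3].
  by rewrite P1 P2 P3.
move=> /andP[/andP[PY' PH'] S1].
have PNH : above b%:Z H by apply: above_le PH'; word_lia.
have X0 : 0 <= wsum X by rewrite -[wsum X]add0r above_sum.
have S2 : 0 < b%:Z + wsum Y - a%:Z.
  have := @wsum_neq0 (true :: rcons Y false) co.
  rewrite -cats1 /= count_cat wsum_cat /= /wt => /(_ _) /eqP; word_lia.
(* No step of H fails, so the E in front of Y is the first that does; then IH
   exchanges H with all that follows. *)
case: (boolP (above 0 H)) => PH.
  have Pw : iter 1 promote w = H ++ X ++ true :: rcons Y false.
    rewrite /w /= -/(promote (true :: _)) catA promote_fail ?catA //.
    + by rewrite above_cat PH (above_le _ PX) // add0r -[wsum H]add0r above_sum.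
    + by rewrite wsum_cat; word_lia.
  have A1 : above 0 (X ++ true :: rcons Y false).
    rewrite above_cat PX /= -cats1 above_cat /= /wt andbT.
    by apply/and3P; split; [word_lia | apply: above_le PY'; word_lia | word_lia].
  have A2 : full (H ++ X ++ true :: rcons Y false).
    rewrite /full !wsum_cat !count_cat /= -cats1 wsum_cat count_cat /= /wt.
    by apply/andP; split; word_lia.
  have [E1 [S ZS VS]] := IH H _ Hn PH A1 A2.
  have E2 : iter (size H).+1 promote w = w'.
    by rewrite iterSr -[promote w]/(iter 1 promote w) Pw E1 /w' -cats1 -!catA /= -catA.
  split=> //; exists (map rot1 S) => [|t tH]; first by rewrite size_map.
  case: t tH => [|t] tH; first by rewrite inE /unrot /= eqxx.
  rewrite -add1n unrotD Pw.
  have -> : iter (size H) rot1 w' = H ++ X ++ true :: rcons Y false.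
    have -> : w' = (X ++ true :: rcons Y false) ++ H by rewrite /w' -catA /= cat_rcons.
    exact: iter_rot1.
  by rewrite inE -map_cons (map_f rot1 (VS t tH)) orbT.
(* H = G2 E H' with E the next failing step: exchange G2 first, then apply
   the lemma to H' with Y E G2 in place of Y. *)
have {PH} [G2 [H' [HE PG2 SG2]]] := first_fail (lexx 0) PH.

have SG0 : 0 <= wsum G2 by rewrite -[wsum G2]add0r above_sum.
have sH : size H = (size G2 + (size H').+1)%N by rewrite HE size_cat.
have sumH : wsum H = wsum G2 - a%:Z + wsum H' by rewrite HE wsum_cat /= /wt; word_lia.
have cntH : count negb H = (count negb G2 + (count negb H').+1)%N.
  by rewrite HE count_cat.
have PNH' : above b%:Z H'.
  move: PNH; rewrite HE above_cat => /andP[_ /= /andP[_]].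
  by apply: above_le; rewrite /wt; word_lia.
have X0' : 0 <= b%:Z + wsum H' by apply: above_sum.
pose X3 := true :: H' ++ X ++ false :: rcons Y false.
have Pw : promote w = G2 ++ X3.
  have -> : w = true :: G2 ++ false :: (H' ++ X ++ false :: Y).
    by rewrite /w HE -catA.
  by rewrite promote_fail //; [rewrite /X3 !rcons_cat | word_lia].
have PX3 : above 0 X3.
  rewrite /X3 /= !above_cat /= -cats1 above_cat /= andbT /wt !add0r PNH'.
  rewrite (above_le _ PX) ?(above_le _ PY); try word_lia.
  do ?[apply/andP; split=> //]. all: try word_lia.
have F3 : full (G2 ++ X3).
  rewrite /full /X3 wsum_cat count_cat /= !wsum_cat !count_cat /= -cats1 wsum_cat count_cat /= /wt.
  by apply/andP; split; word_lia.
have [|E3 [S3 ZS3 VS3]] := IH G2 X3 _ PG2 PX3 F3; first by word_lia.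
have E34 : X3 ++ G2 = true :: H' ++ X ++ false :: Y ++ false :: G2.
  by rewrite /X3 -cats1 /= -!catA /= -catA.
have P4 : above 0 (true :: (Y ++ false :: G2) ++ false :: H').
  by move: P; rewrite HE -catA.
have F4 : full (true :: (Y ++ false :: G2) ++ false :: H' ++ X).
  by move: F; rewrite HE -!catA.
have [||||E4 [S4 ZS4 VS4]] := IHm H' _ (Y ++ false :: G2) X _ P4 PX _ _ F4; try word_lia.
- by rewrite wsum_cat /= /wt; word_lia.
- rewrite wsum_cat above_cat /= /wt; apply/and3P; split; last 1 first.
  + by apply: above_le PG2; word_lia.
  + by apply: above_le PY; word_lia.
  + by word_lia.
rewrite -E34 in E4 VS4.
have E5 : iter (size G2).+1 promote w = X3 ++ G2 by rewrite iterSr Pw.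
have Ew' : X ++ true :: (Y ++ false :: G2) ++ false :: H' = w'.
  by rewrite /w' HE -catA.
rewrite Ew' in E4 VS4.
split.
  rewrite -iterS; have -> : ((size H).+1 = (size H').+1 + (size G2).+1)%N by word_lia.
  by rewrite iterD E5.
exists (rot1 (G2 ++ X3) :: map rot1 S3 ++ map (iter (size G2).+1 rot1) S4).
  by rewrite /= size_cat !size_map; word_lia.
move=> t tH; case: t tH => [|t] tH; first by rewrite inE /unrot /= eqxx.
have [tG|tG] := leqP t (size G2).
  rewrite -add1n unrotD [iter 1 promote _]Pw /= 2!inE -cat_cons mem_cat -map_cons.
  by rewrite (map_f rot1 (VS3 t tG)) !orbT.
have -> : t.+1 = ((size G2).+1 + (t - size G2))%N by word_lia.
rewrite unrotD E5; have /VS4 : (t - size G2 <= (size H').+1)%N by word_lia.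
move: (unrot _ _) => v; rewrite !inE => /or3P[/eqP->|/eqP->|vS].
- by rewrite [iter (size G2).+1 _ _]iterS iter_rot1 eqxx !orbT.
- by rewrite -!iterS -iterD sH addSn eqxx !orbT.
- by rewrite mem_cat (map_f _ vS) !orbT.
Qed.

(** Induction on the length of [G], which starts with N. If the rest [G'] of [G]
    does not cross 0, one promotion moves this N behind [X], and the hypothesis
    applies to [G']. Otherwise [G = N Y E H] with E the first failing step; one
    promotion gives [Y N H X E], the hypothesis exchanges [Y] with the rest, and
    [exchange_rec] does the remaining steps. New words appear once for the
    failing step, and otherwise at most as often as there are letters E in [Y]
    and [H]. *)
Lemma exchangeP G X : above 0 G -> above 0 X -> full (G ++ X) -> exchange G X.
Proof.
have [n] := ubnP (size G); elim: n G X => // n IHn G X Gn PG PX F.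
have {}IHn G' X' : (size G' < n)%N -> above 0 G' -> above 0 X' -> full (G' ++ X') ->
  exchange G' X' by exact: IHn.
case: G Gn PG F => [|c G] Gn PG F.
  rewrite /exchange /= cats0; split=> //; exists [::] => // t.
  by rewrite leqn0 => /eqP->; rewrite mem_head.
case: c PG F Gn => [] PG F Gn; last by move: PG; rewrite /= /wt; case/andP; lia.
case: (boolP (above 0 G)) => PG0.
  have A1 : above 0 (X ++ [:: true]).
    rewrite above_cat PX /= andbT add0r /wt.
    by have := above_sum (lexx 0) PX; word_lia.
  have A2 : full (G ++ X ++ [:: true]).
    by move: F; rewrite /full /= !wsum_cat !count_cat /= => /andP[/eqP ? ?]; apply/andP; split; word_lia.
  have [|E [S ZS VS]] := IHn G _ _ PG0 A1 A2; first by move: Gn => /=; word_lia.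
  have Pw : promote ((true :: G) ++ X) = G ++ X ++ [:: true].
    rewrite cat_cons promote_end ?catA ?cats1 // above_cat PG0 add0r.
    by apply: above_le PX; rewrite -[wsum G]add0r above_sum.
  split; first by rewrite [size _]/= iterSr Pw E -catA.
  exists (map rot1 S) => [|t tG]; first by rewrite size_map.
  case: t tG => [|t] tG; first by rewrite /unrot mem_head.
  rewrite -add1n unrotD [iter 1 promote _]Pw.
  have -> : (true :: G) ++ X = rot1 (G ++ X ++ [:: true]).
    by rewrite catA [RHS](iter_rot1 (G ++ X) [:: true]).
  by rewrite -map_cons (map_f rot1 (VS t tG)).
have {PG0} [G1 [H [GE PG1 SG1]]] := first_fail (lexx 0) PG0.
rewrite {}GE in PG F Gn *.
have [WT CT] : wsum ((true :: G1 ++ false :: H) ++ X) = a%:Z /\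
    (count negb ((true :: G1 ++ false :: H) ++ X) < b)%N by case/andP: F => /eqP.
move: WT CT; rewrite /= !wsum_cat /= !count_cat /= /wt => WT CT.
have : above b%:Z G1 && above (b%:Z + wsum G1 - a%:Z) H && (0 <= b%:Z + wsum G1 - a%:Z).
  move: PG; rewrite /= above_cat /= /wt !add0r => /and3P[P1 P2 P3].
  by rewrite P1 P2 P3.
move=> /andP[/andP[_ PH'] S1].
have PH : above b%:Z H by apply: above_le PH'; word_lia.
have SH : 0 <= b%:Z + wsum G1 - a%:Z + wsum H by apply: above_sum.
have SG0 : 0 <= wsum G1 by rewrite -[wsum G1]add0r above_sum.
pose X1 := true :: rcons (H ++ X) false.
have Pw : promote ((true :: G1 ++ false :: H) ++ X) = G1 ++ X1.
  by rewrite cat_cons -catA cat_cons promote_fail //; word_lia.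
have PX1 : above 0 X1.
  rewrite /X1 /= -cats1 !above_cat /= /wt !add0r PH wsum_cat andbT.
  apply/andP; split; first by apply/andP; split=> //; apply: above_le PX; word_lia.
  by word_lia.
have F1 : full (G1 ++ X1).
  rewrite /full /X1 wsum_cat count_cat /= -cats1 !wsum_cat !count_cat /= /wt.
  by apply/andP; split; word_lia.
have [|E1 [S1' ZS1 VS1]] := IHn G1 X1 _ PG1 PX1 F1.
  by move: Gn; rewrite /= size_cat /=; word_lia.
have E12 : X1 ++ G1 = true :: H ++ X ++ false :: G1.
  by rewrite /X1 -cats1 /= -!catA.
have N1 : (size H < n)%N by move: Gn; rewrite /= size_cat /=; word_lia.
have N2 : above (a%:Z - wsum G1) G1 by apply: above_le PG1; word_lia.
have N3 : full (true :: G1 ++ false :: H ++ X) by move: F; rewrite cat_cons -catA.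
have SG1' : wsum G1 < a%:Z by rewrite -[wsum G1]add0r.
have [] := exchange_rec IHn N1 PG PX SG1' N2 N3.
rewrite -E12 => E2 [S2 ZS2 VS2].
have E3 : iter (size G1).+1 promote ((true :: G1 ++ false :: H) ++ X) = X1 ++ G1.
  by rewrite iterSr Pw E1.
have sz : size (true :: G1 ++ false :: H) = ((size G1).+1 + (size H).+1)%N.
  by rewrite /= size_cat /=; word_lia.
split; first by rewrite sz addnC iterD E3.
exists (rot1 (G1 ++ X1) :: map rot1 S1' ++ map (iter (size G1).+1 rot1) S2).
  by rewrite /= !size_cat !size_map count_cat /=; word_lia.
move=> t tH; case: t tH => [|t] tH; first by rewrite /unrot mem_head.
have [tG|tG] := leqP t (size G1).
  rewrite -add1n unrotD [iter 1 promote _]Pw.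
  have := map_f rot1 (VS1 t tG).
  by rewrite map_cons !in_cons mem_cat => /orP[->|->]; rewrite !orbT.
have -> : t.+1 = ((size G1).+1 + (t - size G1))%N by word_lia.
rewrite unrotD E3; have /VS2 : (t - size G1 <= (size H).+1)%N by move: tH; rewrite sz; word_lia.
move: (unrot _ _) => v; rewrite !inE => /or3P[/eqP->|/eqP->|vS].
- by rewrite [iter (size G1).+1 _ _]iterS iter_rot1 eqxx !orbT.
- rewrite -iterD -sz.
  by rewrite (iter_rot1 X (true :: G1 ++ false :: H)) eqxx.
- by rewrite mem_cat (map_f _ vS) !orbT.
Qed.

Definition period := (a + b).-1.

Definition word (w : seq bool) := (size w == period) && (count id w == a).
(** [w] followed by an E is a path from corner to corner above the diagonal. *)
Definition good (w : seq bool) := word w && above 0 w.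

Lemma wordP w : word w -> [/\ size w = period, wsum w = a%:Z & count negb w = b.-1].
Proof.
move=> /andP[/eqP S /eqP C]; have := count_predC id w.
have -> : count (predC id) w = count negb w by apply: eq_count.
rewrite C S /period => H; have nE : count negb w = b.-1 by lia.
split=> //; rewrite wsumE C nE.
have : (b * a = a * b.-1 + a)%N by rewrite -{1}(prednK b0) mulSn mulnC addnC.
by lia.
Qed.

Lemma word_full w : word w -> full w.
Proof. by move/wordP=> [_ W C]; rewrite /full W eqxx C; lia. Qed.

Lemma word_rot n w : word (rot n w) = word w.
Proof.
rewrite /word size_rot; congr (_ && (_ == _)).
by apply/seq.permP; rewrite perm_rot.
Qed.

Lemma size_jump h w : size (jump h w) = (size w).+1.
Proof. by elim: w h => [|c w IH] h //=; case: ifP; rewrite /= ?IH ?size_rcons. Qed.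

Lemma size_promote w : size (promote w) = size w.
Proof. by case: w => [|c w] //=; rewrite size_jump. Qed.

Lemma good_true w : good w -> exists2 w', w = true :: w' & above b%:Z w'.
Proof.
case: w => [|c w] /andP[Ww].
  by move: Ww; rewrite /word /period /= => /andP[/eqP]; lia.
case: c Ww => Ww H; first by exists w => //; move: H; rewrite /= add0r => /andP[].
by move: H => /= /andP[]; rewrite /wt; lia.
Qed.

Lemma good_promote w : good w -> good (promote w).
Proof.
move=> Gw; have [w' E P] := good_true Gw; case/andP: Gw => Ww _.
have [S W C] := wordP Ww; rewrite /good /word size_promote S eqxx /=.
move: Ww => /andP[_ /eqP Cw].
case: (boolP (above 0 w')) => P0.
  rewrite E promote_end // -cats1 above_cat P0 count_cat /= andbT.
  move: Cw W; rewrite E /= /wt => Cw W; apply/andP; split; first by apply/eqP; lia.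
  by have := above_sum (lexx 0) P0; lia.
have [u [v [E' Pu Su]]] := first_fail (lexx 0) P0.
rewrite E E' promote_fail //; last lia.
move: P; rewrite E' above_cat /= => /andP[_ /andP[P1 P2]].
move: W Cw; rewrite E E' /= wsum_cat !count_cat /= -cats1 count_cat /= /wt => W Cw.
rewrite above_cat Pu /= above_cat /= andbT.
rewrite (above_le _ P2) /=; last by rewrite /wt; lia.
have S0 : 0 <= wsum u by rewrite -[wsum u]add0r above_sum.
by apply/andP; split; [apply/eqP; lia | apply/andP; split; rewrite /wt; lia].
Qed.

Lemma good_iter n w : good w -> good (iter n promote w).
Proof. by move=> G; elim: n => // n; apply: good_promote. Qed.

Lemma promote_rot j w : (j <= period)%N -> good w -> good (rot j w) ->
  iter j promote w = rot j w.
Proof.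
move=> jN /andP[Ww Pw] /andP[_ Pr]; have [S _ _] := wordP Ww.
move: Pw Pr; rewrite /rot -{1}(cat_take_drop j w) !above_cat => /andP[P1 _] /andP[P2 _].
have [|+ _] := exchangeP P1 P2; first by rewrite cat_take_drop word_full.
by rewrite cat_take_drop size_takel // S.
Qed.

Lemma promote_period w : good w -> iter period promote w = w.
Proof.
move=> G; have [S _ _] : [/\ size w = period, wsum w = a%:Z & count negb w = b.-1].
  by apply: wordP; case/andP: G.
by rewrite promote_rot // -S rot_size.
Qed.

Lemma iter_period q w : good w -> iter (q * period) promote w = w.
Proof. by move=> G; elim: q => // q IH; rewrite mulSn iterD IH promote_period. Qed.

(** [exchangeP] for the whole word and the empty one: it has [b - 1] letters E.
    *)
Lemma visited_bound w : good w ->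
  exists2 S, (size S <= b)%N & forall t, (t <= period)%N -> unrot t w \in S.
Proof.
move=> /andP[Ww Pw]; have [S _ C] := wordP Ww.
have [|_ [S0 H1 H2]] := @exchangeP w [::] Pw isT; first by rewrite cats0 word_full.
exists (w :: S0); first by move: H1; rewrite /= C; lia.
by move=> t tN; have := H2 t; rewrite cats0 S; apply.
Qed.

Lemma jump_keep h w i : nth false w i -> nth false (jump h w) i.
Proof.
elim: w h i => [|c w IH] h i /=; first by rewrite nth_nil.
case: ifP => _; case: i => [|i] //=; first exact: IH.
by rewrite nth_rcons; case: ltnP => // H; rewrite nth_default.
Qed.

(** Promotion shifts letters to the left, and the only one it changes on the way
    is an E that becomes N. *)
Lemma promote_keep j w i : nth false w (j + i) -> nth false (iter j promote w) i.
Proof.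
elim: j i => [|j IH] i //; rewrite addSnnS => /IH.
case: (iter j promote w) (iterS j promote w) => [|c v] -> //=.
exact: jump_keep.
Qed.

End Words.

(** * Counting words fixed by powers of promotion *)

Lemma card_words n m : #|[set w : n.-tuple bool | count id w == m]| = 'C(n, m).
Proof.
pose f (w : n.-tuple bool) := [set i | tnth w i].
have fB : bijective f.
  exists (fun A : {set 'I_n} => [tuple (i \in A) | i < n]) => [w|A].
    by apply: eq_from_tnth => i; rewrite tnth_mktuple inE.
  by apply/setP => i; rewrite inE tnth_mktuple.
rewrite -[n in RHS]card_ord -card_draws -(on_card_preimset (f := f)); last first.
  exact: onW_bij.
apply: eq_card => w; rewrite !inE; congr (_ == _).
rewrite -sum1dep_card -sum1_count -[in LHS](map_tnth_enum w) big_map big_enum_cond /=.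
by [].
Qed.

Lemma nth_flatten_nseq (d : nat) (s : seq bool) i : i < d * size s ->
  nth false (flatten (nseq d s)) i = nth false s (i %% size s).
Proof.
elim: d i => [|d IH] i //=; rewrite mulSn nth_cat => H.
case: ltnP => iS; first by rewrite modn_small.
rewrite IH; last lia.
by rewrite -[in RHS](subnK iS) modnDr.
Qed.

Lemma nth_rot_fix k (u : seq bool) q i : k <= size u -> rot k u = u ->
  i + q * k < size u -> nth false u (i + q * k) = nth false u i.
Proof.
move=> ku E; elim: q => [|q IH] iS; first by rewrite addn0.
rewrite -IH; last by move: iS; rewrite mulSn; lia.
have -> : i + q.+1 * k = k + (i + q * k) by rewrite mulSn; lia.
rewrite -{2}E /rot nth_cat size_drop nth_drop.
case: ltnP => //; move: iS; rewrite mulSn; lia.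
Qed.

Lemma rot_fix_modn k (u : seq bool) i : 0 < k <= size u -> rot k u = u ->
  i < size u -> nth false u i = nth false u (i %% k).
Proof.
case/andP=> k0 ku E iS; rewrite {1}(divn_eq i k) addnC (nth_rot_fix ku E) //.
by rewrite addnC -divn_eq.
Qed.

(** Such a word is [d] copies of a word of length [k]. *)
Lemma card_rot_fix n k d m : n = d * k -> 0 < d -> 0 < k ->
  #|[set u : n.-tuple bool | (count id u == m) && (rot k u == u :> seq bool)]| =
  if d %| m then 'C(k, m %/ d) else 0.
Proof.
move=> nE d0 k0.
have per (u : n.-tuple bool) : rot k u = u :> seq bool ->
    flatten (nseq d (take k u)) = u.
  move=> E; have kn : k <= size u by rewrite size_tuple nE leq_pmull.
  have sk : size (take k u) = k by rewrite size_takel.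
  have sf : size (flatten (nseq d (take k u))) = n.
    by rewrite size_flatten /shape map_nseq sumn_nseq sk mulnC.
  apply: (@eq_from_nth _ false) => [|i]; rewrite sf ?size_tuple // => iS.
  rewrite nth_flatten_nseq sk -?nE // nth_take ?ltn_pmod //.
  by rewrite [RHS](@rot_fix_modn k) ?k0 // ?size_tuple // -?nE; move: kn; rewrite size_tuple.
have cnt s : count id (flatten (nseq d s)) = d * count id s.
  by rewrite count_flatten map_nseq sumn_nseq mulnC.
case: ifP => [dm|/negP dm]; last first.
  apply: eq_card0 => u; rewrite !inE; apply/negP => /andP[/eqP C /eqP E].
  by apply: dm; rewrite -C -(per u E) cnt dvdn_mulr.
have szf (s : k.-tuple bool) : size (flatten (nseq d (val s))) == n.
  by rewrite size_flatten /shape map_nseq sumn_nseq size_tuple nE mulnC.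
pose h (s : k.-tuple bool) : n.-tuple bool := Tuple (szf s).
rewrite -card_words -(card_imset (f := h)); last first.
  move=> s s' /(congr1 val) /= E; apply: val_inj => /=.
  have tk (v : k.-tuple bool) : take k (flatten (nseq d (val v))) = v.
    by case: (d) d0 => // d' _ /=; rewrite take_size_cat ?size_tuple.
  by rewrite -(tk s) E tk.
apply: eq_card => u; rewrite !inE; apply/andP/imsetP.
  case=> /eqP C /eqP E; have kn : k <= n by rewrite nE leq_pmull.
  have szt : size (take k u) == k by rewrite size_takel ?size_tuple.
  exists (Tuple szt); last by apply: val_inj; rewrite /= per.
  by rewrite inE /= -(eqn_pmul2l d0) -cnt per // C [d * _]mulnC divnK.
case=> s; rewrite inE => /eqP C ->; split; first by rewrite /= cnt C mulnC divnK.
rewrite /=; case: (d) d0 => // d' _; rewrite /= -{1}(size_tuple s) rot_size_cat.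
by apply/eqP; elim: d' => [|d' IH] /=; rewrite ?cats0 // -catA IH.
Qed.

Lemma leq_card_rel (T U : finType) (A : {set T}) (B : {set U}) (R : T -> U -> bool) :
  (forall x, x \in A -> exists2 u, u \in B & R x u) ->
  (forall x y u, x \in A -> y \in A -> R x u -> R y u -> x = y) ->
  #|A| <= #|B|.
Proof.
move=> RA RI; pose f x := [pick u in B | R x u].
have fP x : x \in A -> exists2 u, f x = Some u & (u \in B) && R x u.
  move=> /RA[u uB Ru]; rewrite /f; case: pickP => [v|/(_ u)]; first by exists v.
  by rewrite uB Ru.
rewrite -(card_in_imset (f := f)) => [|x y xA yA]; last first.
  have [u -> /andP[_ Rxu]] := fP x xA; have [v -> /andP[_ Ryv]] := fP y yA.
  by case=> uv; apply: RI xA yA Rxu _; rewrite uv.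
rewrite -(card_imset B (f := @Some U)); last by move=> ? ? [].
apply/subset_leq_card/subsetP => w.
by case/imsetP=> x /fP[u -> /andP[uB _]] ->; apply: imset_f.
Qed.

Section Count.
Variables a b : nat.
Hypothesis co : coprime a b.
Hypothesis a0 : 0 < a.
Hypothesis b0 : 0 < b.

Local Notation n := (period a b).
Local Notation promote := (promote a b).
Local Notation unrot := (unrot a b).
Local Notation good := (good a b).
Local Notation word := (word a b).

(** The words visited in the rotating frame. Each of them is a rotation of an
    element of the orbit of [x]. *)
Definition cuts (x : seq bool) : {set n.-tuple bool} :=
  [set u : n.-tuple bool | [exists t : 'I_n.+1, (u : seq bool) == unrot t x]].

Lemma n_gt0 : 0 < n. Proof. rewrite /period; lia. Qed.

Lemma size_good w : good w -> size w = n.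
Proof. by case/andP=> /andP[/eqP]. Qed.

Lemma iter_rot1_rotr t (w : seq bool) : t <= size w -> iter t rot1 w = rotr t w.
Proof.
move=> tw; rewrite -{1}(cat_take_drop (size w - t) w).
have {1}-> : t = size (drop (size w - t) w) by rewrite size_drop; lia.
by rewrite iter_rot1 /rotr /rot.
Qed.

Lemma iter_rot1_size (w : seq bool) q : iter (q * size w) rot1 w = w.
Proof.
elim: q => // q IH; rewrite mulSn iterD IH iter_rot1_rotr // /rotr subnn rot0 //.
Qed.

Lemma rot_iter_rot1 k t w : rot k (iter t rot1 w) = iter t rot1 (rot k w).
Proof. by elim: t => // t IH; rewrite !iterS -IH /rot1 rot_rotr. Qed.

Lemma rot1_inj : injective rot1. Proof. exact: rotr_inj. Qed.

Lemma iter_rot1_inj t : injective (iter t rot1).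
Proof. by elim: t => // t IH x y /rot1_inj /IH. Qed.

Lemma iter_rot1_rot k w : k <= size w -> iter k rot1 (rot k w) = w.
Proof. by move=> kw; rewrite iter_rot1_rotr ?size_rot // rotK. Qed.

Lemma unrot_period q t x : good x -> unrot (q * n + t) x = unrot t x.
Proof.
move=> G; rewrite /unrot [(q * n + t)%N]addnC [iter _ promote _]iterD iter_period //.
have Gt := good_iter co a0 b0 t G.
by rewrite iterD -(size_good Gt) iter_rot1_size.
Qed.

Lemma cutsP x (u : n.-tuple bool) : good x ->
  reflect (exists t, u = unrot t x :> seq bool) (u \in cuts x).
Proof.
move=> G; rewrite inE; apply: (iffP existsP) => [[t /eqP]|[t E]]; first by exists t.
have tn : t %% n < n.+1 by rewrite ltnS ltnW // ltn_mod n_gt0.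
by exists (Ordinal tn); rewrite /= E [in X in X == _](divn_eq t n) unrot_period.
Qed.

Lemma card_cuts x : good x -> #|cuts x| <= b.
Proof.
move=> G; have [S SB SP] := visited_bound co a0 b0 G.
apply: leq_trans SB; rewrite cardE -(size_map val).
apply: uniq_leq_size; first by rewrite map_inj_uniq ?enum_uniq //; apply: val_inj.
move=> v /mapP[u]; rewrite mem_enum inE => /existsP[t /eqP E] ->.
by rewrite [val u]E SP // -ltnS.
Qed.

Lemma word_unrot t x : good x -> word (unrot t x).
Proof.
move=> G; have /andP[W _] := good_iter co a0 b0 t G.
rewrite /unrot; elim: t (iter t promote x) W => // t IH v W.
by rewrite iterSr; apply: IH; rewrite /rot1 /rotr word_rot.
Qed.

(** Cut the word where its partial sums are minimal. *)
Lemma exists_good_rot u : word u -> exists2 j, j <= n & good (rot j u).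
Proof.
move=> Wu; have [S Su _] := wordP co a0 b0 Wu.
have [j _ jmin] := arg_minP (fun i : 'I_n.+1 => wsum a b (take i u)) (isT : xpredT ord0).
have jn : j <= n by rewrite -ltnS.
exists j => //; rewrite /good word_rot Wu /=; apply: aboveP => i.
rewrite size_rot S add0r /rot => iS.
have E k : k <= n -> (wsum a b (take j u) <= wsum a b (take k u))%R.
  by rewrite -ltnS => kn; apply: (jmin (Ordinal kn)).
have := Su; rewrite -{1}(cat_take_drop j u) wsum_cat.
rewrite take_cat size_drop S; case: ltnP => H.
  have := E (j + i); rewrite takeD wsum_cat; lia.
rewrite wsum_cat take_takel; last lia.
have := E (i - (n - j)); lia.
Qed.

(** A rotation of [u] is good by [exists_good_rot]; promote it until the
    rotation is undone. *)
Lemma cuts_cover u : word u -> exists2 x, good x & exists t, u = unrot t x.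
Proof.
move=> Wu; have [j jn G] := exists_good_rot Wu; have [S _ _] := wordP co a0 b0 Wu.
exists (iter (n - j) promote (rot j u)); first exact: good_iter.
exists j; rewrite /unrot -iterD addnC subnK // promote_period //.
by rewrite iter_rot1_rot ?S.
Qed.

Definition dyck (x : seq bool) := rcons x false.

(** The path of a good word touches the line of height 0 only at its ends, so it
    is good in one rotation only. *)
Lemma dyck_rot_inj x y i j : good x -> good y -> i <= n -> j <= n ->
  rot i (dyck x) = rot j (dyck y) -> i = j /\ x = y.
Proof.
wlog ij : x y i j / i <= j.
  move=> H Gx Gy iN jN E; have [ij|/ltnW ij] := leqP i j; first exact: H.
  by have [-> ->] := H _ _ _ _ ij Gy Gx jN iN (esym E).
move=> Gx Gy iN jN; rewrite -(subnKC ij) rotD; last first.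
  by rewrite subnKC // size_rcons size_good // ltnW.
move/rot_inj => E.
have aboveD z : good z -> above a b 0 (dyck z) /\ wsum a b (dyck z) = 0%R.
  move=> /andP[Wz Az]; have [_ Sz _] := wordP co a0 b0 Wz.
  rewrite /dyck -cats1 above_cat wsum_cat Az /= Sz /wt; split; last lia.
  by rewrite andbT; lia.
have [Ax Sx] := aboveD _ Gx; have [Ay Sy] := aboveD _ Gy.
have [e|jmi] := posnP (j - i).
  move: E; rewrite e rot0 => /eqP; rewrite eqseq_rcons => /andP[/eqP -> _].
  by split=> //; lia.
have sD : size (dyck y) = n.+1 by rewrite size_rcons size_good.
move: Ay Sy Ax Sx; rewrite E /rot -{1 2}(cat_take_drop (j - i) (dyck y)) !above_cat !wsum_cat.
set P := take _ _; set Q := drop _ _ => /andP[AP _] SS /andP[AQ _] _.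
have P0 : wsum a b P = 0%R.
  by have := above_sum (lexx (0%R : int)) AP; have := above_sum (lexx (0%R : int)) AQ; lia.
have [Wy _] := andP Gy; have [_ _ Cy] := wordP co a0 b0 Wy.
have : (0 < count negb P < b)%N.
  apply/andP; split.
    rewrite lt0n; apply/eqP => C0.
    have := count_predC id P; have -> : count (predC id) P = count negb P by apply: eq_count.
    rewrite C0 addn0 => C1; have sP : size P = j - i by rewrite size_takel // sD; lia.
    by move: P0; rewrite wsumE C0 C1 sP; move: jmi; nia.
  rewrite /P /dyck -cats1 takel_cat ?(size_good Gy); last lia.
  by have := cat_take_drop (j - i) y => /(congr1 (count negb)); rewrite count_cat Cy; lia.
by move/(wsum_neq0 co); rewrite P0 eqxx.
Qed.

Definition goods : {set n.-tuple bool} := [set x : n.-tuple bool | good x].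

(** Each path [r E] has [a + b] distinct rotations, and they are distinct for
    distinct paths. *)
Lemma card_goods_le : (a + b) * #|goods| <= 'C(a + b, a).
Proof.
have szd (x : n.-tuple bool) (i : 'I_n.+1) : size (rot i (dyck x)) == a + b.
  by rewrite size_rot size_rcons size_tuple /period; lia.
pose f (z : n.-tuple bool * 'I_n.+1) : (a + b).-tuple bool := Tuple (szd z.1 z.2).
have <- : #|setX goods [set: 'I_n.+1]| = (a + b) * #|goods|.
  by rewrite cardsX cardsT card_ord mulnC; congr (_ * _); rewrite /period; lia.
rewrite -(card_in_imset (f := f)) => [|[x i] [y j]]; last first.
  rewrite !inE /= => /andP[Gx _] /andP[Gy _] /(congr1 val) /= E.
  have iN : i <= n by rewrite -ltnS.
  have jN : j <= n by rewrite -ltnS.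
  have [ij xy] := dyck_rot_inj Gx Gy iN jN E.
  by congr (_, _); apply: val_inj.
rewrite -card_words; apply: subset_leq_card; apply/subsetP => w /imsetP[[x i] xi ->]; move: xi.
rewrite !inE /= andbT => Gx; have /andP[/andP[_ /eqP C] _] := Gx; rewrite /=.
have /seq.permP -> : perm_eq (rot i (dyck x)) (dyck x) by rewrite perm_rot.
by rewrite /dyck -cats1 count_cat C addn0.
Qed.

Definition words : {set n.-tuple bool} := [set x : n.-tuple bool | word x].

Lemma card_wordset : #|words| = 'C(n, a).
Proof.
by rewrite -card_words; apply: eq_card => u; rewrite !inE /word size_tuple eqxx.
Qed.

Lemma bin_period : (a + b) * 'C(n, a) = b * 'C(a + b, a).
Proof.
have -> : a + b = n.+1 by rewrite /period; lia.
by rewrite mul_bin_down; congr (_ * _); rewrite /period; lia.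
Qed.

Definition fibre_count (u : n.-tuple bool) := #|[set x in goods | u \in cuts x]|.

Lemma sum_cuts :
  \sum_(x in goods) #|cuts x| = \sum_(u in words) fibre_count u.
Proof.
under eq_bigr do rewrite -sum1_card.
rewrite (exchange_big_dep (mem words)) /=.
  apply: eq_bigr => u _; rewrite /fibre_count -sum1_card.
  by apply: eq_bigl => x; rewrite [in RHS]inE.
move=> x u; rewrite !inE => Gx /existsP[t /eqP E].
by rewrite [val u]E word_unrot.
Qed.

Lemma fibre_count_gt0 u : u \in words -> 0 < fibre_count u.
Proof.
rewrite inE => /cuts_cover[x Gx [t E]]; apply/card_gt0P.
have sx : size x == n by rewrite size_good.
have uc : u \in cuts (Tuple sx) by apply/cutsP => //; exists t.
by exists (Tuple sx); rewrite in_set uc andbT inE.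
Qed.

Lemma goods_words_le : b * #|goods| <= #|words|.
Proof.
rewrite card_wordset -(leq_pmul2l (_ : 0 < a + b)); last lia.
by rewrite bin_period mulnCA leq_mul2l card_goods_le orbT.
Qed.

(** Each of the sets [cuts x] has at most [b] elements and together they cover
    all words, while [goods_words_le] bounds the number of sets: equality holds
    throughout. *)
Lemma sum_cuts_chain :
  [/\ \sum_(x in goods) #|cuts x| = \sum_(x in goods) b,
      \sum_(u in words) 1 = \sum_(u in words) fibre_count u &
      b * #|goods| = #|words|].
Proof.
have H1 : \sum_(x in goods) #|cuts x| <= \sum_(x in goods) b.
  by apply: leq_sum => x; rewrite inE => /card_cuts.
have H2 : \sum_(u in words) 1 <= \sum_(u in words) fibre_count u.
  by apply: leq_sum => u; apply: fibre_count_gt0.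
have H3 := goods_words_le; have H4 := sum_cuts.
have E1 : \sum_(x in goods) b = b * #|goods| by rewrite sum_nat_const mulnC.
have E2 : \sum_(u in words) 1 = #|words| by rewrite sum1_card.
rewrite E1 in H1 *; rewrite E2 in H2 *; rewrite H4 in H1 *; clear E1 E2 H4.
move: (\sum_(u in words) fibre_count u) (b * #|goods|) #|words| H1 H2 H3 => s g w *.
by split; lia.
Qed.

Lemma card_goods_words : b * #|goods| = #|words|.
Proof. by case: sum_cuts_chain. Qed.

Lemma card_goods : (a + b) * #|goods| = 'C(a + b, a).
Proof.
apply/eqP; rewrite -(eqn_pmul2l b0) -bin_period mulnCA eqn_mul2l card_goods_words.
by rewrite card_wordset eqxx orbT.
Qed.

Lemma card_cutsE (x : n.-tuple bool) : good x -> #|cuts x| = b.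
Proof.
move=> Gx; have [/eqP + _ _] := sum_cuts_chain.
have H y : y \in goods -> #|cuts y| <= b ?= iff (#|cuts y| == b).
  by rewrite inE => Gy; split=> //; apply: card_cuts.
rewrite (leqif_sum H).2 => /forallP /(_ x); rewrite inE Gx => /eqP.
exact.
Qed.

Lemma cuts_unique (x y u : n.-tuple bool) : good x -> good y ->
  u \in cuts x -> u \in cuts y -> x = y.
Proof.
move=> Gx Gy ux uy; have uW : u \in words.
  by rewrite inE; move: (ux) => /(cutsP _ Gx)[t ->]; apply: word_unrot.
have [_ /eqP + _] := sum_cuts_chain.
have H v : v \in words -> 1 <= fibre_count v ?= iff (1 == fibre_count v).
  by move=> vW; split=> //; apply: fibre_count_gt0.
rewrite (leqif_sum H).2 => /forallP /(_ u); rewrite uW /= eq_sym => /cards1P[z E].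
have: x \in [set x0 in goods | u \in cuts x0] by rewrite in_set ux andbT inE.
have: y \in [set x0 in goods | u \in cuts x0] by rewrite in_set uy andbT inE.
by rewrite E !inE => /eqP-> /eqP->.
Qed.

Lemma imply_count_eq (s t : seq bool) : size s = size t ->
  (forall i, nth false s i -> nth false t i) -> count id s = count id t -> s = t.
Proof.
have le s' t' : size s' = size t' -> (forall i, nth false s' i -> nth false t' i) ->
    count id s' <= count id t'.
  elim: s' t' => [|c s' IH] [|d t'] //= [S] H.
  have := IH t' S (fun i => H i.+1); have := H 0; case: c {H} => //=; case: d => //=; lia.
elim: s t => [|c s IH] [|d t] //= [S] H.
have Hs i : nth false s i -> nth false t i by exact: (H i.+1).
have := le _ _ S Hs; have := H 0.
case: c {H} => /=; case: d => /=; try lia; move=> _ _ C; congr (_ :: _); apply: IH => //; lia.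
Qed.

Lemma iter_rot_id k t w : rot k w = w -> k <= size w -> iter (t * k) rot1 w = w.
Proof.
move=> E kw; elim: t => // t IH; rewrite mulSn iterD IH -{1}E.
exact: iter_rot1_rot.
Qed.

Lemma rot_fix_unrot k t x : rot k (unrot t x) = unrot t x ->
  rot k (iter t promote x) = iter t promote x.
Proof. by rewrite /unrot rot_iter_rot1 => /iter_rot1_inj. Qed.

(** Let [t <= t'] and replace the difference by its residue [j] modulo the
    period [k]. By [promote_keep] the letters N at positions from [j] on survive
    [j] promotions, and by periodicity all letters N of the word rotated by [j]
    are repetitions of these. Both words have the same number of letters N, so
    they agree. *)
Lemma fix_cut_unique k x t t' : 0 < k -> k.*2 <= n -> good x ->
  rot k (unrot t x) = unrot t x -> rot k (unrot t' x) = unrot t' x ->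
  unrot t x = unrot t' x.
Proof.
move=> k0 k2 Gx; wlog tt : t t' / t <= t'.
  move=> H E E'; have [tt|/ltnW tt] := leqP t t'; first exact: H.
  by apply/esym/H.
move=> /rot_fix_unrot E /rot_fix_unrot E'.
rewrite /unrot -(subnKC tt) in E' *; move: E E'.
rewrite [(t + (t' - t))%N]addnC [iter (_ + t) promote _]iterD; set j := t' - t.
have := good_iter co a0 b0 t Gx; set r := iter t promote x => Gr E.
have Sr := size_good Gr; have kn : k <= n by lia.
have Ek q : iter (q * k) promote r = r.
  elim: q => // q IH; rewrite mulSn iterD IH (promote_rot co a0 b0) // E //.
rewrite (divn_eq j k) addnC [in iter _ promote _]iterD Ek.
have jk : j %% k < k by rewrite ltn_mod.
move: (j %% k) jk => j' jk; have G' := good_iter co a0 b0 j' Gr.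
have S' := size_good G' => E'.
have kr : 0 < k <= size r by rewrite k0 Sr.
have kr' : 0 < k <= size (iter j' promote r) by rewrite k0 S'.
have -> : iter j' promote r = rot j' r.
  apply/esym/imply_count_eq; first by rewrite size_rot S' Sr.
    move=> i; have [iS|iS] := ltnP i n; last by rewrite nth_default // size_rot Sr.
    have ik : i %% k < k by rewrite ltn_mod.
    rewrite (@rot_fix_modn k (rot j' r)) ?size_rot ?Sr ?k0 ?kn //; last by rewrite rot_rot E.
    rewrite [in X in _ -> X](rot_fix_modn kr' E') ?S' //.
    rewrite /rot nth_cat size_drop nth_drop Sr ifT; last by lia.
    exact: promote_keep.
  have /andP[/andP[_ /eqP ->] _] := G'.
  have /seq.permP -> : perm_eq (rot j' r) r by rewrite perm_rot.
  by case/andP: Gr => /andP[_ /eqP ->].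
rewrite addnC [iter (t + _) rot1 _]iterD addnC iterD iter_rot1_rot ?Sr; last by lia.
by rewrite iter_rot_id ?Sr.
Qed.

Lemma iter_rot k q (u : seq bool) : q * k <= size u -> iter q (rot k) u = rot (q * k) u.
Proof.
elim: q => [|q IH] H; first by rewrite rot0.
by rewrite iterS IH ?mulSn ?rotD // -?mulSn //; lia.
Qed.

Lemma cuts_rot k x (u : n.-tuple bool) : k <= n -> good x -> iter k promote x = x ->
  u \in cuts x -> [tuple of rot k u] \in cuts x.
Proof.
move=> kn Gx E /(cutsP _ Gx)[t Et]; apply/(cutsP _ Gx).
exists (t + (n - k)); rewrite [LHS]/= Et /unrot rot_iter_rot1.
have E' : iter (n - k) promote x = x.
  by rewrite -[in LHS]E -iterD subnK // promote_period.
have Gt := good_iter co a0 b0 t Gx; have St := size_good Gt.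
rewrite [iter (t + _) promote _]iterD E' iterD; congr (iter t rot1 _).
by rewrite iter_rot1_rotr ?St ?leq_subr // /rotr St subKn.
Qed.

(** The rotation by [n / p] generates a group of order 1 or [p] acting on the
    [b] elements of [cuts x]. *)
Lemma cuts_prime p x : prime p -> p %| n -> good x -> iter (n %/ p) promote x = x ->
  let F := [set u in cuts x | rot (n %/ p) u == u :> seq bool] in
  #|F| <= 1 /\ b = #|F| %[mod p].
Proof.
move=> pp pn Gx E F; set k := n %/ p in E F *.
have n0 := n_gt0; have p1 := prime_gt1 pp.
have k0 : 0 < k by rewrite divn_gt0 ?prime_gt0 // dvdn_leq.
have nk : p * k = n by rewrite mulnC divnK.
have kn : k <= n by rewrite -nk leq_pmull ?prime_gt0.
have k2 : k.*2 <= n by rewrite -nk -mul2n leq_mul2r p1 orbT.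
split.
  apply/card_le1_eqP => u v; rewrite !inE => /andP[uc /eqP Eu] /andP[vc /eqP Ev].
  apply: val_inj => /=; move: Eu Ev.
  have /(cutsP _ Gx)[t ->] : u \in cuts x by rewrite inE.
  have /(cutsP _ Gx)[s ->] : v \in cuts x by rewrite inE.
  by move=> A B; apply/esym/(fix_cut_unique k0 k2 Gx A B).
pose f (u : n.-tuple bool) : n.-tuple bool := [tuple of rot k u].
have fI : injective f by move=> u v /(congr1 val) /= /rot_inj; apply: val_inj.
pose s := perm fI.
have sE q u : val ((s ^+ q)%g u) = iter q (rot k) u.
  rewrite permX; elim: q => // q IH.
  by rewrite !iterS permE /= IH.
have sp : (s ^+ p)%g = 1%g.
  apply/permP => u; apply: val_inj; rewrite sE perm1 iter_rot ?size_tuple nk //.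
  by rewrite rot_oversize // size_tuple.
have pG : (p.-group <[s]>)%g.
  rewrite /pgroup -orderE; apply: pnat_dvd (pnat_id pp).
  by rewrite order_dvdn sp.
have nS : [acts <[s]>, on cuts x | 'P]%g.
  rewrite cycle_subG; apply/astabsP => u /=; rewrite apermE permE.
  apply/idP/idP => [H|]; last exact: cuts_rot.
  have : iter p.-1 f (f u) \in cuts x.
    by elim: p.-1 => // q IH; rewrite iterS; apply: cuts_rot.
  suff -> : iter p.-1 f (f u) = u by [].
  rewrite -iterSr prednK ?prime_gt0 //.
  have := congr1 (fun g : {perm _} => g u) sp; rewrite perm1 permX => {2}<-.
  by apply: eq_iter => v; rewrite permE.
have sx : size x == n by rewrite size_good.
rewrite -[in LHS](card_cutsE (x := Tuple sx)) // (pgroup_fix_mod pG nS).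
congr (_ %% _); apply: eq_card => u; rewrite in_setI afix_cycle [in RHS]inE.
congr (_ && _); apply/afix1P/eqP => /= [H|H].
  by move: (congr1 val H); rewrite /= apermE permE.
by apply: val_inj; rewrite /= apermE permE.
Qed.

(** The rotation of [u] by [k] is in [cuts x] as well and has the same symmetry,
    so it is [u] by uniqueness. *)
Lemma cut_fix_all k x (u : n.-tuple bool) : k <= n -> good x -> iter k promote x = x ->
  forall k', 0 < k' -> k'.*2 <= n ->
  u \in cuts x -> rot k' u = u :> seq bool -> rot k u = u :> seq bool.
Proof.
move=> kn Gx E k' k0 k2 uc Eu.
have vc := cuts_rot kn Gx E uc.
have Ev : rot k' (rot k u) = rot k u by rewrite rot_rot Eu.
move: vc uc Eu Ev => /(cutsP _ Gx)[t /= ->] /(cutsP _ Gx)[s ->].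
by move=> A B; rewrite (fix_cut_unique k0 k2 Gx B A).
Qed.

Lemma fixed_dichotomy d k x : n = d * k -> 1 < d -> good x -> iter k promote x = x ->
  (b = 1 %[mod pdiv d] /\
     exists2 u : n.-tuple bool, u \in cuts x & rot k u = u :> seq bool)
  \/ b = 0 %[mod pdiv d].
Proof.
move=> nE d1 Gx E; set p := pdiv d; have pp : prime p by apply: pdiv_prime.
have pd : p %| d by apply: pdiv_dvd.
have n0 := n_gt0; have k0 : 0 < k by move: n0; rewrite nE; case: (k) => //; rewrite muln0.
have pn : p %| n by rewrite nE dvdn_mulr.
have np : n %/ p = (d %/ p) * k by rewrite nE -{1}(divnK pd) mulnAC mulnK ?prime_gt0.
have Ep : iter (n %/ p) promote x = x.
  by rewrite np; elim: (d %/ p) => // q IH; rewrite mulSn iterD IH.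
have kn : k <= n by rewrite nE leq_pmull // ltnW.
have [F1 Fb] := cuts_prime pp pn Gx Ep.
move: F1 Fb; case FE: #|_| => [|[|//]] _ Fb; [by right | left; split=> //].
have /card_gt0P[u] : 0 < #|[set u in cuts x | rot (n %/ p) u == u :> seq bool]| by rewrite FE.
rewrite inE => /andP[uc /eqP Eu]; exists u => //.
apply: (cut_fix_all kn Gx E _ _ uc Eu); first by rewrite divn_gt0 ?prime_gt0 // dvdn_leq.
have p1 := prime_gt1 pp.
by rewrite -{2}(divnK pn) -muln2 leq_mul2l p1 orbT.
Qed.

Lemma word_rot_fix_dvd d k (u : n.-tuple bool) : n = d * k -> 0 < d -> 0 < k ->
  word u -> rot k u = u :> seq bool -> d %| a.
Proof.
move=> nE d0 k0 /andP[_ C] E; have := card_rot_fix a nE d0 k0; case: ifP => // _ /eqP.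
rewrite cards_eq0 => /eqP/setP/(_ u); rewrite !inE C E eqxx.
by [].
Qed.

Lemma fix_dvd d k x : n = d * k -> 1 < d -> good x -> iter k promote x = x ->
  b = 1 %[mod pdiv d] -> d %| a.
Proof.
move=> nE d1 Gx E b1; have n0 := n_gt0.
have k0 : 0 < k by move: n0; rewrite nE; case: (k) => //; rewrite muln0.
case: (fixed_dichotomy nE d1 Gx E) => [[_ [u uc Eu]]|]; last first.
  by rewrite b1 mod0n modn_small // prime_gt1 // pdiv_prime.
apply: (word_rot_fix_dvd nE (ltnW d1) k0 _ Eu).
by move: uc => /(cutsP _ Gx)[t ->]; apply: word_unrot.
Qed.

(** As [a + b] is 1 and [a] is 0 modulo the prime divisors of [d], so [b] is 1.
    Each fixed [x] then has exactly one word in [cuts x] which the rotation by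
    [k] fixes, and conversely such a word lies in [cuts x] for one [x], which is
    fixed. *)
Lemma card_fix_dvd d k : n = d * k -> 1 < d -> d %| a ->
  #|[set x : n.-tuple bool | good x && (iter k promote x == x :> seq bool)]| = 'C(k, a %/ d).
Proof.
move=> nE d1 da; have n0 := n_gt0; have d0 := ltnW d1.
have k0 : 0 < k by move: n0; rewrite nE; case: (k) => //; rewrite muln0.
have kn : k <= n by rewrite nE leq_pmull.
have k2 : k.*2 <= n by rewrite nE -mul2n leq_mul2r d1 orbT.
have b1 : b = 1 %[mod pdiv d].
  have H1 : (a + b).-1 = 0 %[mod pdiv d].
    by apply/eqP; rewrite mod0n -/(dvdn _ _) -/(period a b) nE dvdn_mulr // pdiv_dvd.
  have H2 : a = 0 %[mod pdiv d].
    by apply/eqP; rewrite mod0n -/(dvdn _ _) (dvdn_trans (pdiv_dvd d)).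
  have e : a + b = (a + b).-1 + 1 by lia.
  by have := congr1 (modn^~ (pdiv d)) e; rewrite /= -modnDml H2 -[in RHS]modnDml H1 !mod0n.
have -> : 'C(k, a %/ d) =
    #|[set u : n.-tuple bool | (count id u == a) && (rot k u == u :> seq bool)]|.
  by rewrite (card_rot_fix a nE d0 k0) da.
have wordE (u : n.-tuple bool) : word u = (count id u == a).
  by rewrite /word size_tuple eqxx.
apply/eqP; rewrite eqn_leq; apply/andP; split.
  apply: (leq_card_rel (R := fun x u : n.-tuple bool => u \in cuts x)) => [x|x y u].
    rewrite inE => /andP[Gx /eqP E].
    case: (fixed_dichotomy nE d1 Gx E) => [[_ [u uc Eu]]|]; last first.
      by rewrite b1 mod0n modn_small // prime_gt1 // pdiv_prime.
    exists u => //; rewrite inE -wordE Eu eqxx andbT.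
    by move: uc => /(cutsP _ Gx)[t ->]; apply: word_unrot.
  by move=> xA yA; apply: cuts_unique; [move: xA|move: yA]; rewrite inE => /andP[].
apply: (leq_card_rel (R := fun u x : n.-tuple bool => good x && (u \in cuts x))) => [u|u v x].
  rewrite inE -wordE => /andP[Wu /eqP Eu].
  have [y Gy [t Et]] := cuts_cover Wu.
  have sy : size y == n by rewrite size_good.
  have ux : u \in cuts (Tuple sy) by apply/cutsP => //; exists t.
  exists (Tuple sy); last by rewrite Gy ux.
  rewrite inE Gy /=; apply/eqP.
  have Gy' := good_iter co a0 b0 k Gy.
  have sy' : size (iter k promote y) == n by rewrite size_good.
  suff : Tuple sy' = Tuple sy by move/(congr1 val).
  apply: (@cuts_unique _ _ u) => //; apply/cutsP => //; exists (t + (n - k)).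
  rewrite /= /unrot -iterD -addnA subnK // -[LHS]Eu {1}Et /unrot rot_iter_rot1.
  have Gt := good_iter co a0 b0 t Gy; have St := size_good Gt.
  rewrite [iter (t + n) promote _]iterD promote_period // [in RHS]iterD.
  congr (iter t rot1 _).
  by rewrite iter_rot1_rotr ?St ?leq_subr // /rotr St subKn.
rewrite inE => /andP[_ /eqP Eu]; rewrite inE => /andP[_ /eqP Ev].
move=> /andP[Gx /(cutsP _ Gx)[t Et]] /andP[_ /(cutsP _ Gx)[t' Et']].
apply: val_inj => /=; rewrite Et Et'; apply: fix_cut_unique k0 k2 Gx _ _.
  by rewrite -Et.
by rewrite -Et'.
Qed.

End Count.

(** * Duality between the two step types *)

Definition rev_compl (w : seq bool) := rev (map negb w).

Lemma rcK : involutive rev_compl.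
Proof. by move=> w; rewrite /rev_compl map_rev revK mapK //; apply: negbK. Qed.

Lemma rc_cat u v : rev_compl (u ++ v) = rev_compl v ++ rev_compl u.
Proof. by rewrite /rev_compl map_cat rev_cat. Qed.

Lemma rc_cons c w : rev_compl (c :: w) = rcons (rev_compl w) (~~ c).
Proof. by rewrite /rev_compl /= rev_cons. Qed.

Lemma rc_rcons w c : rev_compl (rcons w c) = ~~ c :: rev_compl w.
Proof. by rewrite /rev_compl map_rcons rev_rcons. Qed.

Lemma size_rc w : size (rev_compl w) = size w.
Proof. by rewrite size_rev size_map. Qed.

Lemma count_rc w : count id (rev_compl w) = count negb w.
Proof. by rewrite count_rev count_map; apply: eq_count. Qed.

Lemma wsum_rc a b w : wsum b a (rev_compl w) = (- wsum a b w)%R.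
Proof.
elim: w => [|c w IH]; first by rewrite oppr0.
by rewrite rc_cons -cats1 wsum_cat IH /= /wt; case: c => /=; lia.
Qed.

Lemma above_rc a b h w : (0 <= h)%R -> above a b h w ->
  above b a (h + wsum a b w)%R (rev_compl w).
Proof.
elim: w h => [|c w IH] h h0 //= /andP[h1 H].
rewrite rc_cons -cats1 above_cat addrA IH //= andbT wsum_rc.
by move: h1; rewrite /wt; case: (c) => /=; lia.
Qed.

Section Dual.
Variables a b : nat.
Hypothesis co : coprime a b.
Hypothesis a0 : 0 < a.
Hypothesis b0 : 0 < b.

(** Reversing a path and exchanging its two types of steps preserves being above
    the diagonal; on the word without the last E, the initial N stays in place.
    *)
Definition dual (r : seq bool) := true :: rev_compl (behead r).

Lemma dyck_dual r : good a b r -> dyck (dual r) = rev_compl (dyck r).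
Proof.
move/(good_true co a0 b0) => [w -> _].
by rewrite /dyck /dual -[in RHS]cats1 rc_cat rc_cons [rev_compl (true :: w)]rc_cons.
Qed.

Lemma dyck_above r : good a b r -> above a b 0 (dyck r) /\ wsum a b (dyck r) = 0%R.
Proof.
move=> /andP[Wz Az]; have [_ Sz _] := wordP co a0 b0 Wz.
rewrite /dyck -cats1 above_cat wsum_cat Az /= Sz /wt; split; last lia.
by rewrite andbT; lia.
Qed.

Lemma promote_dyck r : good a b r -> exists u v,
  [/\ dyck r = true :: u ++ false :: v, above a b 0 u & (wsum a b u < a%:Z)%R].
Proof.
move=> G; have [w E _] := good_true co a0 b0 G.
have /andP[/(wordP co a0 b0)[_ S _] _] := G.
case: (boolP (above a b 0 w)) => P.
  exists w, [::]; rewrite /dyck E rcons_cons -cats1; split=> //.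
  by move: S; rewrite E /= /wt; lia.
have [u [v [E' Pu Su]]] := first_fail (lexx (0%R : int)) P.
exists u, (rcons v false); rewrite /dyck E E' rcons_cons rcons_cat; split=> //; lia.
Qed.

Lemma dyck_promote r u v : dyck r = true :: u ++ false :: v ->
  above a b 0 u -> (wsum a b u < a%:Z)%R ->
  dyck (promote a b r) = u ++ true :: rcons v false.
Proof.
rewrite /dyck => E Pu Su; case/lastP: v E => [|v c].
  rewrite -rcons_cons cats1 -rcons_cons => /rcons_inj[->].
  by rewrite promote_end // -!cats1 -catA.
rewrite -!rcons_cons -rcons_cat -rcons_cons => /rcons_inj[-> <-].
by rewrite promote_fail // rcons_cat.
Qed.

End Dual.

Section Duality.
Variables a b : nat.
Hypothesis co : coprime a b.
Hypothesis a0 : 0 < a.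
Hypothesis b0 : 0 < b.

Let co' : coprime b a. Proof. by rewrite coprime_sym. Qed.

Lemma good_dual r : good a b r -> good b a (dual r).
Proof.
move=> G; have [w E _] := good_true co a0 b0 G.
have /andP[/(wordP co a0 b0)[S _ C] _] := G.
rewrite /good /word; apply/andP; split.
  rewrite /dual /= size_rc count_rc.
  by move: S C; rewrite E /= /period => S C; apply/andP; split; apply/eqP; lia.
have [P W] := dyck_above co a0 b0 G.
have := above_rc (lexx 0%R) P; rewrite W addr0 -(dyck_dual co a0 b0 G).
by rewrite /dyck -cats1 above_cat => /andP[].
Qed.

Lemma dualK r : good a b r -> dual (dual r) = r.
Proof. by move/(good_true co a0 b0) => [w -> _]; rewrite /dual /= rcK. Qed.

(** On paths, promotion takes N u E v to u N v E; the dual of the latter is N v'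
    E u', which goes to v' N u' E, the dual of the former. *)
Lemma promote_dual r : good a b r -> promote b a (dual (promote a b r)) = dual r.
Proof.
move=> G; have G' := good_promote co a0 b0 G.
have [u [v [E Pu Su]]] := promote_dyck co a0 b0 G.
have E1 := dyck_promote E Pu Su.
have E2 : dyck (dual (promote a b r)) = true :: rev_compl v ++ false :: rev_compl u.
  by rewrite (dyck_dual co a0 b0 G') E1 rc_cat rc_cons rc_rcons /= cat_rcons.
have [P W] := dyck_above co a0 b0 G.
have P' := above_rc (lexx 0%R) P.
have E3 : dyck (promote b a (dual (promote a b r))) = rev_compl v ++ true :: rcons (rev_compl u) false.
  apply: dyck_promote E2 _ _.
    move: P'; rewrite W addr0 E rc_cons rc_cat rcons_cat above_cat => /andP[+ _].
    by rewrite rc_cons -cats1 above_cat => /andP[].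
  by move: W; rewrite E wsum_rc /= wsum_cat /= /wt; lia.
apply: (@rcons_injl _ false); rewrite -!/(dyck _) E3 (dyck_dual co a0 b0 G) E.
by rewrite rc_cons rc_cat rc_cons cat_rcons rcons_cat.
Qed.

Lemma iter_dual k r : good a b r -> iter k (promote b a) (dual (iter k (promote a b) r)) = dual r.
Proof.
move=> G; elim: k => // k IH; rewrite iterSr iterS promote_dual //.
exact: good_iter.
Qed.

Lemma leq_card_dual k :
  #|[set x : (period a b).-tuple bool | good a b x && (iter k (promote a b) x == x :> seq bool)]| <=
  #|[set x : (period b a).-tuple bool | good b a x && (iter k (promote b a) x == x :> seq bool)]|.
Proof.
apply: (@leq_card_rel _ _ _ _ (fun (x : (period a b).-tuple bool) (y : (period b a).-tuple bool) =>
  (y : seq bool) == dual x)) => [x|x y u].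
  rewrite inE => /andP[G /eqP E].
  have s : size (dual x) == period b a by rewrite (size_good (good_dual G)).
  exists (Tuple s); last by rewrite /=.
  by rewrite inE /= good_dual //= -[X in dual X]E iter_dual // E.
rewrite !inE => /andP[Gx _] /andP[Gy _] /eqP-> /eqP E.
by apply: val_inj; rewrite /= -(dualK Gx) E dualK.
Qed.

End Duality.

(** If neither [a] nor [b] is divisible by [d], a fixed word would have [b]
    congruent to 0 or 1 modulo the least prime divisor of [d]. In the second
    case [d] divides [a]; in the first case [a] is congruent to 1 and the dual
    word shows that [d] divides [b]. *)
Theorem card_fixed a b d k : coprime a b -> 0 < a -> 0 < b -> period a b = d * k -> 1 < d ->
  #|[set x : (period a b).-tuple bool | good a b x && (iter k (promote a b) x == x :> seq bool)]| =
  if d %| a then 'C(k, a %/ d) else if d %| b then 'C(k, b %/ d) else 0.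
Proof.
move=> co a0 b0 nE d1; have co' : coprime b a by rewrite coprime_sym.
have nE' : period b a = d * k by rewrite -nE /period addnC.
case: ifP => [da|nda]; first exact: card_fix_dvd.
case: ifP => [db|ndb].
  rewrite -(card_fix_dvd co' b0 a0 nE' d1 db).
  by apply/eqP; rewrite eqn_leq !leq_card_dual.
apply: eq_card0 => x; rewrite inE; apply/negP => /andP[G /eqP E].
have n0 := n_gt0 co a0 b0.
case: (fixed_dichotomy co a0 b0 nE d1 G E) => [[b1 _]|b1].
  by have := fix_dvd co a0 b0 nE d1 G E b1; rewrite nda.
have G' := good_dual co a0 b0 G.
have E' : iter k (promote b a) (dual x) = dual x by rewrite -[in LHS]E iter_dual.
have a1 : a = 1 %[mod pdiv d].
  have H1 : (a + b).-1 = 0 %[mod pdiv d].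
    by apply/eqP; rewrite mod0n -/(dvdn _ _) -/(period a b) nE dvdn_mulr // pdiv_dvd.
  have e : a + b = (a + b).-1 + 1 by lia.
  by have := congr1 (modn^~ (pdiv d)) e; rewrite /= -modnDmr b1 -[in RHS]modnDml H1 !mod0n addn0.
by have := fix_dvd co' b0 a0 nE' d1 G' E' a1; rewrite ndb.
Qed.

(** * q-Catalan polynomials at roots of unity *)

Section QFactorials.
Local Open Scope ring_scope.

Lemma qintS n : qint n.+1 = qint n + 'X^n.
Proof. by rewrite /qint big_ord_recr. Qed.

Lemma qint0 : qint 0 = 0. Proof. by rewrite /qint big_ord0. Qed.

Lemma qint1 : qint 1 = 1. Proof. by rewrite qintS qint0 add0r expr0. Qed.

Lemma qintD m n : qint (m + n) = qint m + 'X^m * qint n.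
Proof.
elim: n => [|n IH]; first by rewrite addn0 qint0 mulr0 addr0.
by rewrite addnS !qintS IH exprD; ring.
Qed.

Lemma qintM d m : qint (d * m) = qint d * \sum_(j < m) 'X^(d * j).
Proof.
elim: m => [|m IH]; first by rewrite muln0 qint0 big_ord0 mulr0.
by rewrite mulnS addnC qintD big_ord_recr /= IH; ring.
Qed.

Lemma qfactS n : qfact n.+1 = qfact n * qint n.+1.
Proof. by rewrite /qfact big_nat_recr. Qed.

Lemma qfact0 : qfact 0 = 1. Proof. by rewrite /qfact big_nil. Qed.

Lemma qint_monic n : qint n.+1 \is monic.
Proof.
have -> : qint n.+1 = \poly_(i < n.+1) 1.
  by rewrite poly_def /qint; apply: eq_bigr => i _; rewrite scale1r.
by rewrite monicE lead_coefE size_poly_eq ?oner_eq0 // coef_poly ltnSn.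
Qed.

Lemma qfact_monic n : qfact n \is monic.
Proof.
elim: n => [|n IH]; first by rewrite qfact0 monic1.
by rewrite qfactS monicMl // qint_monic.
Qed.

(** The q-binomial coefficients by the Pascal rule, which exhibits them as
    polynomials. *)
Fixpoint qbin (n k : nat) : {poly int} :=
  match n, k with
  | _, 0 => 1
  | 0, _.+1 => 0
  | n'.+1, k'.+1 => qbin n' k' + 'X^k * qbin n' k
  end.

Lemma qbin_small n k : (n < k)%N -> qbin n k = 0.
Proof.
elim: n k => [|n IH] [|k] //= H; rewrite !IH ?mulr0 ?addr0 //; lia.
Qed.

Lemma qbinP n k : (k <= n)%N -> qfact n = qbin n k * (qfact k * qfact (n - k)).
Proof.
elim: n k => [|n IH] [|k] // H; rewrite ?subn0 ?qfact0 ?mul1r //= ?mul1r //.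
rewrite subSS; have [nk|nk] := ltnP k n; last first.
  have -> : k = n by lia.
  by rewrite (qbin_small (ltnSn n)) mulr0 addr0 qfactS {1}(IH n) // subnn qfact0; ring.
have Hk := IH k (ltnW nk); have Hk1 := IH k.+1 nk.
have E : qint n.+1 = qint k.+1 + 'X^(k.+1) * qint (n - k).
  by rewrite -qintD; congr qint; lia.
have nkE : (n - k = (n - k.+1).+1)%N by lia.
rewrite [LHS]qfactS E mulrDr {1}Hk Hk1 [qfact k.+1]qfactS.
by rewrite nkE [qfact (n - k.+1).+1]qfactS; ring.
Qed.

Lemma qbinomialE n k : (k <= n)%N -> qbinomial n k = qbin n k.
Proof.
move=> kn; rewrite /qbinomial (qbinP kn) Pdiv.IdomainMonic.mulpK //.
by rewrite monicMl ?qfact_monic.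
Qed.

(** The q-analogue of Bezout's identity [u a = v b + 1]. *)
Lemma qint_bezout a b : (0 < a)%N -> coprime a b ->
  exists A B, A * qint a = 1 + B * qint b.
Proof.
move=> a0 co; case: (egcdnP b a0) => u v E _.
move: E; rewrite (eqP co) => E.
exists (\sum_(j < u) 'X^(a * j)), ('X * \sum_(j < v) 'X^(b * j)).
rewrite mulrC -qintM mulnC E mulnC addnC qintD qint1 expr1 qintM.
by ring.
Qed.

Lemma qfact_lead n k : (0 < k <= n)%N ->
  qint n * qbin n.-1 k.-1 = qbin n k * qint k.
Proof.
case: n k => [|n] [|k] // /andP[_ kn]; rewrite [n.+1.-1]/= [k.+1.-1]/=.
have H1 := qbinP kn; have H2 := @qbinP n k kn.
apply: (@mulIf _ (qfact k * qfact (n - k))).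
  by rewrite monic_neq0 // monicMl ?qfact_monic.
transitivity (qfact n.+1); first by rewrite qfactS H2; ring.
by rewrite H1 qfactS subSS; ring.
Qed.

(** By [qfact_lead] both [qint a] times and [qint b] times the binomial
    coefficient are multiples of [qint (a + b)]; a Bezout relation makes the
    coefficient itself divisible. *)
Theorem qCatalanP a b : (0 < a)%N -> (0 < b)%N -> coprime a b ->
  qCatalan a b * (qfact a * qfact b) = qfact (a + b).-1.
Proof.
move=> a0 b0 co.
have [A [B AB]] := qint_bezout a0 co.
have ab : (b <= a + b)%N by rewrite leq_addl.
have sym : qbin (a + b) a = qbin (a + b) b.
  apply: (@mulIf _ (qfact a * qfact b)).
    by rewrite monic_neq0 // monicMl ?qfact_monic.
  transitivity (qfact (a + b)); first by rewrite (qbinP (leq_addr b a)) addKn.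
  by rewrite (qbinP ab) addnK; ring.
have Ha : qint (a + b) * qbin (a + b).-1 a.-1 = qbin (a + b) b * qint a.
  by rewrite -sym; apply: qfact_lead; lia.
have Hb : qint (a + b) * qbin (a + b).-1 b.-1 = qbin (a + b) b * qint b.
  by apply: qfact_lead; lia.
have E : qbin (a + b) b = (A * qbin (a + b).-1 a.-1 - B * qbin (a + b).-1 b.-1) * qint (a + b).
  have -> : qbin (a + b) b = qbin (a + b) b * (A * qint a - B * qint b).
    by rewrite AB addrK mulr1.
  transitivity (A * (qbin (a + b) b * qint a) - B * (qbin (a + b) b * qint b)); first by ring.
  by rewrite -Ha -Hb; ring.
have mon : qint (a + b) \is monic by case: (a) a0 => // a' _; apply: qint_monic.
rewrite /qCatalan qbinomialE // E Pdiv.IdomainMonic.mulpK //.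
apply: (mulIf (monic_neq0 mon)).
transitivity (qbin (a + b) b * (qfact a * qfact b)); first by rewrite E; ring.
have {2}-> : a = (a + b - b)%N by rewrite addnK.
rewrite mulrC [qfact _ * qfact b]mulrC mulrC -qbinP //.
by case: (a) a0 => // a' _; rewrite addSn qfactS.
Qed.

(** The factors of the q-factorial that do not vanish at primitive [d]-th roots
    of unity. *)
Definition qregular d n : {poly int} := \prod_(1 <= i < n.+1 | ~~ (d %| i)%N) qint i.
(** Product of the quotients [qint (d * i) / qint d]. *)
Definition qcofactor d m : {poly int} := \prod_(1 <= i < m.+1) \sum_(j < i) 'X^(d * j).

Lemma qregS d n : qregular d n.+1 = qregular d n * (if (d %| n.+1)%N then 1 else qint n.+1).
Proof.
by rewrite /qregular big_mkcond big_nat_recr //= -big_mkcond if_neg.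
Qed.

Lemma qmulS d m : qcofactor d m.+1 = qcofactor d m * \sum_(j < m.+1) 'X^(d * j).
Proof. by rewrite /qcofactor big_nat_recr. Qed.

Lemma qfact_split d n : (0 < d)%N ->
  qfact n = qregular d n * qcofactor d (n %/ d) * qint d ^+ (n %/ d).
Proof.
move=> d0; elim: n => [|n IH].
  by rewrite qfact0 div0n /qregular /qcofactor !big_geq // !mulr1.
rewrite qfactS qregS divnS // IH; case: ifP => dn; last by rewrite add0n; ring.
rewrite add1n exprS qmulS; have E : qint n.+1 = qint d * \sum_(j < (n %/ d).+1) 'X^(d * j).
  by rewrite -qintM; congr qint; rewrite -{1}(divnK dn) divnS // dn add1n mulnC.
by rewrite E; ring.
Qed.

Section RootOfUnity.
Variables (F : numFieldType) (d : nat) (w : F).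
Hypothesis prim : d.-primitive_root w.

Definition qeval (p : {poly int}) : F := (map_poly intr p).[w].

Lemma qevalM p q : qeval (p * q) = qeval p * qeval q.
Proof. by rewrite /qeval rmorphM hornerM. Qed.

Lemma qevalD p q : qeval (p + q) = qeval p + qeval q.
Proof. by rewrite /qeval rmorphD hornerD. Qed.

Lemma qeval1 : qeval 1 = 1.
Proof. by rewrite /qeval rmorph1 hornerC. Qed.

Lemma qeval0 : qeval 0 = 0.
Proof. by rewrite /qeval rmorph0 hornerC. Qed.

Lemma qevalX n : qeval 'X^n = w ^+ n.
Proof. by rewrite /qeval map_polyXn hornerXn. Qed.

Lemma qeval_qint n : qeval (qint n) = \sum_(i < n) w ^+ i.
Proof.
elim: n => [|n IH]; first by rewrite qint0 qeval0 big_ord0.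
by rewrite qintS qevalD IH qevalX big_ord_recr.
Qed.

Lemma qeval_qint_neq0 n : ~~ (d %| n)%N -> qeval (qint n) != 0.
Proof.
move=> dn; apply: contraNneq dn => E.
have := subrX1 w n; rewrite -qeval_qint E mulr0 => /eqP.
by rewrite subr_eq0 -(prim_order_dvd prim).
Qed.

Lemma qeval_qint_order : (1 < d)%N -> qeval (qint d) = 0.
Proof.
move=> d1; have w1 : w - 1 != 0.
  rewrite subr_eq0 -[w]expr1 -(prim_order_dvd prim) dvdn1; lia.
apply: (mulfI w1); rewrite qeval_qint -subrX1 mulr0 (prim_expr_order prim).
by rewrite subrr.
Qed.

Lemma qeval_qreg_neq0 n : qeval (qregular d n) != 0.
Proof.
elim: n => [|n IH]; first by rewrite /qregular big_geq // qeval1 oner_eq0.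
rewrite qregS qevalM mulf_neq0 //; case: ifP => [_|/negbT]; last exact: qeval_qint_neq0.
by rewrite qeval1 oner_eq0.
Qed.

(** The value of [qint i] depends on [i] modulo [d] only. *)
Lemma qeval_qregD n : (1 < d)%N -> qeval (qregular d (d + n)) = qeval (qregular d d) * qeval (qregular d n).
Proof.
move=> d1; elim: n => [|n IH]; first by rewrite addn0 /qregular [in X in _ * X]big_geq // qeval1 mulr1.
rewrite addnS !qregS !qevalM IH -addnS dvdn_addr //.
case: ifP => _; first by rewrite qeval1; ring.
by rewrite qintD qevalD qevalM qeval_qint_order // add0r qevalX (prim_expr_order prim) mul1r; ring.
Qed.

Lemma qeval_qregM m : (1 < d)%N -> qeval (qregular d (d * m)) = qeval (qregular d d) ^+ m.
Proof.
move=> d1; elim: m => [|m IH]; first by rewrite muln0 /qregular big_geq // qeval1 expr0.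
by rewrite mulnS qeval_qregD // IH exprS.
Qed.

Lemma qeval_qregM1 m : (1 < d)%N -> qeval (qregular d (d * m).+1) = qeval (qregular d d) ^+ m.
Proof.
move=> d1; rewrite -addn1; elim: m => [|m IH].
  rewrite muln0 add0n qregS /qregular big_geq // dvdn1 expr0 qint1 qevalM qeval1 mul1r.
  by case: ifP => _; rewrite qeval1.
by rewrite mulnS -addnA qeval_qregD // IH exprS.
Qed.

Lemma qeval_qmul m : qeval (qcofactor d m) = (m`!)%:R.
Proof.
elim: m => [|m IH]; first by rewrite /qcofactor big_geq // qeval1.
rewrite qmulS qevalM IH factS mulnC natrM; congr (_ * _).
elim: m.+1 => [|k IHk]; first by rewrite big_ord0 qeval0.
by rewrite big_ord_recr qevalD IHk qevalX exprM (prim_expr_order prim) expr1n natr1.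
Qed.

(** After cancellation of [qint d ^+ k], the regular factors of numerator and
    denominator agree at [w], and the others give the binomial coefficient. *)
Lemma qeval_div a b k Q : (1 < d)%N -> (a + b).-1 = (d * k)%N -> (0 < b)%N ->
  (d %| a)%N -> Q * (qfact a * qfact b) = qfact (a + b).-1 ->
  qeval Q = 'C(k, a %/ d)%:R.
Proof.
move=> d1 ab b0 /dvdnP[a' aE] HQ; have d0 : (0 < d)%N by lia.
have ak : (a' <= k)%N by rewrite -(leq_pmul2l d0) -ab; lia.
have bE : b = (d * (k - a')).+1 by rewrite mulnBr; lia.
have ad : (a %/ d = a')%N by rewrite aE mulnK.
have bd : (b %/ d = k - a')%N.
  by rewrite bE -addn1 mulnC divnMDl // divn_small // addn0.
have kd : ((a + b).-1 %/ d = k)%N by rewrite ab mulKn.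
have md : qint d \is monic by case: (d) d0 => // d' _; apply: qint_monic.
have H : Q * (qregular d a * qcofactor d a' * (qregular d b * qcofactor d (k - a'))) = qregular d (d * k) * qcofactor d k.
  apply: (mulIf (monic_neq0 (monic_exp k md))).
  have -> : qint d ^+ k = qint d ^+ a' * qint d ^+ (k - a') by rewrite -exprD subnKC.
  move: HQ; rewrite (qfact_split a d0) (qfact_split b d0) (qfact_split (a + b).-1 d0).
  have -> : qint d ^+ ((a + b).-1 %/ d) = qint d ^+ a' * qint d ^+ (k - a').
    by rewrite kd -exprD subnKC.
  by rewrite ad bd kd ab => <-; ring.
have e0 := qeval_qreg_neq0 d.
move: (congr1 qeval H); rewrite !qevalM !qeval_qmul {1}aE {1}bE [(a' * d)%N]mulnC.
rewrite !qeval_qregM // qeval_qregM1 // ad => {}H.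
apply: (@mulIf _ (qeval (qregular d d) ^+ k * (a'`! * (k - a')`!)%:R)).
  by rewrite mulf_neq0 ?expf_neq0 // pnatr_eq0 -lt0n muln_gt0 !fact_gt0.
rewrite [RHS]mulrCA -natrM bin_fact // -H.
have -> : qeval (qregular d d) ^+ k = qeval (qregular d d) ^+ a' * qeval (qregular d d) ^+ (k - a').
  by rewrite -exprD subnKC.
by rewrite natrM; ring.
Qed.

(** The numerator contains one more factor [qint d] than the denominator. *)
Lemma qeval_ndiv a b k Q : (1 < d)%N -> (a + b).-1 = (d * k)%N -> (0 < a)%N -> (0 < b)%N ->
  ~~ (d %| a)%N -> ~~ (d %| b)%N -> Q * (qfact a * qfact b) = qfact (a + b).-1 ->
  qeval Q = 0.
Proof.
move=> d1 ab a0 b0 da db HQ; have d0 : (0 < d)%N by lia.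
have kd : ((a + b).-1 %/ d = k)%N by rewrite ab mulKn.
have ra : (0 < a %% d)%N by rewrite lt0n.
have rb : (0 < b %% d)%N by rewrite lt0n.
have kE : (k = (a %/ d + b %/ d).+1)%N.
  have := ltn_pmod a d0; have := ltn_pmod b d0.
  have := divn_eq a d; have := divn_eq b d; move: ab a0 ra rb.
  move: (a %/ d)%N (b %/ d)%N (a %% d)%N (b %% d)%N => x y r s ab' a0' r0 s0 bE aE sd rd.
  have E : (d * k = d * (x + y) + (r + s - 1))%N by rewrite mulnDr; lia.
  have lo : (x + y < k)%N by rewrite -(ltn_pmul2l d0) E; lia.
  have hi : (k < (x + y).+2)%N by rewrite -(ltn_pmul2l d0) E !mulnS; lia.
  by lia.
have md : qint d \is monic by case: (d) d0 => // d' _; apply: qint_monic.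
have H : Q * (qregular d a * qcofactor d (a %/ d) * (qregular d b * qcofactor d (b %/ d))) =
    qregular d (d * k) * qcofactor d k * qint d.
  apply: (mulIf (monic_neq0 (monic_exp (a %/ d + b %/ d) md))).
  rewrite -[RHS]mulrA -exprS -kE.
  move: HQ; rewrite (qfact_split a d0) (qfact_split b d0) (qfact_split (a + b).-1 d0).
  by rewrite exprD kd ab => <-; ring.
apply/eqP; move: (congr1 qeval H); rewrite !qevalM qeval_qint_order // mulr0 => /eqP.
have n1 m : (m`!%:R == 0 :> F) = false by rewrite pnatr_eq0; apply/eqP; have := fact_gt0 m; lia.
by rewrite !mulf_eq0 !qeval_qmul !n1 !(negbTE (qeval_qreg_neq0 _)) !orbF.
Qed.

End RootOfUnity.

End QFactorials.

Section Zeta.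
Local Open Scope ring_scope.

Lemma zetaX (R : realType) n k :
  zeta R n ^+ k = (cos (k%:R * (2 * pi / n%:R)) +i* sin (k%:R * (2 * pi / n%:R)))%C.
Proof.
rewrite /zeta; set t := 2 * pi / n%:R.
elim: k => [|k IH]; first by rewrite mul0r cos0 sin0 expr0.
have -> : k.+1%:R * t = t + k%:R * t by rewrite -natr1 mulrDl mul1r addrC.
by rewrite exprS IH cosD sinD; simpc; congr (_ +i* _)%C; ring.
Qed.

(** If the angle [2 * x] has cosine 1 then [sin x = 0], while [0 < x < pi]. *)
Lemma zeta_prim (R : realType) n : (0 < n)%N -> n.-primitive_root (zeta R n).
Proof.
move=> n0; rewrite /primitive_root_of_unity n0; apply/forallP => i.
rewrite unity_rootE zetaX; apply/eqP; apply/eqP/eqP => [|->]; last first.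
  have -> : n%:R * (2 * pi / n%:R) = pi *+ 2 :> R.
    by rewrite mulrC divfK ?pnatr_eq0 -?lt0n // mulr2n mulrDl mul1r.
  by rewrite cos2pi sin2pi.
move=> E; have {E} C : cos (i.+1%:R * (2 * pi / n%:R)) = 1 :> R by case: E.
apply/eqP; rewrite eqn_leq ltn_ord /= leqNgt; apply/negP => lt_in.
pose x : R := i.+1%:R * (pi / n%:R).
have xE : i.+1%:R * (2 * pi / n%:R) = x *+ 2 by rewrite /x mulr2n; ring.
have n0' : 0 < n%:R :> R by rewrite ltr0n.
have /sin_gt0_pi : 0 < x < pi.
  rewrite /x mulr_gt0 ?ltr0n ?divr_gt0 ?pi_gt0 //= mulrA ltr_pdivrMr // mulrC.
  by rewrite ltr_pM2l ?pi_gt0 // ltr_nat.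
move: C; rewrite xE cos_mulr2n => C.
have : sin x ^+ 2 = 0 by rewrite sin2cos2; move: C; set y := cos x ^+ 2; lra.
by move/eqP; rewrite expf_eq0 /= => /eqP->; rewrite ltxx.
Qed.

End Zeta.

(** * Paths above the diagonal of a rectangle *)

Lemma bounds_nth nu : bounds nu = mkseq (fun i => sumn (drop i.+1 nu)) (size nu).-1.
Proof.
elim: nu => // p [|q nu] IH //.
rewrite [LHS]/= -/(bounds (q :: nu)) IH /mkseq /=; congr (_ :: _).
by rewrite (iotaDl 1 0) -map_comp; apply: eq_map.
Qed.

Lemma sumn_telescope (f : nat -> nat) n : (forall i, f i <= f i.+1) ->
  f 0 + sumn (mkseq (fun i => f i.+1 - f i) n) = f n.
Proof.
move=> fi; elim: n => [|n IH]; first by rewrite addn0.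
by rewrite mkseqS sumn_rcons addnA IH subnKC.
Qed.

Lemma promote_comp_pos bs p mu : size mu = size bs ->
  path_of (promote_comp bs (p.+1 :: mu)) = rcons (path_of (p :: mu)) false.
Proof.
elim: bs p mu => [|b bs IH] p [|q mu] //= => [_|[S]].
  by rewrite /path_of /= !cats0 -cats1 -[false :: _]/(nseq p.+1 false) -[p.+1]addn1 nseqD.
have {}IH := IH q mu S; rewrite [in LHS]path_of_cons; last first.
  have : size (promote_comp bs (q.+1 :: mu)) = size (q :: mu).
    elim: bs (q.+1) (q) mu {IH S b} => [|b bs IH] x y [|z mu] //=.
    by case: x => [|x]; rewrite /= (IH _ z).
  by move->.
by rewrite IH [in RHS]path_of_cons // rcons_cat.
Qed.

Section Rational.
Variables a b : nat.
Hypothesis a0 : 0 < a.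
Hypothesis b0 : 0 < b.

Local Notation above := (above a b).
Local Notation jump := (jump a b).
Local Notation promote := (promote a b).

Lemma above_nseq k h : a * k <= h -> above (Posz h) (nseq k false).
Proof.
elim: k h => // k IH h H; rewrite /=; have ah : a <= h by lia.
apply/andP; split; first by rewrite /wt; lia.
have -> : (Posz h + wt a b false)%R = Posz (h - a) by rewrite /wt; lia.
by apply: IH; lia.
Qed.

Lemma wsum_nseq k : wsum a b (nseq k false) = (- Posz (a * k))%R.
Proof. by elim: k => [|k IH] /=; rewrite ?IH /wt; lia. Qed.

(** The bounds given by the lowest path above the diagonal, from row [i] on. *)
Definition diagonal_bounds i m := [seq b - (j * b) %/ a | j <- iota i m].

(** The number [h %/ a] of E steps that can be made from height [h] is the
    margin that the bounds leave. *)
Lemma diagonal_height i h S : h + a * b = i * b + a * S -> i <= a ->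
  b - (i * b) %/ a <= S -> h %/ a = S - (b - (i * b) %/ a).
Proof.
move=> hE ia bS; have E1 := divnMDl b h a0; have E2 := divnMDl S (i * b) a0.
have E : b * a + h = S * a + i * b by lia.
have : (i * b) %/ a <= b.
  by rewrite -[X in _ <= X](mulKn b a0) leq_div2r // leq_mul2r ia orbT.
by rewrite -E E1 in E2; lia.
Qed.

Lemma path_of_nseq k q mu : path_of (k + q :: mu) = nseq k false ++ path_of (q :: mu).
Proof. by elim: k => // k IH; rewrite addSn path_of_E IH. Qed.

Lemma size_promote_comp bs mu : size (promote_comp bs mu) = size mu.
Proof.
elim: bs mu => [|x bs IH] [|p [|q mu]] //=.
by case: p => [|p]; rewrite /= IH.
Qed.

Lemma jump_nseq k h X : a * k <= h ->
  jump (Posz h) (nseq k false ++ X) = nseq k false ++ jump (Posz (h - a * k)) X.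
Proof.
by move=> kh; rewrite jump_cat ?above_nseq // wsum_nseq; congr (_ ++ jump _ _); lia.
Qed.

Lemma jump_true h w : jump (Posz h) (true :: w) = true :: jump (Posz (h + b)) w.
Proof. by []. Qed.

Lemma jump_stop bs q mu h u : h %/ a < q -> size mu = size bs ->
  path_of (q :: mu) = rcons u false ->
  path_of (h %/ a :: promote_comp bs (q - h %/ a :: mu)) = rcons (jump (Posz h) u) false.
Proof.
set k := h %/ a => kq sz pE; have kh : a * k <= h by rewrite mulnC leq_trunc_div.
have [q' qE] : exists q', q = k + q'.+1 by exists (q - k).-1; lia.
rewrite qE addKn path_of_cons ?size_promote_comp // promote_comp_pos //.
move: pE; rewrite qE path_of_nseq path_of_E.
case/lastP: (path_of (q' :: mu)) => [|u' c] uE.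
  have -> : u = nseq k false by apply: (@rcons_injl _ false); rewrite -uE cats1.
  by rewrite -[X in jump _ X]cats0 jump_nseq //= rcons_cat.
move: uE; rewrite -rcons_cons -rcons_cat => /rcons_inj[<- ->].
rewrite jump_nseq // jump_fail ?rcons_cat //.
by have := ltn_ceil h a0; rewrite -/k; lia.
Qed.

Lemma promote_comp_diagonal i m q mu h : i <= a ->
  h + a * b = i * b + a * sumn (q :: mu) ->
  valid (diagonal_bounds i m.+1) [:: 0, q & mu] ->
  promote_comp (diagonal_bounds i m.+1) [:: 0, q & mu] =
  minn q (h %/ a) :: promote_comp (diagonal_bounds i.+1 m) (q - minn q (h %/ a) :: mu).
Proof. by move=> ia hE /andP[V _]; rewrite (diagonal_height hE ia V). Qed.

(** [h] is the height reached when [i] north steps have been read and the steps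
    [q :: mu] remain. *)
Lemma jump_promote_comp i q mu h u : i + size (q :: mu) = a ->
  h + a * b = i * b + a * sumn (q :: mu) -> path_of (q :: mu) = rcons u false ->
  valid (diagonal_bounds i (size (q :: mu))) [:: 0, q & mu] ->
  path_of (promote_comp (diagonal_bounds i (size (q :: mu))) [:: 0, q & mu]) =
  rcons (jump (Posz h) u) false.
Proof.
elim: mu i q h u => [|q' mu IH] i q h u ia hE pE; rewrite [size (_ :: _)]/= => V;
  have ia' : i <= a by [lia | rewrite -ia leq_addr].
  rewrite (promote_comp_diagonal ia' hE V); have hq : h %/ a < q.
    by rewrite ltn_divLR //; move: hE ia; rewrite /= addn0; nia.
  by rewrite (minn_idPr (ltnW hq)); apply: jump_stop.
rewrite (promote_comp_diagonal ia' hE V); have [hq|qh] := ltnP (h %/ a) q.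
  by apply: jump_stop; rewrite //= size_map size_iota.
rewrite subnn.
have kh : a * q <= h by rewrite mulnC -leq_divRL.
move: pE; rewrite path_of_cons //; case/lastP uE: (path_of (q' :: mu)) => [|u' c].
  by rewrite cats1 => /rcons_inj[].
rewrite -rcons_cons -rcons_cat => /rcons_inj[<- cE]; rewrite cE in uE.
rewrite path_of_cons ?size_promote_comp // jump_nseq // rcons_cat; congr (_ ++ _).
rewrite jump_true rcons_cons; congr (_ :: _).
apply: IH => //=.
- by rewrite -ia /= addSnnS.
- by move: hE kh; rewrite /=; nia.
- by case/andP: V.
Qed.

Lemma diagonal_promote mu r : size mu = a.+1 -> sumn mu = b ->
  valid (diagonal_bounds 0 a) mu -> path_of mu = rcons r false ->
  path_of (promote_comp (diagonal_bounds 0 a) mu) = rcons (promote r) false.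
Proof.
case: mu => [|p mu] // [S] E V; have bE : b <= sumn mu.
  by move: V; rewrite -S; case: mu S {E} => [|q mu] /= S; [lia | case/andP; rewrite mul0n div0n subn0].
have p0 : p = 0 by move: E; rewrite /=; lia.
case: mu S E V {bE} => [|q mu] S E V; first by move: a0; rewrite -S.
rewrite p0 in E V *; rewrite path_of_N; case: r => [|c r] [] // <- pE.
have := @jump_promote_comp 0 q mu 0 r S _ pE; rewrite S => -> //.
by move: E; rewrite /= mul0n add0n => ->.
Qed.

End Rational.

Section Lowest.
Variables (a b : nat) (nu : seq nat).
Hypothesis a0 : 0 < a.
Hypothesis b0 : 0 < b.
Hypothesis low : lowest_above_diagonal a b (path_of nu).

Lemma lowest_size : size nu = a.+1.
Proof.
case: low => /andP[/eqP hN _] _ _; case: nu hN => [|p m] hN; first by move: a0; rewrite -hN.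
by rewrite -[LHS](congr1 size (@path_ofK (p :: m) isT)) size_comp hN.
Qed.

Lemma lowest_comp : comp_of (path_of nu) = nu.
Proof. by rewrite path_ofK // lowest_size. Qed.

Lemma lowest_sum : sumn nu = b.
Proof. by case: low => /andP[_ /eqP E] _ _; rewrite -lowest_comp sumn_comp. Qed.

Lemma above_diagonalP p : reflect (forall x y, point p x y -> a * x <= b * y) (above_diagonal a b p).
Proof.
apply: (iffP forallP) => [H x y [k [ks <- <-]]|H i].
  by have := H (Ordinal (ks : k < (size p).+1)).
by apply: H; exists i; rewrite -ltnS ltn_ord.
Qed.

(** The upper bound expresses that the path is above the diagonal; for the lower
    bound, the composition of the integer parts [(j * b) %/ a] is a path above
    the diagonal too. *)
Lemma sumn_take_lowest i : i < a -> sumn (take i.+1 nu) = (i * b) %/ a.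
Proof.
move=> ia; have [/andP[/eqP cN /eqP cE] /above_diagonalP ab min] := low.
apply/eqP; rewrite eqn_leq; apply/andP; split.
  rewrite leq_divRL // [_ * a]mulnC [i * b]mulnC; apply: ab; apply/pointP.
  by rewrite lowest_comp cN (ltnW ia) sumn_take_le // leqnn.
(* The partial sums [f] of the composition of the lowest path. *)
pose f j := (j.-1 * b) %/ a; pose m := mkseq (fun j => f j.+1 - f j) a.+1.
have fS j : f j <= f j.+1 by rewrite leq_div2r // leq_mul2r leq_pred orbT.
have mE j : j <= a.+1 -> sumn (take j m) = f j.
  by move=> ja; rewrite /m /mkseq -map_take take_iota (minn_idPl ja) -(sumn_telescope j fS) /f mul0n div0n.
have mK : comp_of (path_of m) = m by rewrite path_ofK // size_mkseq.
have hN : count_mem true (path_of m) = a by apply/eqP; rewrite -eqSS -size_comp mK size_mkseq.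
have E : count_mem false (path_of m) = b.
  by rewrite -sumn_comp mK -[m]take_size size_mkseq mE // /f mulKn.
have := min (path_of m); rewrite /path_to hN E !eqxx weakly_above_comp ?hN ?E //.
rewrite mK lowest_comp => H.
have -> : (i * b) %/ a = sumn (take i.+1 m) by rewrite mE // ltnS ltnW.
apply: H => //; apply/above_diagonalP => x y /pointP[]; rewrite hN mK => ya.
case/andP=> _; rewrite mE ?ltnS // /f /= => H.
by rewrite mulnC [b * y]mulnC -leq_divRL.
Qed.

Lemma lowest_bounds : bounds nu = diagonal_bounds a b 0 a.
Proof.
rewrite bounds_nth lowest_size; apply/eq_in_map => i; rewrite mem_iota => /andP[_ ia].
by rewrite -(sumn_take_lowest ia) -lowest_sum -{2}(cat_take_drop i.+1 nu) sumn_cat addKn.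
Qed.

Lemma above_diagonalE p : above_diagonal a b p = above a b 0 p.
Proof.
have E i : wsum a b (take i p) = (Posz (b * north p i) - Posz (a * east p i))%R.
  by rewrite wsumE /east /north count_idE count_negbE.
apply/idP/idP => [/above_diagonalP H|H].
  apply: aboveP => i ip; rewrite E.
  by have := H (east p i) (north p i) (ex_intro _ i (And3 ip erefl erefl)); lia.
apply/forallP => i; move: H; rewrite -{1}(cat_take_drop i p) above_cat => /andP[H _].
by have := above_sum (Order.POrderTheory.lexx _) H; rewrite E; lia.
Qed.

Lemma rational_dyckP p : is_dyck nu p <-> path_to a b p /\ above a b 0 p.
Proof.
have [/andP[/eqP cN /eqP cE] /above_diagonalP ab min] := low.
have pE : same_endpoints p (path_of nu) = path_to a b p.
  by rewrite /same_endpoints cN cE andbC.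
rewrite /is_dyck pE -above_diagonalE.
split=> [/andP[-> /weakly_aboveP H]|[P D]].
  split=> //; apply/above_diagonalP => x y /H[y' /ab xy yy].
  by apply: leq_trans xy _; rewrite leq_mul2l yy orbT.
by rewrite P min.
Qed.

(** A path above the diagonal ends with an east step, for the height before its
    last step is nonnegative. *)
Lemma rational_dyck_good p : is_dyck nu p <-> exists2 r, good a b r & p = rcons r false.
Proof.
rewrite rational_dyckP; split=> [[]|[r /andP[/andP[/eqP S /eqP C] P] ->]].
  rewrite /path_to count_idE count_negbE => /andP[/eqP cN /eqP cE].
  case/lastP: p cN cE => [|r c]; first by move=> cN; move: a0; rewrite -cN.
  rewrite -cats1 !count_cat above_cat => cN cE /andP[P /andP[Pc _]].
  have cF : c = false.
    have := above_sum (Order.POrderTheory.lexx _) P.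
    by case: c cN cE {Pc} => //; rewrite GRing.add0r wsumE /=; nia.
  rewrite cF /= in cN cE *; exists r; last by rewrite cats1.
  by rewrite /good /word P size_counts /period; apply/andP; split=> //; apply/andP; split; lia.
have S' : size r = count negb r + count id r by rewrite size_counts.
have E : count negb r = b.-1 by rewrite /period in S; lia.
rewrite /path_to count_idE count_negbE -cats1 !count_cat above_cat P /= C E /=.
rewrite GRing.add0r wsumE C E /wt; split; [lia | apply/andP; split=> //; nia].
Qed.

End Lowest.

(** * Conjugacy of rowmotion and promotion *)

Section Conjugacy.
Variables (a b : nat) (nu delta : seq nat).
Hypothesis a0 : 0 < a.
Hypothesis b0 : 0 < b.
Hypothesis co : coprime a b.
Hypothesis low : lowest_above_diagonal a b (path_of nu).
Hypothesis incr : increment_vector nu delta.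

Local Notation T := (dyck_path nu).
Local Notation s := (rowmotion (@alt_tamari_le nu delta)).
Local Notation bs := (bounds nu).
Local Notation mu x := (comp_of (val (val (x : T)))).
Local Notation n := (period a b).

Let nu0 : 0 < size nu. Proof. by rewrite (lowest_size a0 low). Qed.
Let A : adm delta bs. Proof. exact: bounds_adm. Qed.

(** The conjugating map: the straightened path, without its last east step. *)
Definition theta (x : T) : seq bool := take n (path_of (untwist delta bs (mu x))).

Lemma theta_spec (x : T) : good a b (theta x) /\
  path_of (untwist delta bs (mu x)) = rcons (theta x) false.
Proof.
have [V S] := dyck_valid nu0 x; have [Vu Su] := untwist_valid A V.
have E : comp_of (path_of (untwist delta bs (mu x))) = untwist delta bs (mu x).
  by rewrite path_ofK // (size_valid Vu).
have : is_dyck nu (path_of (untwist delta bs (mu x))).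
  by apply/is_dyckP => //; rewrite E Su.
case/(rational_dyck_good a0 b0 low) => r G rE; rewrite /theta rE.
suff -> : take n (rcons r false) = r by [].
by rewrite -cats1 take_size_cat //; case/andP: G => /andP[/eqP].
Qed.

Lemma theta_inj : injective theta.
Proof.
move=> x y E; have [_ Ex] := theta_spec x; have [_ Ey] := theta_spec y.
rewrite -E -Ex in Ey; have [V S] := dyck_valid nu0 x; have [V' S'] := dyck_valid nu0 y.
apply: dyck_eq; apply: (untwist_inj A V V'); first by rewrite S S'.
have [Vu _] := untwist_valid A V; have [Vu' _] := untwist_valid A V'.
by rewrite -[LHS]path_ofK ?(size_valid Vu) // -[RHS]path_ofK ?(size_valid Vu') // Ey.
Qed.

Lemma theta_row x : theta (s x) = promote a b (theta x).
Proof.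
have [_ E] := theta_spec x; have [_ Es] := theta_spec (s x).
have [V S] := dyck_valid nu0 x; have [Vu Su] := untwist_valid A V.
apply: (@rcons_injl _ false); rewrite -Es rowmotion_path // untwist_row //.
rewrite (lowest_bounds a0 low) in Vu *.
apply: diagonal_promote => //.
- by rewrite (size_valid Vu) size_map size_iota.
- by rewrite -(lowest_bounds a0 low) Su S (lowest_sum a0 low).
- by rewrite -(lowest_bounds a0 low).
Qed.

Lemma theta_iter k x : theta ((s ^+ k)%g x) = iter k (promote a b) (theta x).
Proof. by rewrite permX; elim: k => // k IH; rewrite !iterS theta_row IH. Qed.

Lemma rowmotion_period : (s ^+ n)%g = 1%g.
Proof.
apply/permP => x; apply: theta_inj; rewrite theta_iter perm1.
by apply: promote_period => //; case: (theta_spec x).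
Qed.

Lemma size_theta x : size (theta x) == n.
Proof. by case: (theta_spec x) => /andP[/andP[]]. Qed.

(** As good words followed by an E are paths, there are no more good words than
    paths, and [theta] is injective. *)
Lemma theta_onto : [set Tuple (size_theta x) | x : T] = goods a b.
Proof.
have inj : injective (fun x => Tuple (size_theta x)) by move=> x y [/theta_inj].
apply/eqP; rewrite eqEcard; apply/andP; split.
  by apply/subsetP => _ /imsetP[x _ ->]; rewrite inE; case: (theta_spec x).
rewrite card_imset // -cardsT.
apply: (leq_card_rel (R := fun (r : n.-tuple bool) (x : T) =>
  val (val x) == rcons r false :> seq bool)) => [r|r r' x _ _ /eqP E].
  rewrite inE => G; have D : is_dyck nu (rcons r false).
    by apply/(rational_dyck_good a0 b0 low); exists r.
  have [||x E] := @dyck_ex nu delta nu0 incr (comp_of (rcons r false)).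
    by case/(is_dyckP _ nu0): D.
    by case/(is_dyckP _ nu0): D.
  by exists x => //; apply/eqP/(can_inj comp_ofK).
by rewrite E => /eqP /rcons_inj[/val_inj].
Qed.

Lemma card_rowmotion_fixed k :
  #|[set x | (s ^+ k)%g x == x]| =
  #|[set r : n.-tuple bool | good a b r && (iter k (promote a b) r == r :> seq bool)]|.
Proof.
have inj : injective (fun x => Tuple (size_theta x)) by move=> x y [/theta_inj].
rewrite -(card_imset _ inj); apply: eq_card => r; rewrite inE; apply/imsetP/andP.
  case=> x; rewrite inE => /eqP E ->; split; first by case: (theta_spec x).
  by rewrite /= -theta_iter E.
case=> G /eqP E; have : r \in goods a b by rewrite inE.
rewrite -theta_onto => /imsetP[x _ rE]; exists x => //; rewrite inE.
by apply/eqP/theta_inj; rewrite theta_iter; move: E; rewrite rE.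
Qed.

(** The power of exponent [gcdn k n] is itself a power of the [k]-th one. *)
Lemma fixed_gcdn k :
  [set x | (s ^+ k)%g x == x] = [set x | (s ^+ gcdn k n)%g x == x].
Proof.
have fixX j q x : (s ^+ j)%g x = x -> (s ^+ (j * q))%g x = x.
  by move=> E; rewrite expgM permX; elim: q => // q; rewrite iterS => ->.
apply/setP => x; rewrite !inE; apply/eqP/eqP => [E|E]; last first.
  by rewrite -{1}(divnK (dvdn_gcdl k n)) mulnC fixX.
case: (posnP k) => [->|k0]; first by rewrite gcd0n rowmotion_period perm1.
have [u v uE _] := egcdnP n k0; have := fixX k u x E.
by rewrite mulnC uE expgD mulnC expgM rowmotion_period expg1n mul1g.
Qed.

End Conjugacy.

Section Evaluation.
Local Open Scope ring_scope.

Lemma qeval_qfact1 (F : numFieldType) m : qeval (1 : F) (qfact m) = (m`!)%:R.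
Proof.
elim: m => [|m IH]; first by rewrite qfact0 qeval1.
rewrite qfactS qevalM IH factS mulnC natrM qeval_qint; congr (_ * _).
rewrite (eq_bigr (fun=> 1)) => [|i _]; last by rewrite expr1n.
by rewrite sumr_const card_ord.
Qed.

Lemma qeval_qCatalan1 (F : numFieldType) a b : (0 < a)%N -> (0 < b)%N -> coprime a b ->
  qeval (1 : F) (qCatalan a b) = #|goods a b|%:R.
Proof.
move=> a0 b0 co; have := congr1 (qeval (1 : F)) (qCatalanP a0 b0 co).
rewrite !qevalM !qeval_qfact1 => E.
have f0 : ((a`! * b`!)%N%:R : F) != 0 by rewrite pnatr_eq0 -lt0n muln_gt0 !fact_gt0.
apply: (mulIf f0); rewrite natrM E -!natrM; congr _%:R.
have ab0 : (0 < a + b)%N by rewrite addn_gt0 a0.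
apply/eqP; rewrite -(eqn_pmul2l ab0) mulnA card_goods //; apply/eqP.
have := bin_fact (leq_addr b a); rewrite addKn => ->.
by case: (a + b)%N ab0 => // m _; rewrite factS.
Qed.

End Evaluation.

Theorem theorem5p1 (R : realType) (a b : nat) (nu delta : seq nat) :
  0 < a -> a < b -> coprime a b ->
  lowest_above_diagonal a b (path_of nu) ->
  increment_vector nu delta ->
  #[rowmotion (@alt_tamari_le nu delta)]%g %| a + b - 1 /\
  cyclic_sieving R (a + b - 1) (rowmotion (@alt_tamari_le nu delta))
    (qCatalan a b).
Proof.
move=> a0 ab co low incr; have b0 : (0 < b) := leq_ltn_trans (leq0n a) ab.
rewrite subn1 -/(period a b).
have ord : (#[rowmotion (@alt_tamari_le nu delta)]%g %| period a b).
  by rewrite order_dvdn; apply/eqP/(rowmotion_period a0 b0 co low incr).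
split=> //; split=> // k; have n0 : (0 < period a b) := n_gt0 co a0 b0.
rewrite (fixed_gcdn a0 b0 co low incr) (card_rowmotion_fixed a0 b0 low incr).
have := exp_prim_root (zeta_prim R n0) k; set w := (zeta R _ ^+ k)%R.
set g := gcdn k _; set d := (_ %/ g) => prim; rewrite -/(qeval w (qCatalan a b)).
have nE : period a b = (d * g) by rewrite divnK // dvdn_gcdr.
(* If [d = 1] then [k] is a multiple of the period. *)
have [d1|d1] := leqP d 1.
  have {}d1 : d = 1 by have := prim_order_gt0 prim; lia.
  have w1 : w = 1%R by rewrite -[w]expr1 -d1 (prim_expr_order prim).
  rewrite w1 qeval_qCatalan1 //; congr (_%:R)%R; apply: eq_card => r; rewrite !inE.
  rewrite (_ : g = period a b); last by rewrite nE d1 mul1n.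
  case: (boolP (good a b r)) => // G.
  by rewrite promote_period // eqxx.
rewrite (card_fixed co a0 b0 nE d1); have QP := qCatalanP a0 b0 co.
case: ifP => [da|/negbT da]; first by rewrite (qeval_div prim d1 nE b0 da QP).
case: ifP => [db|/negbT db]; last by rewrite (qeval_ndiv prim d1 nE a0 b0 da db QP).
have nE' : (b + a).-1 = (d * g) by rewrite addnC.
rewrite addnC [(qfact a * _)%R]mulrC in QP.
by rewrite (qeval_div prim d1 nE' a0 db QP).
Qed.
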